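(* Let $G$ be any one of the six (pairwise non-isomorphic) non-trivial snarks on $20$ vertices (these include the flower snark $J_5$). Then a $G$ design of order $n$ exists if and only if $n \equiv 1, 16, 25$ or $40 \pmod{60}$ and $n \neq 16$.
   Context: All graphs are simple. A snark is a connected, bridgeless 3-regular graph with chromatic index 4. A snark is non-trivial if it has girth at least 5 and there are no three edges whose deletion yields a disconnected graph each of whose components is non-trivial (has at least one edge). Up to isomorphism there are exactly six non-trivial snarks on 20 vertices. For a graph $G$, a $G$ design of order $n$ is a partition of the edge set of the complete graph $K_n$ into edge sets of subgraphs each isomorphic to $G$. By convention the empty set is a $G$ design of order $1$. *)

(* Defs.v *)
From mathcomp Require Import all_boot.

Set Implicit Arguments.
Unset Strict Implicit.
Unset Printing Implicit Defensive.

Record sgraph := SGraph {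
  vertex :> finType;
  adj : rel vertex;
  adj_sym : symmetric adj;
  adj_irrefl : irreflexive adj
}.

Definition edges (G : sgraph) : {set {set G}} :=
  [set [set p.1; p.2] | p : G * G & adj p.1 p.2].

Section Delete.
Variables (G : sgraph) (S : {set {set G}}).

Definition delete_adj : rel G :=
  fun x y => adj x y && ([set x; y] \notin S).

Lemma delete_adj_sym : symmetric delete_adj.
Proof. by move=> x y; rewrite /delete_adj adj_sym setUC. Qed.

Lemma delete_adj_irrefl : irreflexive delete_adj.
Proof. by move=> x; rewrite /delete_adj adj_irrefl. Qed.

Definition delete_edges : sgraph := SGraph delete_adj_sym delete_adj_irrefl.

End Delete.

Definition components (G : sgraph) : {set {set G}} :=
  equivalence_partition (connect (@adj G)) [set: G].

Definition connected (G : sgraph) : Prop :=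
  forall x y : G, connect (@adj G) x y.

Definition is_bridge (G : sgraph) (e : {set G}) : Prop :=
  e \in edges G /\ #|components G| < #|components (delete_edges [set e])|.

Definition bridgeless (G : sgraph) : Prop := forall e : {set G}, ~ is_bridge e.

Definition regular (k : nat) (G : sgraph) : Prop :=
  forall x : G, #|[set y | adj x y]| = k.

Definition edge_colourable (G : sgraph) (k : nat) : Prop :=
  exists c : {set G} -> nat,
    (forall e, e \in edges G -> c e < k) /\
    (forall e f, e \in edges G -> f \in edges G ->
       e != f -> e :&: f != set0 -> c e != c f).

Definition has_chromatic_index (G : sgraph) (k : nat) : Prop :=
  edge_colourable G k /\ forall j, edge_colourable G j -> k <= j.

Definition girth_at_least (g : nat) (G : sgraph) : Prop :=
  forall c : seq G, 2 < size c -> ucycle (@adj G) c -> g <= size c.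

Definition snark (G : sgraph) : Prop :=
  [/\ connected G, bridgeless G, regular 3 G & has_chromatic_index G 4].

Definition nontrivial_component (G : sgraph) (C : {set G}) : Prop :=
  exists2 e, e \in edges G & e \subset C.

Definition nontrivial_snark (G : sgraph) : Prop :=
  [/\ snark G, girth_at_least 5 G &
    ~ exists S : {set {set G}},
        [/\ S \subset edges G, #|S| = 3, ~ connected (delete_edges S) &
          forall C, C \in components (delete_edges S) ->
            nontrivial_component (G := delete_edges S) C]].

Section Complete.
Variable n : nat.

Definition complete_adj : rel 'I_n := fun x y => x != y.

Lemma complete_adj_sym : symmetric complete_adj.
Proof. by move=> x y; rewrite /complete_adj eq_sym. Qed.

Lemma complete_adj_irrefl : irreflexive complete_adj.
Proof. by move=> x; rewrite /complete_adj eqxx. Qed.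

Definition complete_graph : sgraph :=
  SGraph complete_adj_sym complete_adj_irrefl.

End Complete.

Definition is_subgraph (H : sgraph) (W : {set H}) (F : {set {set H}}) : Prop :=
  F \subset edges H /\ forall e, e \in F -> e \subset W.

Definition isomorphic_to (G H : sgraph) (W : {set H}) (F : {set {set H}}) :
    Prop :=
  exists f : G -> H,
    [/\ injective f, f @: [set: G] = W &
      forall x y : G, adj x y = ([set f x; f y] \in F)].

Definition is_design (G : sgraph) (n : nat)
    (D : {set {set {set complete_graph n}}}) : Prop :=
  partition D (edges (complete_graph n)) /\
  forall F, F \in D ->
    exists W : {set complete_graph n}, is_subgraph W F /\ isomorphic_to G W F.

(* Main.v *)
(* Necessity is counting: every point meets each block in 0 or 3 edges and a block has 60
   incidences, so 3 divides n - 1 and 60 divides n (n - 1); a block needs 20 points, which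
   excludes n = 16.

   For sufficiency, the six snarks are first made explicit. A cubic graph on 20 vertices of girth
   at least 5 is grown vertex by vertex from a small subgraph that it must contain: two pentagons
   sharing a path of length two, else two pentagons sharing an edge, else a pentagon with its five
   pendant edges, else a hexagon, else the tree of the vertices at distance at most two from an
   edge. Each graph so generated is 3-edge-coloured, or contains one of six snarks, or contains
   the Petersen graph minus a vertex, whose boundary is a 3-edge cut.

   For each of the six, K_n is split along a triple system on Z/M x Z/3 whose lines are
   {(x, i), (y, i), ((x + y)/2, i + 1)}, and whose points are blown up: the points over x = 0
   become fibres of sizes 1, w1 and w2, all others fibres of size 30, and a fibre at infinity
   meets the lines given by x = y. The resulting complete multipartite graphs, and K_m for
   finitely many m, are decomposed by developing base blocks under a cyclic group. It is enough
   that every pair is covered: since the number of blocks is n (n - 1) / 60, no pair can be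
   covered twice. *)

From HB Require Import structures.
From Stdlib Require Import BinNat.
From mathcomp Require Import all_boot zify.
Require Import Defs.

Set Implicit Arguments.
Unset Strict Implicit.
Unset Printing Implicit Defensive.

(** * Cubic graphs *)

Section Graphs.
Variable G : sgraph.
Implicit Types (x y z : G) (A B U : {set G}).

Definition triangle_free := forall x y z : G, adj x y -> adj y z -> ~~ adj z x.

Definition square_free := forall x y a b : G,
  adj x a -> adj x b -> adj y a -> adj y b -> a != b -> x = y.

Lemma adj_neq x y : adj x y -> x != y.
Proof. by apply: contraTneq => ->; rewrite adj_irrefl. Qed.

Lemma girth5_triangle_free : girth_at_least 5 G -> triangle_free.
Proof.
move=> g5 x y z xy yz; apply/negP => zx.
suff /(g5 [:: x; y; z] isT) : ucycle (@adj G) [:: x; y; z] by [].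
by apply/andP; rewrite /= !inE xy yz zx negb_or (eq_sym x z) !adj_neq.
Qed.

Lemma girth5_square_free : girth_at_least 5 G -> square_free.
Proof.
move=> g5 x y a b xa xb ya yb ab; apply: contraTeq isT => xy.
suff /(g5 [:: x; a; y; b] isT) : ucycle (@adj G) [:: x; a; y; b] by [].
apply/andP; rewrite /= !inE !negb_or xy ab (adj_sym a) (adj_sym b) xa xb ya yb.
by rewrite (eq_sym a y) !adj_neq.
Qed.

Definition degree_in B x := #|[set y in B | adj x y]|.

Definition arcs A B := \sum_(x in A) degree_in B x.

Lemma degree_inE B x : degree_in B x = \sum_(y in B) adj x y.
Proof.
rewrite /degree_in -sum1dep_card big_mkcondr.
by apply: eq_bigr => y _; case: (adj x y).
Qed.

Lemma arcsC A B : arcs A B = arcs B A.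
Proof.
rewrite /arcs (eq_bigr _ (fun x _ => degree_inE B x)) exchange_big /=.
by apply: eq_bigr => y _; rewrite degree_inE; apply: eq_bigr => x _; rewrite adj_sym.
Qed.

Lemma degree_inD1 U x y : x \in U ->
  degree_in U y = adj y x + degree_in (U :\ x) y.
Proof. by move=> xU; rewrite !degree_inE (big_setD1 x). Qed.

Lemma arcsD1 U x : x \in U ->
  arcs U U = arcs (U :\ x) (U :\ x) + (degree_in U x).*2.
Proof.
move=> xU; rewrite /arcs (big_setD1 x) //= (eq_bigr _ (fun y _ => degree_inD1 y xU)).
rewrite big_split /= [\sum_(y in U :\ x) (adj y x : nat)](_ : _ = degree_in U x).
  by rewrite addnA addnn addnC.
rewrite (degree_inD1 x xU) adj_irrefl degree_inE.
by apply: eq_bigr => y _; rewrite adj_sym.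
Qed.

Lemma arcs_le U : arcs U U <= #|U| * #|U|.-1.
Proof.
rewrite -sum_nat_const; apply: leq_sum => x xU; rewrite (cardsD1 x) xU /=.
apply/subset_leq_card/subsetP => y; rewrite !inE => /andP[-> xy].
by rewrite eq_sym adj_neq.
Qed.

Hypothesis cubic : regular 3 G.

Lemma degree_inC B x : degree_in B x + degree_in (~: B) x = 3.
Proof.
rewrite -(cubic x) -(cardsID B [set y | adj x y]); congr (_ + _).
  by apply: eq_card => y; rewrite !inE andbC.
by apply: eq_card => y; rewrite !inE.
Qed.

Lemma arcs_setC U : arcs U U + arcs (~: U) U = 3 * #|U|.
Proof.
rewrite (arcsC (~: U)) -big_split /= (eq_bigr _ (fun x _ => degree_inC U x)).
by rewrite sum_nat_const mulnC.
Qed.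

Lemma nbrs_exhausted x y (s : seq G) :
  uniq s -> 2 < size s -> {in s, forall z, adj x z} -> adj x y -> y \in s.
Proof.
move=> us s3 sx xy; have sub : {subset s <= enum [set z | adj x z]}.
  by move=> z zs; rewrite mem_enum inE sx.
have [|_ ->] := uniq_min_size us sub; first by rewrite -cardE cubic.
by rewrite mem_enum inE.
Qed.

Lemma other_nbr x (s : seq G) : size s < 3 -> exists2 y, adj x y & y \notin s.
Proof.
move=> s3; have /subsetPn[y] : ~~ ([set y | adj x y] \subset s).
  apply/negP => /subset_leq_card; rewrite cubic => /leq_trans/(_ (card_size s)).
  by rewrite leqNgt s3.
by rewrite inE; exists y.
Qed.

End Graphs.

(** * Labelled graphs as tables *)

(* Constant constructors keep the comparison of labels cheap in the searches below. *)
Inductive label :=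
  L0|L1|L2|L3|L4|L5|L6|L7|L8|L9|L10|L11|L12|L13|L14|L15|L16|L17|L18|L19.

Definition label_eqb (a b : label) : bool :=
  match a, b with
  | L0,L0|L1,L1|L2,L2|L3,L3|L4,L4|L5,L5|L6,L6|L7,L7|L8,L8|L9,L9
  | L10,L10|L11,L11|L12,L12|L13,L13|L14,L14|L15,L15|L16,L16|L17,L17
  | L18,L18|L19,L19 => true
  | _, _ => false
  end.

Definition labels : seq label :=
  [:: L0;L1;L2;L3;L4;L5;L6;L7;L8;L9;L10;L11;L12;L13;L14;L15;L16;L17;L18;L19].

Definition label_index (a : label) : nat := find (label_eqb a) labels.

Lemma label_indexK : cancel label_index (nth L0 labels).
Proof. by case. Qed.

HB.instance Definition _ := Countable.copy label (can_type label_indexK).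

Lemma labels_enum : Finite.axiom labels.
Proof. by case. Qed.

HB.instance Definition _ := isFinite.Build label labels_enum.

Lemma mem_labels a : a \in labels.
Proof. by case: a. Qed.

Lemma card_label : #|{: label}| = 20.
Proof. by rewrite cardT enumT unlock. Qed.

Fixpoint in_labels (a : label) (s : seq label) : bool :=
  if s is b :: s' then if label_eqb a b then true else in_labels a s' else false.

Fixpoint disjoint_labels (s t : seq label) : bool :=
  if s is a :: s' then if in_labels a t then false else disjoint_labels s' t
  else true.

Lemma label_eqE a b : label_eqb a b = (a == b).
Proof. by case: a; case: b. Qed.

Lemma in_labelsE a s : in_labels a s = (a \in s).
Proof. by elim: s => //= b s ->; rewrite inE label_eqE; case: eqP. Qed.

Lemma disjoint_labelsE s t : disjoint_labels s t = ~~ has (mem t) s.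
Proof. by elim: s => //= a s ->; rewrite in_labelsE negb_or; case: (a \in t). Qed.

Fixpoint lookup (A : Type) (d : A) (m : seq (label * A)) (a : label) : A :=
  if m is x :: m' then if label_eqb a x.1 then x.2 else lookup d m' a else d.

Lemma lookup_in (A : eqType) (d : A) m a :
  a \in unzip1 m -> (a, lookup d m a) \in m.
Proof.
elim: m => //= x m IH; rewrite inE label_eqE; case: eqP => [->|_] /= am.
  by rewrite -surjective_pairing mem_head.
by rewrite inE IH ?orbT.
Qed.

Lemma lookup_out (A : Type) (d : A) m a : a \notin unzip1 m -> lookup d m a = d.
Proof.
by elim: m => //= x m IH; rewrite inE label_eqE negb_or => /andP[/negPf-> /IH].
Qed.

Definition row := (label * seq label)%type.
Definition table := seq row.

Definition linked (t : table) (a b : label) : bool :=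
  if in_labels b (lookup [::] t a) then true else in_labels a (lookup [::] t b).

Definition nbrs (t : table) (a : label) : seq label := [seq b <- labels | linked t a b].

(* Each row lists neighbours of its label in later rows: tables grow at the front. *)
Fixpoint well_formed (t : table) : bool :=
  if t is r :: t' then
    [&& r.1 \notin unzip1 t', uniq r.2, all (mem (unzip1 t')) r.2 & well_formed t']
  else true.

Lemma linkedE t a b : linked t a b = (b \in lookup [::] t a) || (a \in lookup [::] t b).
Proof. by rewrite /linked !in_labelsE. Qed.

Lemma linkedC t a b : linked t a b = linked t b a.
Proof. by rewrite !linkedE orbC. Qed.

Lemma mem_nbrs t a b : (b \in nbrs t a) = linked t a b.
Proof. by rewrite mem_filter mem_labels andbT. Qed.

Lemma uniq_nbrs t a : uniq (nbrs t a).
Proof. exact: filter_uniq. Qed.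

Lemma well_formed_uniq t : well_formed t -> uniq (unzip1 t).
Proof. by elim: t => //= r t IH /and4P[-> _ _ /IH]. Qed.

Lemma well_formed_lookup t a :
  well_formed t -> {subset lookup [::] t a <= unzip1 t}.
Proof.
elim: t => //= r t IH /and4P[_ _ /allP rt /IH ta] b; case: ifP => _.
  by move/rt => bt; rewrite inE [_ \in _]bt orbT.
by move/ta => bt; rewrite inE bt orbT.
Qed.

Lemma linked_keys t a b : well_formed t -> linked t a b ->
  a \in unzip1 t /\ b \in unzip1 t.
Proof.
move=> wf; wlog ab : a b / b \in lookup [::] t a.
  move=> W; rewrite linkedE => /orP[] ab; first by apply: W; rewrite ?linkedE ab.
  by apply/and_comm/W; rewrite ?linkedE ab.
move=> _; split; last exact: well_formed_lookup ab.
by apply: contraLR ab => aN; rewrite lookup_out.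
Qed.

Lemma linked_cons w S t a b : well_formed ((w, S) :: t) ->
  a \in unzip1 t -> linked ((w, S) :: t) a b = if b == w then a \in S else linked t a b.
Proof.
case/and4P => wt _ _ wf aT; have aw : a != w by apply: contraNneq wt => <-.
rewrite !linkedE /= !label_eqE (negPf aw).
case: (b =P w) => [->|/eqP bw]; last by [].
by rewrite (negPf (contra (@well_formed_lookup t a wf w) wt)).
Qed.

Lemma linked_irrefl t a : well_formed t -> linked t a a = false.
Proof.
elim: t => //= -[w S] t IH wf; have /and4P[wt _ /allP St wf'] := wf.
have [at_|aN] := boolP (a \in unzip1 t).
  by rewrite (linked_cons _ wf) // ifN ?IH //; apply: contraNneq wt => <-.
apply/negbTE/negP; rewrite linkedE orbb /= label_eqE; case: eqP => [-> /St|_].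
  by rewrite inE (negPf wt).
by move=> /(well_formed_lookup wf'); rewrite (negPf aN).
Qed.

(** * Exhaustive generation *)

Section Search.
Variables (joinable : table -> row -> row -> bool) (leaf : table -> bool).

(* The sets of labels in [C] that a new vertex may be joined to besides its first
   neighbour, as far as pairs can tell. *)
Fixpoint small_subsets (cs C : table) : seq (seq label) :=
  if C is a :: C' then
    [:: a.1] :: [seq [:: a.1; b.1] | b <- C' & joinable cs a b]
      ++ small_subsets cs C'
  else [::].

Definition choices (cs : table) (u : row) (D : table) : seq (seq label) :=
  [::] :: small_subsets cs [seq a <- D | joinable cs u a].

Definition is_open (r : row) : bool :=
  if r.2 is [:: _, _, _ & _] then false else true.

Definition link (w : label) (S : seq label) (r : row) : row :=
  if in_labels r.1 S then (r.1, w :: r.2) else r.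

Definition attach (w : label) (S : seq label) (D : table) : table :=
  [seq r <- rcons [seq link w S r | r <- D] (w, S) | is_open r].

Definition spannable (ws : seq label) (d : nat) : bool :=
  match ws with
  | [::] | [:: _] => d == 0
  | [:: _; _] => d <= 2
  | _ => true
  end.

Fixpoint all_pairs (A : Type) (P : A -> A -> bool) (s : seq A) : bool :=
  if s is x :: s' then all (P x) s && all_pairs P s' else true.

(* In [search], [cs] is the table of the vertices placed so far and [D] lists those of
   degree less than 3 with all their neighbours; [d] is the sum of the degrees in the graph
   induced on the vertices that remain to be placed. A vertex with [s] neighbours among the
   placed ones changes [d] to [d + 2 * s - 6]. *)
Definition place_one (continue : nat -> table -> table -> bool) (w : label)
    (todo : seq label) (d : nat) (u : row) (D cs : table) (T : seq label) : bool :=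
  if d + (size T).*2 is d1.+4 then
    if spannable todo d1 then
      let S := u.1 :: T in continue d1 (attach w S (u :: D)) ((w, S) :: cs)
    else true
  else true.

Definition place_two (continue : nat -> table -> table -> bool) (w w' : label)
    (todo : seq label) (d : nat) (u : row) (D cs : table) (T T' : seq label) : bool :=
  if d + (size T).*2 is d1.+4 then
    if d1 + (size T').*2 is d2.+4 then
      if spannable todo d2 then
        if disjoint_labels T T' then
          let S := u.1 :: T in let S' := u.1 :: T' in
          continue d2 (attach w' S' (attach w S (u :: D))) [:: (w', S'), (w, S) & cs]
        else true
      else true
    else true
  else true.

(* The first vertex of [D] receives all its missing neighbours at once; if there are two,
   they form an unordered pair. *)
Fixpoint search (todo : seq label) (d : nat) (D cs : table) {struct todo} : bool :=
  match todo, D with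
  | [::], [::] => leaf cs
  | w :: todo1, u :: D1 =>
    match u.2 with
    | [:: _; _] => all (place_one (search todo1) w todo1 d u D1 cs) (choices cs u D1)
    | [:: _] =>
      if todo1 is w' :: todo2 then
        all_pairs (place_two (search todo2) w w' todo2 d u D1 cs) (choices cs u D1)
      else true
    | _ => false
    end
  | _, _ => true
  end.

End Search.

Definition unplaced (t : table) : seq label := [seq a <- labels | ~~ in_labels a (unzip1 t)].

Definition open_rows (t : table) : table :=
  [seq r <- [seq (a, nbrs t a) | a <- rev (unzip1 t)] | is_open r].

Definition missing (t : table) : nat := sumn [seq 3 - size (nbrs t a) | a <- unzip1 t].

Definition search_from joinable leaf (t : table) : bool :=
  search joinable leaf (unplaced t) (3 * size (unplaced t) - missing t) (open_rows t) t.

(** * Edge colouring *)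

Inductive colour := Red | Green | Blue.

Definition palette := (bool * bool * bool)%type.

Definition uses (p : palette) (c : colour) : bool :=
  let: (r, g, b) := p in match c with Red => r | Green => g | Blue => b end.

Definition add_colour (c : colour) (p : palette) : palette :=
  let: (r, g, b) := p in
  match c with
  | Red => (true, g, b) | Green => (r, true, b) | Blue => (r, g, true)
  end.

Definition palettes := seq (label * palette).

Fixpoint paint (a : label) (c : colour) (l : palettes) (k : palettes -> bool)
    {struct l} : bool :=
  if l is x :: l' then
    if label_eqb a x.1 then
      if uses x.2 c then false else k ((x.1, add_colour c x.2) :: l')
    else paint a c l' (fun l2 => k (x :: l2))
  else false.

Fixpoint colour_row (p : palette) (S : seq label) (l : palettes)
    (k : palettes -> bool) : bool :=
  if S is a :: S' then
    let try c :=
      if uses p c then false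
      else paint a c l (fun l' => colour_row (add_colour c p) S' l' k) in
    if try Red then true else if try Green then true else try Blue
  else k l.

Fixpoint colour_rows (cs : table) (l : palettes) {struct cs} : bool :=
  match cs, l with
  | r :: cs', x :: l' => colour_row x.2 r.2 l' (colour_rows cs')
  | _, _ => true
  end.

Definition three_colourable (cs : table) : bool :=
  colour_rows cs [seq (r.1, (false, false, false)) | r <- cs].

(** * Embeddings *)

Fixpoint first_nonempty (A B : Type) (f : A -> seq B) (s : seq A) : seq B :=
  if s is x :: s' then if f x is y :: r then y :: r else first_nonempty f s'
  else [::].

Fixpoint find_embedding (nb t : table) (f : seq (label * label)) : seq (label * label) :=
  if t is r :: t' then
    first_nonempty (fun a =>
      if in_labels a (unzip2 f) then [::]
      else if all (fun b => in_labels (lookup L0 f b) (lookup [::] nb a)) r.2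
      then find_embedding nb t' ((r.1, a) :: f) else [::])
      (if r.2 is b :: _ then lookup [::] nb (lookup L0 f b) else unzip1 nb)
  else f.

Definition is_embedding (g t : table) (f : label -> label) : bool :=
  [&& uniq [seq f a | a <- unzip1 t], all (mem (unzip1 g)) [seq f a | a <- unzip1 t] &
    all (fun r => all (fun b => linked g (f r.1) (f b)) r.2) t].

Definition embeds (t g : table) : bool :=
  let f := find_embedding [seq (a, nbrs g a) | a <- unzip1 g] (rev t) [::] in
  is_embedding g t (lookup L0 f).

(* [find], unlike [has], stops at the first success under call by value. *)
Definition colourable_or_embeds (ts : seq table) (cs : table) : bool :=
  if three_colourable cs then true else find (embeds^~ cs) ts < size ts.

(** * Pruning rules *)

Definition joinable_girth5 (a b : row) : bool :=
  if in_labels b.1 a.2 then false else disjoint_labels a.2 b.2.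

Definition joinable_avoiding (F : table) (cs : table) (a b : row) : bool :=
  if joinable_girth5 a b then ~~ in_labels b.1 (lookup [::] F a.1) else false.

Definition joinable_girth6 (cs : table) (a b : row) : bool :=
  if joinable_girth5 a b then
    all (fun x => all (fun y => ~~ linked cs x y) b.2) a.2
  else false.

Lemma is_openE r : is_open r = (size r.2 < 3).
Proof. by rewrite /is_open; case: (r.2) => [|? [|? [|? ?]]]. Qed.

Lemma link_fst w S r : (link w S r).1 = r.1.
Proof. by rewrite /link; case: ifP. Qed.

Lemma unzip1_link w S D : unzip1 [seq link w S r | r <- D] = unzip1 D.
Proof. by rewrite /unzip1 -map_comp; apply: eq_map => r /=; apply: link_fst. Qed.

Lemma attach_subseq w S D : subseq (unzip1 (attach w S D)) (rcons (unzip1 D) w).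
Proof.
rewrite -(unzip1_link w S D) -(map_rcons fst _ (w, S)).
by apply: map_subseq; apply: filter_subseq.
Qed.

Lemma mem_attach w S D r : r \in attach w S D ->
  is_open r /\ (r = (w, S) \/ exists2 r0, r0 \in D & r = link w S r0).
Proof.
rewrite mem_filter mem_rcons inE => /andP[-> /orP[/eqP->|/mapP[r0 r0D ->]]]; split=> //.
  by left.
by right; exists r0.
Qed.

Lemma attach_open w S D r : r \in D -> is_open (link w S r) -> r.1 \in unzip1 (attach w S D).
Proof.
move=> rD or; rewrite -(link_fst w S r); apply: map_f.
by rewrite mem_filter or mem_rcons inE map_f ?orbT.
Qed.

Lemma attach_new w S D : is_open (w, S) -> w \in unzip1 (attach w S D).
Proof. by move=> oS; apply/mapP; exists (w, S); rewrite // mem_filter oS mem_rcons mem_head. Qed.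

Lemma all_pairsP (A : eqType) (P : A -> A -> bool) s x y :
  all_pairs P s -> x \in s -> y \in s -> P x y || P y x.
Proof.
elim: s => //= a s IH /andP[/andP[Paa Pa] Ps].
rewrite !inE => /orP[/eqP->|xs] /orP[/eqP->|ys]; rewrite ?Paa ?(allP Pa) ?orbT //.
exact: IH.
Qed.

Lemma mem_small_subsets (joinable : table -> row -> row -> bool) cs (s C : table) :
  subseq s C -> size s <= 2 -> (forall a b, s = [:: a; b] -> joinable cs a b) ->
  unzip1 s \in [::] :: small_subsets joinable cs C.
Proof.
elim: C s => [|a C IH] s; first by move/eqP->.
case: s => [|b s] //=; case: eqP => [-> sC|_ bsC] s2 ok; last first.
  by have := IH _ bsC s2 ok; rewrite !inE mem_cat => /orP[//|->]; rewrite !orbT.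
case: s sC s2 ok => [|c [|//]] cC _ ok; first by rewrite !inE eqxx.
rewrite !inE mem_cat; apply/or3P; constructor 3; apply/orP; left.
by apply/mapP; exists c; rewrite // mem_filter ok //= -sub1seq.
Qed.

Definition upd (A : Type) (env : label -> A) w x := fun a => if a == w then x else env a.

Lemma upd_eq A (env : label -> A) w x : upd env w x w = x.
Proof. by rewrite /upd eqxx. Qed.

Lemma upd_neq A (env : label -> A) w x a : a != w -> upd env w x a = env a.
Proof. by rewrite /upd => /negPf->. Qed.

Section Placement.
Variable G : sgraph.
Implicit Types (env : label -> G) (cs D : table) (todo S : seq label).

Definition placed env cs : {set G} := [set env a | a in unzip1 cs].

Record placement env todo (d : nat) D cs : Prop := Placement {
  placement_keys : uniq (unzip1 cs ++ todo);
  placement_size : size cs + size todo = #|G|;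
  placement_wf : well_formed cs;
  placement_inj : {in unzip1 cs &, injective env};
  placement_adj : {in unzip1 cs &, forall a b, linked cs a b = adj (env a) (env b)};
  placement_rows : forall r, r \in D ->
    [/\ r.1 \in unzip1 cs, uniq r.2, size r.2 < 3 &
      forall b, (b \in r.2) = (b \in unzip1 cs) && adj (env r.1) (env b)];
  placement_uniq_rows : uniq (unzip1 D);
  placement_closed : forall a, a \in unzip1 cs -> a \notin unzip1 D ->
    forall x, adj (env a) x -> x \in placed env cs;
  placement_arcs : arcs (~: placed env cs) (~: placed env cs) = d
}.

Definition free_nbrs env D x : seq label := [seq b <- unzip1 D | adj x (env b)].

Hypothesis cubic : regular 3 G.

Section Facts.
Variables (env : label -> G) (todo : seq label) (d : nat) (D cs : table).
Hypothesis I : placement env todo d D cs.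

Lemma placed_key b : b \in unzip1 cs -> env b \in placed env cs.
Proof. exact: imset_f. Qed.

Lemma unplaced_neq x b : x \notin placed env cs -> b \in unzip1 cs -> x != env b.
Proof. by move=> xN bc; apply: contraNneq xN => ->; apply: placed_key. Qed.

Lemma row_key a : a \in unzip1 D -> a \in unzip1 cs.
Proof. by case/mapP=> r rD ->; case: (placement_rows I rD). Qed.

Lemma mem_free_nbrs x b : x \notin placed env cs -> b \in unzip1 cs ->
  (b \in free_nbrs env D x) = adj x (env b).
Proof.
move=> xN bc; rewrite mem_filter; case xb: (adj x (env b)) => //=.
apply: contraNT xN => bD; apply: (placement_closed I bc bD); by rewrite adj_sym.
Qed.

Lemma uniq_free_nbrs x : uniq (free_nbrs env D x).
Proof. exact/filter_uniq/(placement_uniq_rows I). Qed.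

Lemma free_nbrs_key x b : b \in free_nbrs env D x -> b \in unzip1 cs.
Proof. by rewrite mem_filter => /andP[_ /row_key]. Qed.

Lemma uniq_map_env s : uniq s -> {subset s <= unzip1 cs} -> uniq [seq env b | b <- s].
Proof.
by move=> us sc; rewrite map_inj_in_uniq // => b c /sc bc /sc cc; apply: (placement_inj I).
Qed.

Lemma size_free_nbrs x : x \notin placed env cs ->
  size (free_nbrs env D x) = degree_in (placed env cs) x.
Proof.
move=> xN; rewrite -(size_map env).
have uF : uniq [seq env b | b <- free_nbrs env D x].
  by apply: uniq_map_env (uniq_free_nbrs x) _ => b; apply: free_nbrs_key.
rewrite -(card_uniqP uF); apply: eq_card => y; rewrite !inE.
apply/mapP/andP => [[b bF ->]|[/imsetP[b bc ->] xb]].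
  by have := bF; rewrite mem_filter => /andP[]; rewrite placed_key ?(free_nbrs_key bF).
by exists b; rewrite ?mem_free_nbrs.
Qed.

Lemma card_placed : #|placed env cs| = size cs.
Proof.
rewrite card_in_imset; last exact: (placement_inj I).
have := placement_keys I; rewrite cat_uniq => /andP[/card_uniqP->].
by rewrite size_map.
Qed.

Lemma card_unplaced : #|~: placed env cs| = size todo.
Proof.
by apply/eqP; rewrite -(eqn_add2l (size cs)) (placement_size I) -{1}card_placed cardsC.
Qed.

Lemma card_unplaced_nbrs r : r \in D ->
  degree_in (~: placed env cs) (env r.1) = 3 - size r.2.
Proof.
move=> rD; have [rc ur sr hr] := placement_rows I rD.
have rcs : {subset r.2 <= unzip1 cs} by move=> b; rewrite hr => /andP[].
rewrite -(degree_inC cubic (placed env cs) (env r.1)) -(size_map env).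
rewrite -(card_uniqP (uniq_map_env ur rcs)).
rewrite [#|_|](_ : _ = degree_in (placed env cs) (env r.1)) ?addKn //.
apply: eq_card => y; rewrite !inE; apply/mapP/andP => [[b br ->]|[/imsetP[b bc ->] ab]].
  by have := br; rewrite hr => /andP[bc ab]; rewrite placed_key.
by exists b; rewrite // hr bc.
Qed.

Lemma placement_spannable : spannable todo d.
Proof.
have := arcs_le (~: placed env cs); rewrite (placement_arcs I) card_unplaced /spannable.
by case: todo => [|? [|? [|? ?]]] //=; rewrite leqn0.
Qed.

End Facts.

Section Extension.
Variables (env : label -> G) (w : label) (todo : seq label) (d : nat) (D cs : table) (x : G).
Hypothesis I : placement env (w :: todo) d D cs.
Hypothesis xN : x \notin placed env cs.
Let S := free_nbrs env D x.
Let env' := upd env w x.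
Let cs' := (w, S) :: cs.

Lemma new_label : w \notin unzip1 cs.
Proof. by have := placement_keys I; rewrite cat_uniq => /and3P[_ /norP[]]. Qed.

Lemma upd_key : {in unzip1 cs, env' =1 env}.
Proof. by move=> a ac; rewrite /env' upd_neq //; apply: contraNneq new_label => <-. Qed.

Let S_key b : b \in S -> b \in unzip1 cs := fun h => free_nbrs_key I h.

Let S_adj b : b \in S -> adj x (env b).
Proof. by rewrite mem_filter => /andP[]. Qed.

Lemma extension_wf : well_formed cs'.
Proof.
apply/and4P; split; [exact: new_label | exact: uniq_free_nbrs I _ | | exact: placement_wf I].
by apply/allP => b /S_key.
Qed.

Lemma placed_extension : placed env' cs' = x |: placed env cs.
Proof.
apply/setP => y; rewrite !inE; apply/imsetP/predU1P => [[b]|].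
  rewrite inE => /predU1P[-> ->|bc ->]; first by left; rewrite /env' upd_eq.
  by right; rewrite upd_key ?placed_key.
case=> [->|/imsetP[b bc ->]]; first by exists w; rewrite ?mem_head // /env' upd_eq.
by exists b; rewrite ?upd_key // inE [_ \in _]bc orbT.
Qed.

Lemma extension_inj : {in unzip1 cs' &, injective env'}.
Proof.
have xb b : b \in unzip1 cs -> env' b <> x.
  by move=> bc; rewrite upd_key //; apply/nesym/eqP/(unplaced_neq xN).
move=> b c; rewrite !inE => /predU1P[->|bc] /predU1P[->|cc] //.
- by rewrite {1}/env' upd_eq => /esym /(xb _ cc).
- by rewrite {2}/env' upd_eq => /(xb _ bc).
- by rewrite !upd_key //; apply: (placement_inj I).
Qed.

Lemma extension_adj : {in unzip1 cs' &, forall a b, linked cs' a b = adj (env' a) (env' b)}.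
Proof.
have wf := extension_wf; have xw : env' w = x by rewrite /env' upd_eq.
have new b : b \in unzip1 cs -> linked cs' b w = adj (env' b) (env' w).
  by move=> bc; rewrite (linked_cons _ wf) // eqxx (mem_free_nbrs I) // xw upd_key // adj_sym.
move=> a b; rewrite !inE => /predU1P[->|ac] /predU1P[->|bc].
- by rewrite linked_irrefl ?adj_irrefl.
- by rewrite linkedC adj_sym new.
- exact: new.
rewrite (linked_cons _ wf) // ifN; last by apply: contraNneq new_label => <-.
by rewrite (placement_adj I) // !upd_key.
Qed.

Lemma extension_row r b : r \in D ->
  (b \in r.2) = (b \in unzip1 cs) && adj (env' r.1) (env' b).
Proof.
move=> rD; have [rc _ _ ->] := placement_rows I rD.
by have [bc|//] := boolP (b \in _); rewrite !upd_key.
Qed.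

Lemma extension_rows r : r \in attach w S D ->
  [/\ r.1 \in unzip1 cs', uniq r.2, size r.2 < 3 &
    forall b, (b \in r.2) = (b \in unzip1 cs') && adj (env' r.1) (env' b)].
Proof.
case/mem_attach; rewrite is_openE => sr [rE|[r0 r0D rE]].
  rewrite rE /= mem_head (uniq_free_nbrs I); split=> // [|b]; first by rewrite rE in sr.
  rewrite inE; have [->|bw] := eqVneq b w.
    by rewrite adj_irrefl; apply: contraNF new_label => /S_key.
  rewrite /= [env' w]upd_eq; have [bc|bc] := boolP (b \in unzip1 cs).
    by rewrite (mem_free_nbrs I) ?upd_key.
  by apply: contraNF bc => /S_key.
have [rc ur _ _] := placement_rows I r0D; have hr := extension_row _ r0D.
have wr : w \notin r0.2 by rewrite hr (negPf new_label).
have wS : adj (env' r0.1) (env' w) = (r0.1 \in S).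
  by rewrite (mem_free_nbrs I) // [env' w]upd_eq upd_key // adj_sym.
have r1 : r.1 = r0.1 by rewrite rE link_fst.
rewrite r1 inE rc orbT; split=> // [|b].
  by rewrite rE /link in_labelsE; case: ifP => //= _; rewrite wr.
rewrite rE /link in_labelsE -wS [b \in unzip1 cs']inE.
case: ifP => aw; rewrite ?inE hr; case: (b =P w) => [->|] //=.
by rewrite (negPf new_label) aw.
Qed.

Lemma extension_uniq_rows : uniq (unzip1 (attach w S D)).
Proof.
apply: subseq_uniq (attach_subseq _ _ _) _; rewrite rcons_uniq (placement_uniq_rows I) andbT.
exact: contra (@row_key _ _ _ _ _ I w) new_label.
Qed.

Lemma extension_closed a : a \in unzip1 cs' -> a \notin unzip1 (attach w S D) ->
  forall y, adj (env' a) y -> y \in placed env' cs'.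
Proof.
move=> aC aD y ay; rewrite placed_extension.
have exhausted s : uniq s -> 2 < size s -> {subset s <= unzip1 cs'} ->
    {in s, forall b, adj (env' a) (env' b)} -> y \in x |: placed env cs.
  move=> us s3 sC sa; rewrite -placed_extension.
  have /mapP[b /sC bC ->] : y \in [seq env' b | b <- s].
    apply: (nbrs_exhausted cubic _ _ _ ay); rewrite ?size_map //.
      by rewrite map_inj_in_uniq // => b c /sC bC /sC cC; apply: extension_inj.
    by move=> _ /mapP[b /sa ab ->].
  exact: imset_f.
move: aC; rewrite inE => /predU1P[aw|ac].
  have S3 : 2 < size S.
    by rewrite ltnNge; apply: contra aD => S2; rewrite aw attach_new ?is_openE.
  apply: exhausted S3 _ _ => [|b /S_key bc|b bS]; first exact: uniq_free_nbrs I _.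
    by rewrite inE bc orbT.
  by rewrite aw [env' w]upd_eq upd_key ?S_key // S_adj.
have [/mapP[r rD aE]|aN] := boolP (a \in unzip1 D); last first.
  by rewrite in_setU (placement_closed I ac aN) ?orbT // -upd_key.
have [_ ur _ _] := placement_rows I rD; have hr := extension_row _ rD.
have closed_row : ~~ is_open (link w S r) by apply: contra aD; rewrite aE; apply: attach_open.
have [aS r2] : a \in S /\ 1 < size r.2.
  move: closed_row; rewrite /link in_labelsE -aE is_openE -leqNgt; case: ifP => //= _.
  by have [_ _ ? _] := placement_rows I rD; rewrite leqNgt => /negP[].
apply: (@exhausted (w :: r.2)) => //=.
- by rewrite ur andbT hr (negPf new_label).
- by move=> b; rewrite !inE hr => /predU1P[->|/andP[->]]; rewrite ?eqxx ?orbT.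
move=> b; rewrite inE => /predU1P[->|]; last by rewrite hr aE => /andP[].
by rewrite [env' w]upd_eq upd_key // adj_sym S_adj.
Qed.

Lemma extension_arcs :
  arcs (~: placed env' cs') (~: placed env' cs') + 6 = d + (size S).*2.
Proof.
have xU : x \in ~: placed env cs by rewrite inE.
rewrite -(placement_arcs I) (arcsD1 xU) placed_extension.
have <- : (~: placed env cs) :\ x = ~: (x |: placed env cs).
  by apply/setP => y; rewrite !inE negb_or.
rewrite (size_free_nbrs I xN) -addnA; congr (_ + _).
by rewrite -doubleD addnC (degree_inC cubic).
Qed.

Lemma extend : exists2 d', d' + 6 = d + (size S).*2 &
  placement env' todo d' (attach w S D) cs'.
Proof.
exists (arcs (~: placed env' cs') (~: placed env' cs')); first exact: extension_arcs.
split=> //.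
- by have := placement_keys I; rewrite -[w :: todo]cat1s uniq_catCA.
- by rewrite -(placement_size I) /= addnS.
- exact: extension_wf.
- exact: extension_inj.
- exact: extension_adj.
- exact: extension_rows.
- exact: extension_uniq_rows.
- exact: extension_closed.
Qed.

End Extension.
End Placement.

Section SearchSoundness.
Variable G : sgraph.
Hypothesis cubic : regular 3 G.
Hypothesis conn : connected G.
Hypothesis no_triangle : triangle_free G.
Hypothesis no_square : square_free G.
Variables (joinable : table -> row -> row -> bool) (leaf : table -> bool) (root : table).
Implicit Types (env : label -> G) (cs D : table) (todo : seq label).

Definition admits_new_vertices : Prop := forall env todo d D cs r1 r2 x,
  placement env todo d D cs -> suffix root cs -> r1 \in D -> r2 \in D -> r1.1 != r2.1 ->
  x \notin placed env cs -> adj x (env r1.1) -> adj x (env r2.1) -> joinable cs r1 r2.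

Hypothesis admits : admits_new_vertices.

Lemma mem_choices env todo d u D cs x :
  placement env todo d (u :: D) cs -> suffix root cs ->
  x \notin placed env cs -> adj x (env u.1) ->
  free_nbrs env D x \in choices joinable cs u D.
Proof.
move=> I rcs xN xu; have /= /andP[uD UD] := placement_uniq_rows I.
pose p (r : row) := adj x (env r.1).
have ok (r1 r2 : row) : r1 \in u :: D -> r2 \in u :: D -> r1.1 != r2.1 ->
    p r1 -> p r2 -> joinable cs r1 r2.
  by move=> D1 D2 ne x1 x2; apply: (admits I rcs D1 D2 ne xN x1 x2).
set s := [seq r <- [seq r <- D | joinable cs u r] | p r].
have sE : free_nbrs env D x = unzip1 s.
  rewrite /free_nbrs /unzip1 filter_map /s -filter_predI; congr map.
  apply: eq_in_filter => r rD /=; apply/esym/andb_idr => pr.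
  apply: ok; rewrite ?mem_head ?inE ?rD ?orbT //.
  by apply: contraNneq uD => ->; apply: map_f.
have sD : subseq s D by apply: subseq_trans (filter_subseq _ _) (filter_subseq _ _).
rewrite sE; apply: mem_small_subsets; first exact: filter_subseq.
  have := size_free_nbrs I xN; rewrite /free_nbrs /= xu /= -/(free_nbrs env D x) sE.
  by rewrite size_map -ltnS => ->; rewrite -(degree_inC cubic (placed env cs) x) leq_addr.
move=> a b sab; have [as_ bs] : a \in s /\ b \in s by rewrite sab !inE !eqxx orbT.
have ps r : r \in s -> p r by rewrite mem_filter => /andP[].
apply: ok; rewrite ?ps // ?inE ?(mem_subseq sD) ?orbT //.
have := subseq_uniq (map_subseq fst sD) UD.
by rewrite sab /= inE andbT.
Qed.

Lemma all_placed env todo d cs :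
  0 < size cs -> placement env todo d [::] cs -> todo = [::].
Proof.
move=> cs0 I; have [r rcs] : exists r, r \in cs.
  by case: (cs) cs0 => // r s _; exists r; rewrite mem_head.
have closed_placed : closed (@adj G) (placed env cs).
  suff step x y : adj x y -> x \in placed env cs -> y \in placed env cs.
    by move=> x y xy; apply/idP/idP; apply: step; rewrite // adj_sym.
  by move=> xy /imsetP[a ac xE]; apply: (placement_closed I ac) => //; rewrite -xE.
apply: size0nil; rewrite -(card_unplaced I); apply/eqP; rewrite cards_eq0.
apply/eqP/setP => x; rewrite !inE; apply/negbF.
rewrite -(closed_connect closed_placed (conn (env r.1) x)).
by apply: placed_key; apply: map_f.
Qed.

Lemma extend_first env w todo d u D cs x (T := free_nbrs env D x) (S := u.1 :: T) :
  placement env (w :: todo) d (u :: D) cs -> x \notin placed env cs -> adj x (env u.1) ->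
  exists2 d', d + (size T).*2 = d'.+4 &
    placement (upd env w x) todo d' (attach w S (u :: D)) ((w, S) :: cs).
Proof.
move=> I xN xu; have SE : free_nbrs env (u :: D) x = S by rewrite /free_nbrs /= xu.
have [d'] := extend cubic I xN; rewrite SE /= => dE I'; exists d' => //; lia.
Qed.

Lemma free_nbrs_attach env w x y S D :
  w \notin unzip1 D -> ~~ adj y x ->
  (forall r, r \in D -> adj y (env r.1) -> is_open (link w S r)) ->
  free_nbrs (upd env w x) (attach w S D) y = free_nbrs env D y.
Proof.
move=> wD yx open_row; rewrite /free_nbrs /attach -[unzip1 D](unzip1_link w S).
rewrite /unzip1 [LHS]filter_map [RHS]filter_map -filter_predI filter_rcons /=.
rewrite upd_eq (negPf yx) /=; congr map; apply: eq_in_filter => _ /mapP[r rD ->] /=.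
rewrite link_fst upd_neq.
  by have [/(open_row r rD)->|] := boolP (adj y _).
by apply: contraNneq wD => <-; apply: map_f.
Qed.

Section TwoNew.
Variables (env : label -> G) (w w' : label) (todo : seq label) (d : nat).
Variables (a c : label) (D cs : table) (x y : G).
Hypothesis I : placement env [:: w, w' & todo] d ((a, [:: c]) :: D) cs.
Hypotheses (xy : x != y) (xN : x \notin placed env cs) (yN : y \notin placed env cs).
Hypotheses (xa : adj x (env a)) (ya : adj y (env a)).
Let T := free_nbrs env D x.
Let T' := free_nbrs env D y.

Lemma new_nbrs_disjoint : disjoint_labels T T'.
Proof.
rewrite disjoint_labelsE; suff disjoint b : b \in T -> b \notin T' by apply/hasPn.
rewrite !mem_filter => /andP[xb bD]; rewrite bD andbT; apply/negP => yb; case/eqP: xy.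
apply: no_square xa xb ya yb _.
have /= /andP[aD _] := placement_uniq_rows I; apply: contraNneq aD => abE.
have ac := row_key I (mem_head a (unzip1 D)).
have bc : b \in unzip1 cs by apply: (row_key I); rewrite inE bD orbT.
by rewrite (placement_inj I ac bc abE).
Qed.

Lemma extend_second : exists d1 d2,
  [/\ d + (size T).*2 = d1.+4, d1 + (size T').*2 = d2.+4 &
    placement (upd (upd env w x) w' y) todo d2
      (attach w' (a :: T') (attach w (a :: T) ((a, [:: c]) :: D)))
      [:: (w', a :: T'), (w, a :: T) & cs]].
Proof.
have [d1 d1E I1] := extend_first I xN xa.
have aw : a != w by apply: contraNneq (new_label I) => <-; apply: (row_key I); rewrite mem_head.
have yx : ~~ adj y x by apply: no_triangle xa _; rewrite adj_sym.
have yN1 : y \notin placed (upd env w x) ((w, a :: T) :: cs).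
  have := placed_extension x I; rewrite {1}/free_nbrs /= xa => ->.
  by rewrite in_setU1 negb_or eq_sym xy.
have fE : free_nbrs (upd env w x) (attach w (a :: T) D) y = T'.
  have /= /andP[aD _] := placement_uniq_rows I.
  have key b : b \in unzip1 D -> b \in unzip1 ((a, [:: c]) :: D) by rewrite inE orbC => ->.
  have wD : w \notin unzip1 D by apply: contra (new_label I) => /key/(row_key I).
  apply: free_nbrs_attach yx _ => // r rD yr; rewrite /link in_labelsE.
  have rD1 : r.1 \in unzip1 D := map_f _ rD.
  rewrite ifN ?is_openE.
    by have [|_ _ ->] := placement_rows I (r := r); rewrite ?inE ?rD ?orbT.
  rewrite inE negb_or; apply/andP; split; first by apply: contraNneq aD => <-.
  have := new_nbrs_disjoint; rewrite disjoint_labelsE => /hasPn dis.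
  by apply: contraTN yr => /dis; rewrite /= mem_filter rD1 andbT.
have attachE : attach w (a :: T) ((a, [:: c]) :: D) = (a, [:: w; c]) :: attach w (a :: T) D.
  by rewrite /attach /= /link /= label_eqE eqxx.
rewrite -/T attachE in I1; have [|d2 d2E I2] := extend_first I1 yN1.
  by rewrite /= upd_neq.
by exists d1, d2; rewrite attachE; move: d2E I2; rewrite /= fE.
Qed.

End TwoNew.

Lemma unplaced_nbrs env todo d D cs r : placement env todo d D cs -> r \in D ->
  exists s : seq G, [/\ uniq s, size s = 3 - size r.2 &
    {in s, forall x, x \notin placed env cs /\ adj x (env r.1)}].
Proof.
move=> I rD; exists (enum [set x in ~: placed env cs | adj (env r.1) x]); split.
- exact: enum_uniq.
- by rewrite -cardE -(card_unplaced_nbrs cubic I rD).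
by move=> x; rewrite mem_enum !inE adj_sym => /andP[].
Qed.

Lemma place_one_sound continue w todo d u D cs env x :
  placement env (w :: todo) d (u :: D) cs -> x \notin placed env cs -> adj x (env u.1) ->
  place_one continue w todo d u D cs (free_nbrs env D x) ->
  exists env' d' D' cs', [/\ placement env' todo d' D' cs', suffix cs cs' & continue d' D' cs'].
Proof.
move=> I xN xu; have [d1 d1E I1] := extend_first I xN xu.
rewrite /place_one d1E (placement_spannable I1) => h.
by do 4!eexists; split; [exact: I1 | exact: suffix_cons | exact: h].
Qed.

Lemma place_two_sound continue w w' todo d a c D cs env x y :
  placement env [:: w, w' & todo] d ((a, [:: c]) :: D) cs ->
  x != y -> x \notin placed env cs -> y \notin placed env cs ->
  adj x (env a) -> adj y (env a) ->
  place_two continue w w' todo d (a, [:: c]) D cs (free_nbrs env D x) (free_nbrs env D y) ->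
  exists env' d' D' cs', [/\ placement env' todo d' D' cs', suffix cs cs' & continue d' D' cs'].
Proof.
move=> I xy xN yN xa ya; have [d1 [d2 [d1E d2E I2]]] := extend_second I xy xN yN xa ya.
rewrite /place_two d1E d2E (placement_spannable I2) (new_nbrs_disjoint I xy xa ya) => h.
by do 4!eexists; split; [exact: I2 | exact: suffix_suffix [:: _; _] cs | exact: h].
Qed.

Definition leaf_reached : Prop :=
  exists env cs, placement env [::] 0 [::] cs /\ leaf cs.

Lemma search_sound todo d D cs env :
  0 < size cs -> placement env todo d D cs -> suffix root cs ->
  search joinable leaf todo d D cs -> leaf_reached.
Proof.
have [n] := ubnP (size todo); elim: n todo d D cs env => // n IH todo d D cs env tn cs0 I rcs.
have continue todo' : size todo' < size todo ->
    (exists env' d' D' cs', [/\ placement env' todo' d' D' cs', suffix cs cs' &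
      search joinable leaf todo' d' D' cs']) -> leaf_reached.
  move=> lt [env' [d' [D' [cs' [I' cs_cs' h]]]]]; apply: IH I' _ h.
  - exact: leq_trans lt tn.
  - exact: leq_trans cs0 (size_suffix cs_cs').
  - exact: suffix_trans rcs cs_cs'.
case: D I => [|u D] I.
  have t0 := all_placed cs0 I; subst todo => leafP; exists env, cs; split=> //.
  by have /eqP <- := placement_spannable I.
have [s [us sE sP]] := unplaced_nbrs I (mem_head u D).
have s_todo : size s <= size todo.
  rewrite -(card_unplaced I) cardE; apply: uniq_leq_size => // x /sP[xN _].
  by rewrite mem_enum inE.
have choice x : x \in s -> free_nbrs env D x \in choices joinable cs u D.
  by case/sP; apply: mem_choices I rcs.
have [_ _ + _] := placement_rows I (mem_head u D).
case: u I sE sP choice => a [|c [|c' [|//]]] I sE sP choice _; rewrite sE in s_todo.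
- by case: (todo) s_todo.
- case: s us sE sP choice => [|x [|y [|//]]] //= + _ sP choice; rewrite inE andbT => xy.
  have [xs ys] : x \in [:: x; y] /\ y \in [:: x; y] by rewrite !inE !eqxx orbT.
  have [[xN xa] [yN ya]] := (sP x xs, sP y ys).
  case: todo I s_todo continue {IH tn} => [|w [|w' todo]] // I _ continue.
  move=> /all_pairsP/(_ (choice x xs) (choice y ys))/orP[] h; apply: (continue todo) => //.
    exact: place_two_sound I xy xN yN xa ya h.
  by apply: place_two_sound I _ yN xN ya xa h; rewrite eq_sym.
case: s us sE sP choice => [|x [|//]] //= _ _ sP choice.
have xs : x \in [:: x] by rewrite mem_head.
have [xN xa] := sP x xs.
case: todo I s_todo continue {IH tn} => [|w todo] // I _ continue.
move=> /allP/(_ _ (choice x xs)) h; apply: (continue todo) => //.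
exact: place_one_sound I xN xa h.
Qed.

End SearchSoundness.

(** * Soundness of the colouring *)

Definition table_edges (t : table) : seq (label * label) := [seq (r.1, b) | r <- t, b <- r.2].

Lemma mem_table_edges t a b : uniq (unzip1 t) ->
  ((a, b) \in table_edges t) = (b \in lookup [::] t a).
Proof.
elim: t => //= r t IH /andP[rt ut]; rewrite /table_edges /= mem_cat -/(table_edges t) IH //.
rewrite label_eqE; have [->|ar] := eqVneq a r.1.
  by rewrite (lookup_out _ rt) orbF mem_map // => x y [].
by rewrite (_ : (a, b) \in _ = false) //; apply: contra_neqF ar => /mapP[c _ [->]].
Qed.

Lemma table_edges_keys t e : well_formed t -> e \in table_edges t ->
  e.1 \in unzip1 t /\ e.2 \in unzip1 t.
Proof.
move=> wf; rewrite (surjective_pairing e) mem_table_edges ?well_formed_uniq // => h.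
by apply: linked_keys wf _; rewrite linkedE h.
Qed.

Definition ends (e : label * label) : seq label := [:: e.1; e.2].

Lemma mem_ends e a : (a \in ends e) = (a == e.1) || (a == e.2).
Proof. by rewrite !inE. Qed.

Definition proper_colouring (es : seq (label * label)) (kap : label * label -> colour) :=
  forall e e' a, e \in es -> e' \in es -> a \in ends e -> a \in ends e' ->
    kap e = kap e' -> e = e'.

Definition palette_of (l : palettes) (a : label) : palette :=
  lookup (false, false, false) l a.

Lemma uses_add_colour p c : uses (add_colour c p) c.
Proof. by case: p c => [[r g] b] []. Qed.

Lemma uses_added p c e : uses p e -> uses (add_colour c p) e.
Proof. by case: p c e => [[r g] b] [] []. Qed.

Lemma paintP a c l k : paint a c l k -> exists l',
  [/\ k l', unzip1 l' = unzip1 l, ~~ uses (palette_of l a) c &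
    forall b, palette_of l' b =
      if b == a then add_colour c (palette_of l a) else palette_of l b].
Proof.
rewrite /palette_of; elim: l k => //= x l IH k; rewrite label_eqE.
have [->|ax] := eqVneq a x.1.
  case: ifP => // /negbT ncx kl; eexists; split; [exact: kl | by [] | by [] | ].
  by move=> b /=; rewrite label_eqE; case: eqP.
case/IH => l' [kl ul nc lE]; exists (x :: l'); split; rewrite //= ?ul // => b.
by rewrite label_eqE lE; have [->|//] := eqVneq b x.1; rewrite eq_sym (negPf ax).
Qed.

Lemma colour_rowP p S l k : uniq S -> colour_row p S l k -> exists (kap : label -> colour) l',
  [/\ k l', unzip1 l' = unzip1 l,
    {in S, forall a, [/\ ~~ uses p (kap a), ~~ uses (palette_of l a) (kap a) &
      uses (palette_of l' a) (kap a)]},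
    {in S &, injective kap} &
    forall b e, uses (palette_of l b) e -> uses (palette_of l' b) e].
Proof.
elim: S p l => [|a S IH] p l /=; first by move=> _ kl; exists (fun=> Red), l.
case/andP=> aS uS h.
have {h} [c [pc]] : exists c, ~~ uses p c /\
    paint a c l (fun l' => colour_row (add_colour c p) S l' k).
  move: h; case: ifP => [h _|_]; first by exists Red; move: h; case: (uses p Red).
  case: ifP => [h _|_ h]; first by exists Green; move: h; case: (uses p Green).
  by exists Blue; move: h; case: (uses p Blue).
case/paintP=> l1 [/(IH _ _ uS)[kap [l2 [kl2 ul2 hS inj mono]]] ul1 ac l1E].
have ne b : b \in S -> b == a = false by move=> bS; apply: contraNF aS => /eqP<-.
have newc b : b \in S -> kap b <> c.
  by move=> /hS[+ _ _] E; rewrite E uses_add_colour.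
exists (upd kap a c), l2; split; rewrite ?ul2 //.
- move=> b; rewrite inE => /predU1P[->|bS].
    by rewrite upd_eq; split=> //; apply: mono; rewrite l1E eqxx uses_add_colour.
  rewrite upd_neq ?ne //; have [pb + ?] := hS b bS; rewrite l1E ne // => lb; split=> //.
  by apply: contra pb; apply: uses_added.
- move=> b b'; rewrite !inE => /predU1P[->|bS] /predU1P[->|b'S] //.
  + by rewrite upd_eq upd_neq ?ne // => /esym/(newc _ b'S).
  + by rewrite upd_eq upd_neq ?ne // => /(newc _ bS).
  + by rewrite !upd_neq ?ne //; apply: inj.
- move=> b e lbe; apply: mono; rewrite l1E; case: eqP => // ba.
  by rewrite -ba; apply: uses_added.
Qed.

Lemma table_edges_cons v S cs e : e \in table_edges ((v, S) :: cs) ->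
  (e.1 = v /\ e.2 \in S) \/ e \in table_edges cs.
Proof.
rewrite /table_edges /= mem_cat => /orP[/mapP[b bS ->]|]; first by left.
by right.
Qed.

Lemma colour_rows_sound cs l : well_formed cs -> unzip1 l = unzip1 cs -> colour_rows cs l ->
  exists2 kap, proper_colouring (table_edges cs) kap &
    forall e a, e \in table_edges cs -> a \in ends e -> ~~ uses (palette_of l a) (kap e).
Proof.
elim: cs l => [|[v S] cs IH] [|[v' p] l] //=; first by exists (fun=> Red).
case/and4P=> vcs uS /allP Scs wf [-> ul] /(colour_rowP uS).
case=> kapS [l' [/(IH _ wf) h ul' hS inj mono]].
have {h} [kap proper avoid] := h (etrans ul' ul).
have nv a : a \in unzip1 cs -> (a == v) = false.
  by move=> ac; apply: contraNF vcs => /eqP<-.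
have ends_key e a : e \in table_edges cs -> a \in ends e -> a \in unzip1 cs.
  by move=> /(table_edges_keys wf)[e1 e2]; rewrite mem_ends => /orP[]/eqP->.
have fst_nv e : e \in table_edges cs -> (e.1 == v) = false.
  by move=> /(table_edges_keys wf)[/nv].
have new_old e e' a : e.1 = v -> e.2 \in S -> e' \in table_edges cs ->
    a \in ends e -> a \in ends e' -> kapS e.2 <> kap e'.
  move=> ev eS e'c; rewrite mem_ends ev => /orP[]/eqP-> ae'.
    by have := ends_key e' v e'c ae'; rewrite (negPf vcs).
  move=> E; have [_ _ +] := hS _ eS; rewrite E.
  by apply/negP; apply: avoid.
exists (fun e => if e.1 == v then kapS e.2 else kap e).
  move=> e e' a /table_edges_cons[[ev eS]|ec] /table_edges_cons[[ev' eS']|ec'] ae ae'.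
  - rewrite ev ev' eqxx => /(inj _ _ eS eS') E.
    by rewrite [e]surjective_pairing [e']surjective_pairing ev ev' E.
  - by rewrite ev eqxx fst_nv // => /(new_old e e' a ev eS ec' ae ae').
  - by rewrite ev' eqxx fst_nv // => /esym/(new_old e' e a ev' eS' ec ae' ae).
  - by rewrite !fst_nv //; apply: proper ae ae'.
move=> e a /table_edges_cons[[ev eS]|ec] ae; rewrite /palette_of /= label_eqE.
  have [pe le _] := hS _ eS; rewrite ev eqxx; move: ae; rewrite mem_ends ev.
  by case: (eqVneq a v) => [//|_] /= /eqP->.
rewrite fst_nv // nv ?(ends_key e) //.
by apply: contra (avoid e a ec ae); apply: mono.
Qed.

Section FullPlacement.
Variables (G : sgraph) (env : label -> G) (cs : table).
Hypothesis I : placement env [::] 0 [::] cs.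

Lemma placed_full x : exists2 a, a \in unzip1 cs & x = env a.
Proof.
apply/imsetP; have := card_unplaced I => /= /eqP; rewrite cards_eq0 => /eqP/setP/(_ x).
by rewrite !inE => /negbFE.
Qed.

Lemma edge_table_edge e : e \in edges G ->
  exists2 p, p \in table_edges cs & e = [set env p.1; env p.2].
Proof.
case/imsetP=> -[x y]; rewrite inE /= => + ->.
have [[a ac ->] [b bc ->]] := (placed_full x, placed_full y).
have u := well_formed_uniq (placement_wf I).
rewrite -(placement_adj I) // linkedE -!mem_table_edges // => /orP[h|h].
  by exists (a, b).
by exists (b, a); rewrite // setUC.
Qed.

Definition colour_index (c : colour) : nat :=
  match c with Red => 0 | Green => 1 | Blue => 2 end.

Lemma colour_index_inj : injective colour_index.
Proof. by case=> [] []. Qed.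

Lemma three_colourable_sound : three_colourable cs -> edge_colourable G 3.
Proof.
case/(colour_rows_sound (placement_wf I)); first by rewrite /unzip1 -map_comp.
move=> kap proper _.
pose code (e : {set G}) :=
  odflt (L0, L0) [pick p | (p \in table_edges cs) && (e == [set env p.1; env p.2])].
have codeP e : e \in edges G ->
    code e \in table_edges cs /\ e = [set env (code e).1; env (code e).2].
  case/edge_table_edge=> p pc eE; rewrite /code; case: pickP => [q /andP[qc /eqP]|/(_ p)] //.
  by rewrite pc eE eqxx.
have endP p x : p \in table_edges cs -> x \in [set env p.1; env p.2] ->
    exists a, [/\ a \in ends p, a \in unzip1 cs & x = env a].
  move=> /(table_edges_keys (placement_wf I))[p1 p2] /set2P[]->.
    by exists p.1; rewrite mem_ends eqxx.
  by exists p.2; rewrite mem_ends eqxx orbT.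
exists (fun e => colour_index (kap (code e))); split=> [e _|e f eG fG ef].
  by case: (kap _).
have [[ec eE] [fc fE]] := (codeP e eG, codeP f fG).
case/set0Pn=> x; rewrite inE {1}eE {1}fE => /andP[/(endP _ _ ec)[a [ae ac ->]]].
case/(endP _ _ fc)=> b [bf bc /(placement_inj I ac bc) ab].
apply: contra ef => /eqP/colour_index_inj E.
by rewrite eE fE (proper _ _ a ec fc) // ab.
Qed.

End FullPlacement.

(** * Subgraphs given by tables *)

Lemma uniq_map_inj_in (T1 T2 : eqType) (f : T1 -> T2) s :
  uniq (map f s) -> {in s &, injective f}.
Proof.
elim: s => //= a s IH /andP[fa us] x y; rewrite !inE.
move=> /predU1P[->|xs] /predU1P[->|ys] // E; last exact: IH E.
  by rewrite E map_f in fa.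
by rewrite -E map_f in fa.
Qed.

Definition add_edge (a b : label) (t : table) : table :=
  [seq if r.1 == a then (r.1, b :: r.2) else r | r <- t].

Definition forbids (Ps : seq table) (g : table) : bool := has (embeds^~ g) Ps.

Definition separated (Ps : seq table) (t : table) (a b : label) : bool :=
  [|| a == b, linked t a b | forbids Ps (add_edge a b t)].

Definition rigid (Ps : seq table) (t : table) : bool :=
  all (fun a => all (separated Ps t a) (unzip1 t)) (unzip1 t).

Definition extendable (Ps : seq table) (w a : label) (t : table) : bool :=
  [&& w \notin unzip1 t, a \in unzip1 t, size (nbrs t a) < 3 &
    all (separated Ps t a) (unzip1 t)].

Definition join_new (a b : label) (t : table) : table := (L19, [:: a; b]) :: t.

Definition blocks (P t F : table) : bool :=
  (L19 \notin unzip1 t) &&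
  all (fun r => (r.1 \in unzip1 t) &&
    all (fun b => (b \in unzip1 t) && embeds P (join_new r.1 b t)) r.2) F.

Definition triangle : table := [:: (L2, [:: L0; L1]); (L1, [:: L0]); (L0, [::])].

Definition square : table :=
  [:: (L3, [:: L0; L2]); (L2, [:: L1]); (L1, [:: L0]); (L0, [::])].

Definition pentagon : table :=
  [:: (L4, [:: L0; L3]); (L3, [:: L2]); (L2, [:: L1]); (L1, [:: L0]); (L0, [::])].

Section Containment.
Variable G : sgraph.
Implicit Types (env : label -> G) (t g P : table) (Ps : seq table).

Definition realizes t env : bool :=
  uniq [seq env a | a <- unzip1 t] &&
  all (fun e => adj (env e.1) (env e.2)) (table_edges t).

Definition contains t : bool := [exists f : {ffun label -> G}, realizes t f].

Lemma containsP t : reflect (exists env, realizes t env) (contains t).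
Proof.
apply: (iffP existsP) => [[f tf]|[env te]]; first by exists f.
exists (finfun env); move: te; rewrite /realizes (eq_map (ffunE env)).
by rewrite (eq_all (a2 := fun e => adj (env e.1) (env e.2))) // => e; rewrite !ffunE.
Qed.

Lemma realizes_inj t env : realizes t env -> {in unzip1 t &, injective env}.
Proof. by case/andP=> /uniq_map_inj_in. Qed.

Lemma realizes_linked t env a b : realizes t env -> linked t a b -> adj (env a) (env b).
Proof.
case/andP=> /map_uniq u /allP te; rewrite linkedE -!mem_table_edges // => /orP[]/te //=.
by rewrite adj_sym.
Qed.

Lemma contains_embeds t g : embeds t g -> contains g -> contains t.
Proof.
rewrite /embeds; move: (lookup _ _) => f /and3P[u /allP fg /allP fl] /containsP[env ge].
apply/containsP; exists (env \o f); rewrite /realizes map_inj_in_uniq ?(map_uniq u) /=.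
  apply/allP=> _ /allpairsPdep[r [b [rt br ->]]] /=.
  by apply: realizes_linked ge _; apply: (allP (fl r rt)).
move=> a b at_ bt /(realizes_inj ge (fg _ (map_f f at_)) (fg _ (map_f f bt))).
exact: (uniq_map_inj_in u).
Qed.

Definition avoids Ps : bool := all (fun P => ~~ contains P) Ps.

Lemma avoids_forbids Ps g : avoids Ps -> forbids Ps g -> ~~ contains g.
Proof.
move=> /allP av /hasP[P /av nP Pg]; apply: contra nP; exact: contains_embeds.
Qed.

Lemma realizes_add_edge t env a b :
  realizes t env -> adj (env a) (env b) -> realizes (add_edge a b t) env.
Proof.
case/andP=> u /allP te ab; apply/andP; split.
  rewrite [unzip1 _](_ : _ = unzip1 t) // /unzip1 -map_comp.
  by apply: eq_map => r /=; case: ifP.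
apply/allP=> _ /allpairsPdep[_ [c [/mapP[r rt ->] + ->]]] /=.
have old d : d \in r.2 -> adj (env r.1) (env d).
  by move=> dr; apply: (te (r.1, d)); apply/allpairsPdep; exists r, d.
case: eqP => [ra|_] //=; last exact: old.
by rewrite inE => /predU1P[->|/old //]; rewrite ra.
Qed.

Lemma separated_linked Ps t env a b : avoids Ps -> realizes t env ->
  separated Ps t a b -> adj (env a) (env b) -> linked t a b.
Proof.
move=> av te /or3P[/eqP->|//|fb] ab; first by rewrite adj_irrefl in ab.
by case/containsP: (avoids_forbids av fb); exists env; apply: realizes_add_edge.
Qed.

Lemma rigid_linked Ps t env : avoids Ps -> realizes t env -> rigid Ps t ->
  {in unzip1 t &, forall a b, linked t a b = adj (env a) (env b)}.
Proof.
move=> av te /allP rt a b ac bc; apply/idP/idP; first exact: realizes_linked te.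
by apply: separated_linked av te _; apply: (allP (rt a ac)).
Qed.

Lemma realizes_cons t env w S x : realizes t env -> w \notin unzip1 t ->
  all (fun e => w \notin ends e) (table_edges t) -> w \notin S ->
  x \notin [seq env a | a <- unzip1 t] -> {in S, forall a, adj x (env a)} ->
  realizes ((w, S) :: t) (upd env w x).
Proof.
case/andP=> u /allP te wt /allP we wS xN Sx.
have updE a : a != w -> upd env w x a = env a by apply: upd_neq.
have mapE : [seq upd env w x a | a <- unzip1 t] = [seq env a | a <- unzip1 t].
  by apply/eq_in_map => a at_; apply: updE; apply: contraNneq wt => <-.
rewrite /realizes /= upd_eq mapE xN u; apply/allP => e /table_edges_cons[[-> eS]|et].
  by rewrite upd_eq updE ?Sx //; apply: contraNneq wS => <-.
by have := we e et; rewrite mem_ends negb_or => /andP[w1 w2]; rewrite !updE ?te // eq_sym.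
Qed.

Lemma no_triangle_table : triangle_free G -> ~~ contains triangle.
Proof.
move=> tf; apply/containsP => -[env /andP[_ /and4P[a20 a21 a10 _]]].
by have := tf _ _ _ a21 a10; rewrite adj_sym a20.
Qed.

Lemma no_square_table : square_free G -> ~~ contains square.
Proof.
move=> sf; apply/containsP => -[env te]; have inj := realizes_inj te.
have [_ /and5P[a30 a32 a21 a10 _]] := andP te.
move: a30 a32 a10; rewrite !(adj_sym (env L3)) (adj_sym (env L1)) => a03 a23 a01.
have ne : env L3 != env L1 by apply/eqP => E; have := inj L3 L1 isT isT E.
by have := inj L0 L2 isT isT (sf _ _ _ _ a03 a01 a23 a21 ne).
Qed.

Hypothesis cubic : regular 3 G.

Lemma contains_pendant Ps t w a : well_formed t -> avoids Ps -> extendable Ps w a t ->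
  contains t -> contains ((w, [:: a]) :: t).
Proof.
move=> wf av /and4P[wt at_ a3 /allP sep] /containsP[env te].
have [|x ax xN] := other_nbr cubic (env a) (s := [seq env b | b <- nbrs t a]).
  by rewrite size_map.
have keys e : e \in table_edges t -> w \notin ends e.
  move=> /(table_edges_keys wf)[e1 e2]; rewrite mem_ends negb_or.
  by apply/andP; split; apply: contraNneq wt => ->.
apply/containsP; exists (upd env w x); apply: realizes_cons => //; first exact/allP.
- by rewrite inE; apply: contraNneq wt => ->.
- apply: contra xN => /mapP[b bt xE]; rewrite xE map_f // mem_nbrs.
  by apply: separated_linked av te (sep b bt) _; rewrite -xE.
- by move=> b; rewrite inE => /eqP->; rewrite adj_sym.
Qed.

Section Root.
Variables (env : label -> G) (t : table).
Hypothesis wf : well_formed t.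
Hypothesis env_inj : {in unzip1 t &, injective env}.
Hypothesis env_adj : {in unzip1 t &, forall a b, linked t a b = adj (env a) (env b)}.

Lemma nbrs_keys a : {subset nbrs t a <= unzip1 t}.
Proof. by move=> b; rewrite mem_nbrs => /(linked_keys wf)[]. Qed.

Lemma uniq_env_nbrs a : uniq [seq env b | b <- nbrs t a].
Proof.
rewrite map_inj_in_uniq ?uniq_nbrs // => b c /nbrs_keys bt /nbrs_keys ct; exact: env_inj.
Qed.

Lemma degree_in_placed a : a \in unzip1 t ->
  degree_in (placed env t) (env a) = size (nbrs t a).
Proof.
move=> at_; rewrite -(size_map env) -(card_uniqP (uniq_env_nbrs a)).
apply: eq_card => y; rewrite !inE; apply/andP/mapP => [[/imsetP[b bt ->]]|[b ab ->]].
  by rewrite -(env_adj at_ bt) => ab; exists b; rewrite ?mem_nbrs.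
by have bt := nbrs_keys ab; rewrite imset_f // -(env_adj at_ bt) -mem_nbrs.
Qed.

Lemma arcs_placed : arcs (placed env t) (~: placed env t) = missing t.
Proof.
rewrite /arcs /placed big_imset /=; last exact: env_inj.
rewrite /missing sumnE big_map [RHS]big_uniq ?well_formed_uniq //=.
apply: eq_bigr => a at_.
by rewrite -degree_in_placed // -(degree_inC cubic (placed env t) (env a)) addKn.
Qed.

Lemma uniq_keys_unplaced : uniq (unzip1 t ++ unplaced t).
Proof.
rewrite cat_uniq well_formed_uniq // filter_uniq // andbT /=.
by apply/hasPn => a; rewrite mem_filter in_labelsE => /andP[].
Qed.

Lemma size_keys_unplaced : size t + size (unplaced t) = 20.
Proof.
rewrite -(size_map fst t) -size_cat -card_label -(card_uniqP uniq_keys_unplaced).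
apply: eq_card => a; rewrite !inE mem_cat mem_filter in_labelsE mem_labels.
by case: (a \in unzip1 t).
Qed.

Lemma open_rowsP r : r \in open_rows t ->
  [/\ r.1 \in unzip1 t, r.2 = nbrs t r.1 & size r.2 < 3].
Proof.
by rewrite mem_filter is_openE => /andP[r3 /mapP[a]]; rewrite mem_rev => at_ rE; rewrite rE in r3 *.
Qed.

Lemma placement_root : #|G| = 20 ->
  placement env (unplaced t) (3 * size (unplaced t) - missing t) (open_rows t) t.
Proof.
move=> card20; split=> //.
- exact: uniq_keys_unplaced.
- by rewrite size_keys_unplaced.
- move=> r /open_rowsP[rt r2 r3]; split=> //; first by rewrite r2 uniq_nbrs.
  move=> b; rewrite r2 mem_nbrs; apply/idP/andP => [ab|[bt]]; last by rewrite (env_adj rt bt).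
  by have [_ bt] := linked_keys wf ab; rewrite -(env_adj rt bt).
- rewrite /open_rows; set rows := [seq _ | _ <- _].
  have rowsE : unzip1 rows = rev (unzip1 t) by rewrite /rows /unzip1 -map_comp map_id.
  have sub : subseq (unzip1 [seq r <- rows | is_open r]) (unzip1 rows).
    by apply: map_subseq; apply: filter_subseq.
  by apply: subseq_uniq sub _; rewrite rowsE rev_uniq well_formed_uniq.
- move=> a at_ aN x ax.
  have a3 : 2 < size (nbrs t a).
    rewrite ltnNge; apply: contra aN => a3; apply/mapP; exists (a, nbrs t a) => //.
    by rewrite mem_filter is_openE ltnS a3; apply: map_f; rewrite mem_rev.
  have /mapP[b /nbrs_keys bt ->] : x \in [seq env b | b <- nbrs t a].
    apply: (nbrs_exhausted cubic (uniq_env_nbrs a) _ _ ax); first by rewrite size_map.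
    by move=> _ /mapP[b ab ->]; rewrite -(env_adj at_ (nbrs_keys ab)) -mem_nbrs.
  exact: imset_f.
have := arcs_setC cubic (~: placed env t); rewrite setCK arcs_placed => E.
have -> : size (unplaced t) = #|~: placed env t|; last by rewrite -E addnK.
apply/eqP; rewrite -(eqn_add2l (size t)) size_keys_unplaced -card20.
have <- : #|placed env t| = size t; last by rewrite cardsC.
rewrite card_in_imset // -(size_map fst); exact/card_uniqP/well_formed_uniq.
Qed.

End Root.
End Containment.

Section PruningSound.
Variable G : sgraph.
Hypothesis no_triangle : triangle_free G.
Hypothesis no_square : square_free G.
Implicit Types (env : label -> G) (todo : seq label) (cs D t : table).

Section NewVertex.
Variables (env : label -> G) (todo : seq label) (d : nat) (D cs : table).
Variables (r1 r2 : row) (x : G).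
Hypothesis I : placement env todo d D cs.
Hypotheses (r1D : r1 \in D) (r2D : r2 \in D) (ne : r1.1 != r2.1).
Hypotheses (xN : x \notin placed env cs).
Hypotheses (x1 : adj x (env r1.1)) (x2 : adj x (env r2.1)).

Lemma row_adj r b : r \in D -> b \in r.2 -> b \in unzip1 cs /\ adj (env r.1) (env b).
Proof. by move=> rD; have [_ _ _ ->] := placement_rows I rD => /andP. Qed.

Lemma env_rows_neq : env r1.1 != env r2.1.
Proof.
apply: contra ne => /eqP E; apply/eqP.
by apply: (placement_inj I) E; apply: (row_key I); apply: map_f.
Qed.

Lemma new_joinable_girth5 : joinable_girth5 r1 r2.
Proof.
rewrite /joinable_girth5 in_labelsE; case: ifP => [/(row_adj r1D)[_ a12]|_].
  by have := no_triangle x1 a12; rewrite adj_sym x2.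
rewrite disjoint_labelsE; apply/hasPn => b b1; apply/negP => b2.
have [bc a1] := row_adj r1D b1; have [_ a2] := row_adj r2D b2.
case/eqP: (unplaced_neq xN bc); apply: no_square x1 x2 _ _ env_rows_neq; by rewrite adj_sym.
Qed.

Lemma new_joinable_girth6 : ~~ contains G pentagon -> joinable_girth6 cs r1 r2.
Proof.
move=> no_pentagon; rewrite /joinable_girth6 new_joinable_girth5.
apply/allP => a a1; apply/allP => b b2; apply: contra no_pentagon => ab.
have [ac r1a] := row_adj r1D a1; have [bc r2b] := row_adj r2D b2.
rewrite (placement_adj I) // in ab.
have key r : r \in D -> r.1 \in unzip1 cs by move=> rD; apply: (row_key I); apply: map_f.
have r1b : env r1.1 != env b.
  by apply/eqP => E; have := no_triangle x2 r2b; rewrite -E adj_sym x1.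
have ar2 : env a != env r2.1.
  by apply/eqP => E; have := no_triangle x1 r1a; rewrite E adj_sym x2.
pose s := [:: x; env r1.1; env a; env b; env r2.1].
apply/containsP; exists (fun l => nth x s (label_index l)).
apply/andP; split; last first.
  by rewrite /= !(adj_sym _ x) (adj_sym (env b) (env a)) (adj_sym _ (env r1.1)) x1 x2 r2b ab r1a.
rewrite [[seq _ | _ <- _]](_ : _ = rev s) // rev_uniq /= !inE !negb_or.
rewrite !(unplaced_neq xN) ?key // env_rows_neq r1b ar2 !adj_neq //.
by rewrite adj_sym.
Qed.

End NewVertex.

Lemma suffix_well_formed t cs : suffix t cs -> well_formed cs -> well_formed t.
Proof. by case/suffixP=> s ->; elim: s => //= r s IH /and4P[_ _ _ /IH]. Qed.

Lemma suffix_keys t cs : suffix t cs -> {subset unzip1 t <= unzip1 cs}.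
Proof. by case/suffixP=> s -> a; rewrite /unzip1 map_cat mem_cat orbC => ->. Qed.

Lemma placement_realizes env todo d D cs t :
  placement env todo d D cs -> suffix t cs -> realizes t env.
Proof.
move=> I tcs; have tk := suffix_keys tcs; have wf := placement_wf I.
have wft := suffix_well_formed tcs wf; apply/andP; split.
  rewrite map_inj_in_uniq ?well_formed_uniq // => a b /tk ac /tk bc; exact: (placement_inj I).
apply/allP=> e et; have [/tk e1 /tk e2] := table_edges_keys wft et.
rewrite -(placement_adj I) // linkedE -!mem_table_edges ?well_formed_uniq // -surjective_pairing.
by case/suffixP: tcs => s ->; rewrite /table_edges allpairs_cat mem_cat et orbT.
Qed.

Lemma joinable_avoiding_admits t P F : blocks P t F -> well_formed t -> ~~ contains G P ->
  admits_new_vertices G (joinable_avoiding F) t.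
Proof.
case/andP=> l19 /allP Ft wf nP env todo d D cs r1 r2 x I tcs r1D r2D ne xN x1 x2.
rewrite /joinable_avoiding (new_joinable_girth5 I r1D r2D ne xN x1 x2) in_labelsE.
apply: contra nP => r12.
have /lookup_in-/(_ [::])/Ft/andP[/= r1t /allP/(_ _ r12)/andP[r2t new]] : r1.1 \in unzip1 F.
  by apply: contraLR r12 => r1F; rewrite lookup_out.
apply: contains_embeds new _; apply/containsP; exists (upd env L19 x).
have nt a : a \in unzip1 t -> a != L19 by move=> at_; apply: contraNneq l19 => <-.
apply: realizes_cons (placement_realizes I tcs) l19 _ _ _ _.
- apply/allP=> e /(table_edges_keys wf)[/nt e1 /nt e2].
  by rewrite mem_ends negb_or !(eq_sym L19) e1 e2.
- by rewrite !inE !(eq_sym L19) negb_or !nt.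
- by apply: contra xN => /mapP[a at_ ->]; apply/imset_f/(suffix_keys tcs).
by move=> a; rewrite !inE => /predU1P[->|/eqP->].
Qed.

Lemma joinable_girth6_admits t : ~~ contains G pentagon ->
  admits_new_vertices G joinable_girth6 t.
Proof.
move=> nP env todo d D cs r1 r2 x I _ r1D r2D ne xN x1 x2.
exact: (new_joinable_girth6 I r1D r2D ne xN x1 x2 nP).
Qed.

Hypothesis cubic : regular 3 G.
Hypothesis conn : connected G.
Hypothesis card20 : #|G| = 20.

Lemma search_from_sound joinable leaf Ps t :
  admits_new_vertices G joinable t -> avoids G Ps -> rigid Ps t -> well_formed t ->
  0 < size t -> contains G t -> search_from joinable leaf t -> leaf_reached G leaf.
Proof.
move=> adm av rt wf t0 /containsP[env te].
have I := placement_root cubic wf (realizes_inj te) (rigid_linked av te rt) card20.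
exact (search_sound cubic conn no_triangle no_square adm t0 I (suffix_refl t)).
Qed.

End PruningSound.

(** * Three-edge cuts *)

Lemma set2_inj (T : finType) (a b c d : T) :
  [set a; b] = [set c; d] -> (a = c /\ b = d) \/ (a = d /\ b = c).
Proof.
move=> E; have : a \in [set c; d] by rewrite -E set21.
have : b \in [set c; d] by rewrite -E set22.
have : c \in [set a; b] by rewrite E set21.
have : d \in [set a; b] by rewrite E set22.
by do 4![case/set2P=> ?]; subst; auto.
Qed.

Definition cut_edges (G : sgraph) (A : {set G}) : {set {set G}} :=
  [set [set p.1; p.2] | p : G * G & [&& p.1 \in A, p.2 \notin A & adj p.1 p.2]].

Definition nontrivial_three_cut (G : sgraph) (S : {set {set G}}) : Prop :=
  [/\ S \subset edges G, #|S| = 3, ~ connected (delete_edges S) &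
    forall C, C \in components (delete_edges S) ->
      nontrivial_component (G := delete_edges S) C].

Section ThreeEdgeCut.
Variable G : sgraph.
Hypothesis cubic : regular 3 G.
Hypothesis conn : connected G.
Implicit Types (A : {set G}) (x y : G).

Lemma mem_cut_edges A x y : adj x y -> ([set x; y] \in cut_edges A) = (x \in A) (+) (y \in A).
Proof.
move=> xy; apply/imsetP/idP => [[[u v]]|].
  by rewrite inE /= => /and3P[uA /negPf vA _] /set2_inj[[-> ->]|[-> ->]]; rewrite uA vA.
case xA: (x \in A) => /= yA.
  by exists (x, y); rewrite // inE /= xA yA.
by exists (y, x); rewrite 1?setUC // inE /= yA xA adj_sym.
Qed.

Lemma card_cut_edges A : #|cut_edges A| = arcs A (~: A).
Proof.
rewrite card_in_imset => [|[x y] [x' y']]; last first.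
  rewrite !inE /= => /and3P[xA yA _] /and3P[x'A y'A _] /set2_inj[[-> ->] //|[xy' _]].
  by rewrite xy' (negPf y'A) in xA.
rewrite /arcs (eq_bigr _ (fun x _ => degree_inE _ x)) pair_big_dep /= -sum1_card.
rewrite big_mkcond [RHS]big_mkcond; apply: eq_bigr => -[x y] _; rewrite !inE /=.
by case: (x \in A) (y \in A) (adj x y) => [] [] [].
Qed.

Lemma arcs_eq0 A B x y : arcs A B = 0 -> x \in A -> y \in B -> ~~ adj x y.
Proof.
move/eqP; rewrite sum_nat_eq0 => /forall_inP h xA yB; apply/negP => xy.
have := h x xA; rewrite cards_eq0 => /eqP/setP/(_ y).
by rewrite !inE yB xy.
Qed.

(* A vertex of [A] without neighbours in [A] would carry all three arcs, so the rest of
   [A] would be a union of components. *)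
Lemma nbr_on_same_side A x : 1 < #|A| -> arcs A (~: A) = 3 -> x \in A ->
  exists2 y, y \in A & adj x y.
Proof.
move=> A1 cut3 xA; have [/exists_inP[y yA xy]|/exists_inPn none] := boolP [exists y in A, adj x y].
  by exists y.
have xA0 : degree_in A x = 0.
  by apply: eq_card0 => y; rewrite !inE; apply/negP => /andP[/none/negPf->].
have x3 : degree_in (~: A) x = 3 by rewrite -(degree_inC cubic A x) xA0.
have rest0 : arcs (A :\ x) (~: A) = 0.
  by apply/eqP; rewrite -(eqn_add2l 3) addn0 -{1}x3 /arcs -(big_setD1 x) //= -cut3.
have closed_rest : closed (@adj G) (A :\ x).
  suff step u v : adj u v -> u \in A :\ x -> v \in A :\ x.
    by move=> u v uv; apply/idP/idP; apply: step; rewrite // adj_sym.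
  move=> uv; rewrite !inE => /andP[ux uA]; apply/andP; split.
    by apply: contraTneq uv => ->; rewrite adj_sym none.
  by apply: contraTT uv => vA; apply: (arcs_eq0 rest0); rewrite !inE ?ux.
have [y] : exists y, y \in A :\ x.
  by apply/set0Pn; rewrite -card_gt0; move: A1; rewrite (cardsD1 x) xA.
by rewrite -(closed_connect closed_rest (conn x y)) !inE eqxx.
Qed.

Lemma three_edge_cut A : 1 < #|A| -> 1 < #|~: A| -> arcs A (~: A) = 3 ->
  nontrivial_three_cut (cut_edges A).
Proof.
move=> A1 A1' cut3; set H := delete_edges (cut_edges A).
have adjH x y : adj (s := H) x y = adj x y && ((x \in A) == (y \in A)).
  rewrite /= /delete_adj; case xy: (adj x y) => //=.
  by rewrite mem_cut_edges // negb_add.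
have closedA : closed (@adj H) A.
  by move=> x y; rewrite adjH => /andP[_ /eqP].
split; last move=> C CC.
- apply/subsetP => _ /imsetP[p + ->]; rewrite inE => /and3P[_ _ pp].
  by apply/imsetP; exists p; rewrite ?inE.
- by rewrite card_cut_edges.
- move=> connH; have [a aA] : exists a, a \in A by apply/card_gt0P/ltnW.
  have [b] : exists b, b \in ~: A by apply/card_gt0P/ltnW.
  have E : (a \in A) = (b \in A) := closed_connect closedA (connH a b).
  by rewrite inE -E aA.
have keep x : exists2 y, adj x y & (x \in A) = (y \in A).
  have [xA|xA] := boolP (x \in A).
    by have [y yA xy] := nbr_on_same_side A1 cut3 xA; exists y.
  have cut3' : arcs (~: A) (~: ~: A) = 3 by rewrite setCK arcsC.
  have [|y] := nbr_on_same_side A1' cut3' (x := x); rewrite inE //.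
  by move=> /negPf yA xy; exists y; rewrite ?yA.
have symH : connect_sym (@adj H) by apply/sym_connect_sym/adj_sym.
have equivH : {in [set: H] & &, equivalence_rel (connect (@adj H))}.
  by move=> x y z _ _ _; split=> [|xy]; [apply: connect0 | apply: same_connect].
have [x xC] : exists x, x \in C.
  have /and3P[_ _ n0] := equivalence_partitionP equivH.
  by apply/set0Pn; apply: contraNneq n0 => <-.
have [y xy sideE] := keep x; have xyH : adj (s := H) x y by rewrite adjH xy sideE eqxx.
exists [set x; y]; first by apply/imsetP; exists (x, y); rewrite // inE.
apply/subsetP => z; case/imsetP: CC xC => w _ ->; rewrite !inE => wx /orP[]/eqP-> //.
exact: connect_trans wx (connect1 xyH).
Qed.

End ThreeEdgeCut.

(** * The roots of the search and the six snarks *)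

(* The paths 0-1-2, 0-3-4-2 and 0-5-6-2: two pentagons sharing a path of length two. *)
Definition theta : table :=
  [:: (L6, [:: L2; L5]); (L5, [:: L0]); (L4, [:: L2; L3]); (L3, [:: L0]); (L2, [:: L1]);
    (L1, [:: L0]); (L0, [::])].

(* The paths 0-1, 0-2-3-4-1 and 0-5-6-7-1: two pentagons sharing an edge. *)
Definition fused_pentagons : table :=
  [:: (L7, [:: L1; L6]); (L6, [:: L5]); (L5, [:: L0]); (L4, [:: L1; L3]); (L3, [:: L2]);
    (L2, [:: L0]); (L1, [:: L0]); (L0, [::])].

Definition pendant_pentagon : table :=
  [:: (L9, [:: L4]), (L8, [:: L3]), (L7, [:: L2]), (L6, [:: L1]), (L5, [:: L0]) & pentagon].

Definition hexagon : table :=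
  [:: (L5, [:: L0; L4]); (L4, [:: L3]); (L3, [:: L2]); (L2, [:: L1]); (L1, [:: L0]);
    (L0, [::])].

(* Without cycles of length at most six, the vertices at distance at most two from an edge
   induce a tree. *)
Definition edge_ball : table :=
  [:: (L13, [:: L5]); (L12, [:: L5]); (L11, [:: L4]); (L10, [:: L4]); (L9, [:: L3]);
    (L8, [:: L3]); (L7, [:: L2]); (L6, [:: L2]); (L5, [:: L1]); (L4, [:: L1]);
    (L3, [:: L0]); (L2, [:: L0]); (L1, [:: L0]); (L0, [::])].

Definition petersen_minus_vertex : table :=
  [:: (L8, [:: L1; L7]), (L7, [:: L4; L5]) & theta].

Definition snark1 : table :=
  [:: (L19, [:: L9; L11; L16]); (L18, [:: L9; L10; L17]); (L17, [:: L8; L15]);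
    (L16, [:: L8; L14]); (L15, [:: L7; L13]); (L14, [:: L7; L12]); (L13, [:: L6; L11]);
    (L12, [:: L6; L10]); (L11, [:: L5]); (L10, [:: L5]); (L9, [:: L4]); (L8, [:: L3]);
    (L7, [:: L2]); (L6, [:: L1]); (L5, [:: L0]); (L4, [:: L0; L3]); (L3, [:: L2]);
    (L2, [:: L1]); (L1, [:: L0]); (L0, [::])].

Definition snark2 : table :=
  [:: (L19, [:: L13; L15; L17]); (L18, [:: L13; L14; L16]); (L17, [:: L12; L14]);
    (L16, [:: L11; L15]); (L15, [:: L10]); (L14, [:: L10]); (L13, [:: L9]);
    (L12, [:: L8; L11]); (L11, [:: L6]); (L10, [:: L5]); (L9, [:: L4; L7]);
    (L8, [:: L3; L7]); (L7, [:: L2]); (L6, [:: L1; L5]); (L5, [:: L0]);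
    (L4, [:: L1; L3]); (L3, [:: L0]); (L1, [:: L2]); (L2, [:: L0]); (L0, [::])].

Definition snark3 : table :=
  [:: (L19, [:: L13; L15; L17]); (L18, [:: L13; L14; L16]); (L17, [:: L12; L16]);
    (L16, [:: L11]); (L15, [:: L11; L14]); (L14, [:: L9]); (L13, [:: L8]);
    (L12, [:: L7; L10]); (L11, [:: L6]); (L10, [:: L5; L9]); (L9, [:: L4]);
    (L8, [:: L3; L7]); (L7, [:: L2]); (L6, [:: L1; L5]); (L5, [:: L0]);
    (L4, [:: L1; L3]); (L3, [:: L0]); (L1, [:: L2]); (L2, [:: L0]); (L0, [::])].

Definition snark4 : table :=
  [:: (L19, [:: L13; L15; L17]); (L18, [:: L13; L14; L16]); (L17, [:: L12; L16]);
    (L16, [:: L11]); (L15, [:: L11; L14]); (L14, [:: L10]); (L13, [:: L8]);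
    (L12, [:: L7; L9]); (L11, [:: L6]); (L10, [:: L5; L9]); (L9, [:: L4]);
    (L8, [:: L3; L7]); (L7, [:: L2]); (L6, [:: L1; L5]); (L5, [:: L0]);
    (L4, [:: L1; L3]); (L3, [:: L0]); (L1, [:: L2]); (L2, [:: L0]); (L0, [::])].

Definition snark5 : table :=
  [:: (L19, [:: L14; L15; L17]); (L18, [:: L13; L15; L16]); (L17, [:: L12; L13]);
    (L16, [:: L11; L14]); (L15, [:: L10]); (L14, [:: L9]); (L13, [:: L9]);
    (L12, [:: L8; L11]); (L11, [:: L6]); (L10, [:: L5; L7]); (L9, [:: L4]);
    (L8, [:: L3; L7]); (L7, [:: L2]); (L6, [:: L1; L5]); (L5, [:: L0]);
    (L4, [:: L1; L3]); (L3, [:: L0]); (L1, [:: L2]); (L2, [:: L0]); (L0, [::])].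

Definition snark6 : table :=
  [:: (L19, [:: L14; L16; L18]); (L18, [:: L13; L15]); (L17, [:: L12; L15; L16]);
    (L16, [:: L10]); (L15, [:: L9]); (L14, [:: L9; L12]); (L13, [:: L8; L11]);
    (L12, [:: L7]); (L11, [:: L7; L10]); (L10, [:: L5]); (L9, [:: L4]);
    (L8, [:: L3; L6]); (L7, [:: L2]); (L6, [:: L1; L5]); (L5, [:: L0]);
    (L4, [:: L1; L3]); (L3, [:: L0]); (L1, [:: L2]); (L2, [:: L0]); (L0, [::])].

Definition snarks : seq table := [:: snark1; snark2; snark3; snark4; snark5; snark6].

Definition targets : seq table := petersen_minus_vertex :: snarks.

Definition fused_blocked : table :=
  [:: (L2, [:: L6; L7]); (L3, [:: L5; L7]); (L4, [:: L5; L6]); (L5, [:: L3; L4]);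
    (L6, [:: L2; L4]); (L7, [:: L2; L3])].

Definition pendant_blocked : table :=
  [:: (L5, [:: L6; L9]); (L6, [:: L5; L7]); (L7, [:: L6; L8]); (L8, [:: L7; L9]);
    (L9, [:: L5; L8])].

Lemma theta_search :
  search_from (joinable_avoiding [::]) (colourable_or_embeds targets) theta.
Proof. by vm_compute. Qed.

Lemma fused_search :
  search_from (joinable_avoiding fused_blocked) (colourable_or_embeds targets) fused_pentagons.
Proof. by vm_compute. Qed.

Lemma pendant_search :
  search_from (joinable_avoiding pendant_blocked) (colourable_or_embeds targets) pendant_pentagon.
Proof. by vm_compute. Qed.

Lemma hexagon_search :
  search_from joinable_girth6 (colourable_or_embeds targets) hexagon.
Proof. by vm_compute. Qed.

Lemma edge_ball_search :
  search_from joinable_girth6 (colourable_or_embeds targets) edge_ball.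
Proof. by vm_compute. Qed.

(** * Classification of the snarks *)

Section Classification.
Variable G : sgraph.
Hypothesis cubic : regular 3 G.
Hypothesis conn : connected G.
Hypothesis card20 : #|G| = 20.
Hypothesis no_triangle : triangle_free G.
Hypothesis no_square : square_free G.

Let reached := leaf_reached G (colourable_or_embeds targets).
Let search_sound_from := search_from_sound no_triangle no_square cubic conn card20.

Lemma avoids_girth5 Ps : avoids G Ps -> avoids G [:: triangle, square & Ps].
Proof. by move=> av; rewrite /avoids /= no_triangle_table // no_square_table. Qed.

Lemma reached_from_theta : contains G theta -> reached.
Proof.
have adm : admits_new_vertices G (joinable_avoiding [::]) theta.
  exact: joinable_avoiding_admits (isT : blocks triangle theta [::]) _ (no_triangle_table _).
have av : avoids G [:: triangle; square] by apply: avoids_girth5.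
by move=> h; apply: (search_sound_from adm av _ _ _ h theta_search); vm_compute.
Qed.

Lemma reached_from_fused_pentagons :
  ~~ contains G theta -> contains G fused_pentagons -> reached.
Proof.
move=> no_theta; have av : avoids G [:: triangle; square; theta].
  by apply: avoids_girth5; rewrite /avoids /= no_theta.
have blocked : blocks theta fused_pentagons fused_blocked by vm_compute.
have adm := joinable_avoiding_admits no_triangle no_square blocked isT no_theta.
by move=> h; apply: (search_sound_from adm av _ _ _ h fused_search); vm_compute.
Qed.

Lemma contains_pendant_pentagon : contains G pentagon -> contains G pendant_pentagon.
Proof.
have av : avoids G [:: triangle; square] by apply: avoids_girth5.
by move=> h; do 5![apply: (contains_pendant cubic _ av); [by vm_compute | by vm_compute |]].
Qed.

Lemma reached_from_pendant_pentagon : ~~ contains G theta -> ~~ contains G fused_pentagons ->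
  contains G pendant_pentagon -> reached.
Proof.
move=> no_theta no_fused; have av : avoids G [:: triangle; square; theta].
  by apply: avoids_girth5; rewrite /avoids /= no_theta.
have blocked : blocks fused_pentagons pendant_pentagon pendant_blocked by vm_compute.
have adm := joinable_avoiding_admits no_triangle no_square blocked isT no_fused.
by move=> h; apply: (search_sound_from adm av _ _ _ h pendant_search); vm_compute.
Qed.

Lemma reached_from_hexagon : ~~ contains G pentagon -> contains G hexagon -> reached.
Proof.
move=> no_pentagon; have av : avoids G [:: triangle; square; pentagon].
  by apply: avoids_girth5; rewrite /avoids /= no_pentagon.
have adm := joinable_girth6_admits no_triangle no_square (t := hexagon) no_pentagon.
by move=> h; apply: (search_sound_from adm av _ _ _ h hexagon_search); vm_compute.
Qed.

Lemma reached_from_edge_ball : ~~ contains G pentagon -> ~~ contains G hexagon -> reached.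
Proof.
move=> no_pentagon no_hexagon.
have av : avoids G [:: triangle; square; pentagon; hexagon].
  by apply: avoids_girth5; rewrite /avoids /= no_pentagon no_hexagon.
have adm := joinable_girth6_admits no_triangle no_square (t := edge_ball) no_pentagon.
suff h : contains G edge_ball.
  by apply: (search_sound_from adm av _ _ _ h edge_ball_search); vm_compute.
do 13![apply: (contains_pendant cubic _ av); [by vm_compute | by vm_compute |]].
have /card_gt0P[v _] : 0 < #|G| by rewrite card20.
by apply/containsP; exists (fun=> v).
Qed.

Lemma labelling_reached : reached.
Proof.
have [/reached_from_theta//|no_theta] := boolP (contains G theta).
have [/(reached_from_fused_pentagons no_theta)//|no_fused] := boolP (contains G fused_pentagons).
have [/contains_pendant_pentagon|no_pentagon] := boolP (contains G pentagon).
  exact: reached_from_pendant_pentagon.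
have [/reached_from_hexagon|no_hexagon] := boolP (contains G hexagon); first exact.
exact: reached_from_edge_ball.
Qed.

Lemma petersen_minus_vertex_three_cut :
  contains G petersen_minus_vertex -> exists S, nontrivial_three_cut (G := G) S.
Proof.
have av : avoids G [:: triangle; square] by apply: avoids_girth5.
case/containsP=> env te; exists (cut_edges (placed env petersen_minus_vertex)).
have inj := realizes_inj te.
have linkedE := rigid_linked av te (isT : rigid [:: triangle; square] petersen_minus_vertex).
have card9 : #|placed env petersen_minus_vertex| = 9.
  by rewrite card_in_imset //; apply/card_uniqP.
apply: three_edge_cut => //; first by rewrite card9.
  by have := cardsC (placed env petersen_minus_vertex); rewrite card9 card20; lia.
by rewrite (arcs_placed cubic _ inj linkedE).
Qed.

Lemma realizes_cubic t (env : label -> G) : realizes t env ->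
  all (fun a => (a \in unzip1 t) && (size (nbrs t a) == 3)) labels ->
  injective env /\ forall a b, adj (env a) (env b) = linked t a b.
Proof.
move=> te /allP t3; have key a : a \in unzip1 t by have /andP[] := t3 a (mem_labels a).
have inj : injective env by move=> a b; apply: (realizes_inj te).
split=> // a b; apply/idP/idP => [ab|]; last exact: realizes_linked te.
have /andP[_ /eqP a3] := t3 a (mem_labels a).
have : env b \in [seq env c | c <- nbrs t a].
  apply: (nbrs_exhausted cubic _ _ _ ab); rewrite ?size_map ?a3 //.
    by rewrite map_inj_uniq ?uniq_nbrs.
  by move=> _ /mapP[c ac ->]; apply: (realizes_linked te); rewrite -mem_nbrs.
by rewrite mem_map ?mem_nbrs.
Qed.

End Classification.

Lemma nontrivial_snark20 (G : sgraph) : nontrivial_snark G -> #|G| = 20 ->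
  exists2 t, t \in snarks & exists2 phi : label -> G, injective phi &
    forall a b, adj (phi a) (phi b) = linked t a b.
Proof.
case=> -[conn _ cubic [_ chi]].
move=> /[dup] /girth5_triangle_free tf /girth5_square_free sf no_cut card20.
have [env [cs [I]]] := labelling_reached cubic conn card20 tf sf.
rewrite /colourable_or_embeds -has_find.
case: ifP => [/(three_colourable_sound I)/chi //|_ /hasP[t t_target tcs]].
have tG : contains G t.
  apply: contains_embeds tcs _; apply/containsP; exists env.
  exact: placement_realizes I (suffix_refl cs).
have t_snark : t \in snarks.
  move: t_target; rewrite inE => /predU1P[tE|//]; case: no_cut.
  by apply: (petersen_minus_vertex_three_cut cubic conn card20 tf sf); rewrite -tE.
exists t => //; have /containsP[env' te] := tG.
have snarks_cubic :
    all (fun t => all (fun a => (a \in unzip1 t) && (size (nbrs t a) == 3)) labels) snarks.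
  by vm_compute.
by have [inj adjE] := realizes_cubic cubic te (allP snarks_cubic t t_snark); exists env'.
Qed.

(** * Covers by copies of a graph *)

Section Covers.
(* The edges of a graph with vertices [0, ..., k - 1]; a block lists the images of these
   vertices. *)
Variables (k : nat) (es : seq (nat * nat)).

Section Notions.
Variable T : eqType.
Implicit Types (x y : T) (b s : seq T) (ss : seq (seq T)) (V : pred T).

Definition joined b x y : bool :=
  has (fun e => ((onth b e.1 == Some x) && (onth b e.2 == Some y)) ||
                ((onth b e.2 == Some x) && (onth b e.1 == Some y))) es.

Lemma joinedC b x y : joined b x y = joined b y x.
Proof. by apply: eq_has => e; rewrite orbC andbC [X in _ || X]andbC. Qed.

Definition covers V (H : T -> T -> Prop) (m : nat) : Prop :=
  exists B : seq (seq T),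
    [/\ size B = m, {in B, forall b, [/\ size b = k, uniq b & all V b]} &
      forall x y, H x y -> exists2 b, b \in B & joined b x y].

Definition complete_cover_on s m :=
  covers (mem s) (fun x y => [/\ x \in s, y \in s & x != y]) m.

Definition part_of ss x : nat := find (fun s => x \in s) ss.

Definition multipartite_cover_on ss m :=
  covers (mem (flatten ss))
    (fun x y => [/\ x \in flatten ss, y \in flatten ss & part_of ss x != part_of ss y]) m.

Lemma mem_part ss x : x \in flatten ss -> x \in nth [::] ss (part_of ss x).
Proof.
case/flattenP=> s sss xs.
have xss : has (fun s' => x \in s') ss by apply/hasP; exists s.
exact: nth_find xss.
Qed.

Lemma part_of_lt ss x : x \in flatten ss -> part_of ss x < size ss.
Proof. by case/flattenP=> s sss xs; rewrite -has_find; apply/hasP; exists s. Qed.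

Lemma mem_nth_flatten ss i x : x \in nth [::] ss i -> x \in flatten ss.
Proof.
move=> xi; apply/flattenP; exists (nth [::] ss i) => //; apply: mem_nth.
by rewrite ltnNge; apply: contraL xi => /(nth_default [::])->.
Qed.

Lemma part_of_nth ss i x : uniq (flatten ss) -> x \in nth [::] ss i -> part_of ss x = i.
Proof.
rewrite /part_of; elim: ss i => [|s ss IH] [|i] //=; first by move=> _ ->.
rewrite cat_uniq => /and3P[_ /hasPn disjoint uss] xi; rewrite (IH i) // ifN //.
exact/disjoint/mem_nth_flatten/xi.
Qed.

Lemma uniq_part ss i : uniq (flatten ss) -> uniq (nth [::] ss i).
Proof.
elim: ss i => [|s ss IH] [|i] //=; rewrite cat_uniq => /and3P[us _ uss] //.
exact: IH.
Qed.

Lemma apart_or_together ss t x y : 0 < size ss -> x \in flatten ss ++ t -> y \in flatten ss ++ t ->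
  [/\ x \in flatten ss, y \in flatten ss & part_of ss x != part_of ss y] \/
  exists2 i, i < size ss & (x \in nth [::] ss i ++ t) && (y \in nth [::] ss i ++ t).
Proof.
move=> ss0; rewrite !mem_cat; have [xss _|xN /= xt] := boolP (x \in flatten ss).
  have [yss _|yN /= yt] := boolP (y \in flatten ss).
    have [pE|ne] := eqVneq (part_of ss x) (part_of ss y); last by left.
    by right; exists (part_of ss x); rewrite ?part_of_lt // !mem_cat {2}pE !mem_part.
  by right; exists (part_of ss x); rewrite ?part_of_lt // !mem_cat mem_part // yt orbT.
have [yss _|yN /= yt] := boolP (y \in flatten ss).
  by right; exists (part_of ss y); rewrite ?part_of_lt // !mem_cat xt mem_part ?orbT.
by right; exists 0; rewrite // !mem_cat xt yt !orbT.
Qed.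

Lemma covers_widen V V' H m : (forall x, V x -> V' x) -> covers V H m -> covers V' H m.
Proof.
move=> VV' [B [sB gB cB]]; exists B; split=> // b /gB[sb ub bV]; split=> //.
exact: sub_all VV' _ bV.
Qed.

Lemma covers_sub V (H H' : T -> T -> Prop) m :
  (forall x y, H' x y -> H x y) -> covers V H m -> covers V H' m.
Proof. by move=> HH' [B [? ? cB]]; exists B; split=> // x y /HH'/cB. Qed.

Lemma covers0 V H : (forall x y, ~ H x y) -> covers V H 0.
Proof. by move=> H0; exists [::]; split=> // x y /H0. Qed.

Lemma covers_union V (H1 H2 : T -> T -> Prop) m1 m2 :
  covers V H1 m1 -> covers V H2 m2 -> covers V (fun x y => H1 x y \/ H2 x y) (m1 + m2).
Proof.
move=> [B1 [<- g1 c1]] [B2 [<- g2 c2]]; exists (B1 ++ B2); split.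
- by rewrite size_cat.
- by move=> b; rewrite mem_cat => /orP[/g1|/g2].
by move=> x y [/c1|/c2] [b bB j]; exists b; rewrite // mem_cat bB ?orbT.
Qed.

Lemma covers_seq (I : eqType) (r : seq I) V (H : I -> T -> T -> Prop) (m : I -> nat) :
  {in r, forall i, covers V (H i) (m i)} ->
  covers V (fun x y => exists2 i, i \in r & H i x y) (\sum_(i <- r) m i).
Proof.
elim: r => [|i r IH] h; first by rewrite big_nil; apply: covers0 => x y [].
rewrite big_cons.
have cr : covers V (fun x y => exists2 j, j \in r & H j x y) (\sum_(j <- r) m j).
  by apply: IH => j jr; apply: h; rewrite inE jr orbT.
apply: covers_sub (covers_union (h i (mem_head i r)) cr) => x y [j].
by rewrite inE => /predU1P[->|jr] hj; [left | right; exists j].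
Qed.

End Notions.

Lemma joined_map (T T' : eqType) (g : T -> T') b x y :
  joined b x y -> joined (map g b) (g x) (g y).
Proof.
case/hasP=> e ein he; apply/hasP; exists e => //; rewrite !onth_map.
by case/orP: he => /andP[/eqP-> /eqP->]; rewrite !eqxx ?orbT.
Qed.

Lemma covers_map (T T' : eqType) (g : T -> T') (V : pred T) (V' : pred T') H H' m :
  {in V &, injective g} -> (forall x, V x -> V' (g x)) ->
  (forall x' y', H' x' y' -> exists x y, [/\ g x = x', g y = y' & H x y]) ->
  covers V H m -> covers V' H' m.
Proof.
move=> inj gV gH [B [sB gB cB]]; exists (map (map g) B); split; first by rewrite size_map.
  move=> _ /mapP[b /gB[sb ub /allP Vb] ->]; split; first by rewrite size_map.
    by rewrite map_inj_in_uniq // => x y /Vb xV /Vb yV; apply: inj.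
  by apply/allP => _ /mapP[x /Vb xV ->]; apply: gV.
move=> x' y' /gH[x [y [<- <- /cB[b bB /(joined_map g)]]]].
by exists (map g b); first exact: map_f.
Qed.

Lemma complete_cover_transport (T T' : eqType) (x0 : T) (x0' : T') (s : seq T) (s' : seq T') m :
  uniq s -> uniq s' -> size s = size s' -> complete_cover_on s m -> complete_cover_on s' m.
Proof.
move=> us us' ss'; pose g x := nth x0' s' (index x s); pose g' x := nth x0 s (index x s').
have g's x : x \in s' -> g' x \in s by move=> xs; rewrite mem_nth // ss' index_mem.
have g'K x : x \in s' -> g (g' x) = x.
  by move=> xs; rewrite /g /g' index_uniq ?ss' ?index_mem // nth_index.
apply: (covers_map (g := g)) => [x y xs ys|x xs|x y [xs ys xy]].
- move/eqP; rewrite nth_uniq -?ss' ?index_mem // => /eqP E.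
  by rewrite -(nth_index x0 xs) E nth_index.
- by rewrite /g /= mem_nth // -ss' index_mem.
exists (g' x), (g' y); split; rewrite ?g'K ?g's //; split; rewrite ?g's //.
by apply: contra xy => /eqP E; rewrite -(g'K x) // E g'K.
Qed.

Definition relabel (T T' : eqType) (x0' : T') (ss : seq (seq T)) (ss' : seq (seq T')) (x : T) :=
  nth x0' (nth [::] ss' (part_of ss x)) (index x (nth [::] ss (part_of ss x))).

Section Relabel.
Variables (T T' : eqType) (x0 : T) (x0' : T') (ss : seq (seq T)) (ss' : seq (seq T')).
Hypotheses (uss : uniq (flatten ss)) (uss' : uniq (flatten ss')) (shE : shape ss = shape ss').

Lemma size_part i : size (nth [::] ss i) = size (nth [::] ss' i).
Proof. by rewrite -!nth_shape shE. Qed.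

Lemma mem_relabel x : x \in flatten ss ->
  relabel x0' ss ss' x \in nth [::] ss' (part_of ss x).
Proof. by move=> xss; rewrite mem_nth // -size_part index_mem mem_part. Qed.

Lemma part_relabel x : x \in flatten ss -> part_of ss' (relabel x0' ss ss' x) = part_of ss x.
Proof. by move=> xss; apply: part_of_nth => //; apply: mem_relabel. Qed.

Lemma relabelK x : x \in flatten ss -> relabel x0 ss' ss (relabel x0' ss ss' x) = x.
Proof.
move=> xss; rewrite {1}/relabel part_relabel // index_uniq ?uniq_part //.
  by rewrite nth_index ?mem_part.
by rewrite -size_part index_mem mem_part.
Qed.

End Relabel.

Lemma multipartite_cover_transport (T T' : eqType) (x0 : T) (x0' : T') ss ss' m :
  uniq (flatten ss) -> uniq (flatten ss') -> shape ss = shape ss' ->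
  multipartite_cover_on (T := T) ss m -> multipartite_cover_on (T := T') ss' m.
Proof.
move=> uss uss' shE; have shE' := esym shE.
apply: (covers_map (g := relabel x0' ss ss')) => [x y xss yss|x xss|x y [xss yss xy]].
- by move=> E; rewrite -(relabelK x0 x0' uss' shE xss) E relabelK.
- exact: mem_nth_flatten (mem_relabel x0' shE xss).
exists (relabel x0 ss' ss x), (relabel x0 ss' ss y); rewrite !relabelK //; split=> //.
rewrite !(part_relabel x0 uss shE') // !(mem_nth_flatten (mem_relabel x0 shE' _)) //.
Qed.

Definition complete_cover (n m : nat) : Prop := complete_cover_on (iota 0 n) m.

Definition multipartite_cover (ws : seq nat) (m : nat) : Prop :=
  multipartite_cover_on (reshape ws (iota 0 (sumn ws))) m.

Lemma complete_cover_of (T : eqType) (x0 : T) (s : seq T) m :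
  uniq s -> complete_cover_on s m -> complete_cover (size s) m.
Proof.
by move=> us; apply: (complete_cover_transport x0 0 us); rewrite ?iota_uniq ?size_iota.
Qed.

Lemma complete_cover_to (T : eqType) (x0 : T) (s : seq T) n m :
  uniq s -> size s = n -> complete_cover n m -> complete_cover_on s m.
Proof.
move=> us sn; apply: (complete_cover_transport 0 x0); rewrite ?iota_uniq ?size_iota //.
Qed.

Lemma shape_canonical ws : shape (reshape ws (iota 0 (sumn ws))) = ws.
Proof. by rewrite reshapeKl // size_iota. Qed.

Lemma uniq_canonical ws : uniq (flatten (reshape ws (iota 0 (sumn ws)))).
Proof. by rewrite reshapeKr ?iota_uniq // size_iota. Qed.

Lemma multipartite_cover_of (T : eqType) (x0 : T) (ss : seq (seq T)) m :
  uniq (flatten ss) -> multipartite_cover_on ss m -> multipartite_cover (shape ss) m.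
Proof.
move=> uss; apply: (multipartite_cover_transport x0 0) => //; first exact: uniq_canonical.
by rewrite shape_canonical.
Qed.

Lemma multipartite_cover_to (T : eqType) (x0 : T) (ss : seq (seq T)) ws m :
  uniq (flatten ss) -> shape ss = ws -> multipartite_cover ws m -> multipartite_cover_on ss m.
Proof.
move=> uss shE; apply: (multipartite_cover_transport 0 x0) => //; first exact: uniq_canonical.
by rewrite shape_canonical.
Qed.

Lemma fill_parts ws e m ms : 0 < size ws -> size ms = size ws -> multipartite_cover ws m ->
  (forall i, i < size ws -> complete_cover (nth 0 ws i + e) (nth 0 ms i)) ->
  complete_cover (sumn ws + e) (m + sumn ms).
Proof.
rewrite /multipartite_cover => ws0 sms; set ss := reshape ws _ => css cparts.
have ssE : flatten ss = iota 0 (sumn ws) by rewrite reshapeKr ?size_iota.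
pose t := iota (sumn ws) e.
have sss : size ss = size ws by rewrite -(size_map size) -/(shape ss) shape_canonical.
rewrite /complete_cover iotaD -ssE add0n -/t; set V := mem (flatten ss ++ t).
have {}css : covers V (fun x y => [/\ x \in flatten ss, y \in flatten ss &
    part_of ss x != part_of ss y]) m.
  by apply: covers_widen css => x xss; rewrite /V /= mem_cat [_ \in _]xss.
have {}cparts i : i \in iota 0 (size ms) -> covers V (fun x y => [/\ x \in nth [::] ss i ++ t,
    y \in nth [::] ss i ++ t & x != y]) (nth 0 ms i).
  rewrite mem_iota sms => /cparts/(complete_cover_to 0 (s := nth [::] ss i ++ t)) c.
  apply: covers_widen (c _ _) => [x||]; rewrite /V /= ?mem_cat.
  - by case/orP=> [/mem_nth_flatten->|->]; rewrite ?orbT.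
  - rewrite cat_uniq iota_uniq uniq_part ?uniq_canonical // andbT.
    apply/hasPn => x; rewrite mem_iota => /andP[xt _]; apply/negP => /mem_nth_flatten.
    by rewrite ssE mem_iota ltnNge xt.
  by rewrite size_cat size_iota -nth_shape shape_canonical.
rewrite sumnE -[X in \sum_(_ <- X) _](mkseq_nth 0) big_map.
apply: covers_sub (covers_union css (covers_seq cparts)) => x y [xs ys xy].
have ss0 : 0 < size ss by rewrite sss.
have [|[i il /andP[xi yi]]] := apart_or_together ss0 xs ys; [by left | right].
by exists i; rewrite ?mem_iota ?sms -?sss.
Qed.

Lemma complete_cover_singletons n m :
  0 < n -> multipartite_cover (nseq n 1) m -> complete_cover n m.
Proof.
move=> n0 c; have := @fill_parts (nseq n 1) 0 m (nseq n 0).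
rewrite !sumn_nseq mul1n mul0n !addn0 !size_nseq; apply=> // i im.
by rewrite !nth_nseq im; apply: covers0 => x y []; rewrite !mem_iota; lia.
Qed.

Lemma multipartite_cover_perm (T : eqType) (ss ss' : seq (seq T)) m :
  uniq (flatten ss) -> perm_eq ss ss' -> multipartite_cover_on ss m -> multipartite_cover_on ss' m.
Proof.
move=> uss pss; have ssE := perm_mem (perm_flatten pss).
move=> c; apply: covers_widen (covers_sub _ c) => [x|x y]; first by rewrite /= -ssE.
rewrite -!ssE => -[xss yss /negP ne]; split=> //; apply/negP => /eqP pE; apply: ne.
have s'ss : nth [::] ss (part_of ss x) \in ss' by rewrite -(perm_mem pss) mem_nth ?part_of_lt.
have uss' : uniq (flatten ss') by rewrite -(perm_uniq (perm_flatten pss)).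
have part' z : z \in nth [::] ss (part_of ss x) ->
    part_of ss' z = index (nth [::] ss (part_of ss x)) ss'.
  by move=> zs; apply: part_of_nth; rewrite ?nth_index.
by rewrite !part' ?mem_part // pE mem_part.
Qed.

Lemma multipartite_cover_rcons0 ws m :
  multipartite_cover ws m -> multipartite_cover (rcons ws 0) m.
Proof.
rewrite /multipartite_cover sumn_rcons addn0; set s := iota _ _.
have -> : reshape (rcons ws 0) s = rcons (reshape ws s) [::].
  have : size s = sumn ws by rewrite size_iota.
  by elim: ws s => [|w ws IH] s /= sE; rewrite ?IH ?take0 // size_drop sE addKn.
rewrite -cats1 /multipartite_cover_on flatten_cat /= cats0; apply: covers_sub => x y [xs ys].
by rewrite /part_of !find_cat !has_find !part_of_lt.
Qed.

End Covers.

(** * Cyclic development *)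

Record orbit := Orbit { orbit_length : nat; first_part : nat; part_count : nat }.

Section Development.
Variables (k : nat) (es : seq (nat * nat)).
(* The point [(j, a)] is the [a]-th one of the [j]-th orbit of a cyclic group of order [N]; the
   points of an orbit are spread in turn over [part_count] consecutive parts. *)
Variables (N : nat) (orbits : seq orbit).
Implicit Types (p q x y : nat * nat) (b : seq (nat * nat)) (bs : seq (seq (nat * nat))).

Definition orbit_of j : orbit := nth (Orbit 0 0 0) orbits j.

Definition orbit_indices : seq nat := iota 0 (size orbits).

Definition valid_point p : bool := p.2 < orbit_length (orbit_of p.1).

Definition part p : nat := first_part (orbit_of p.1) + p.2 %% part_count (orbit_of p.1).

Definition points : seq (nat * nat) :=
  [seq (j, a) | j <- orbit_indices, a <- iota 0 (orbit_length (orbit_of j))].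

Definition parts (r : nat) : seq (seq (nat * nat)) :=
  [seq [seq p <- points | part p == i] | i <- iota 0 r].

Definition translate (t : nat) p : nat * nat := (p.1, (p.2 + t) %% orbit_length (orbit_of p.1)).

Definition code p q : nat := (q.2 + (N - p.2)) %% orbit_length (orbit_of q.1).

Definition same_part_code (j l d : nat) : bool :=
  (first_part (orbit_of j) == first_part (orbit_of l)) && (d %% part_count (orbit_of l) == 0).

Definition full (o : orbit) : bool := orbit_length o == N.

Definition well_formed_orbit (r j : nat) : bool :=
  let o := orbit_of j in
  [&& 0 < orbit_length o, orbit_length o %| N, 0 < part_count o,
      part_count o %| orbit_length o &
      (first_part o + part_count o <= r) && (full o || (part_count o == 1))].

Definition compatible_orbits (j l : nat) : bool :=
  if first_part (orbit_of j) == first_part (orbit_of l)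
  then part_count (orbit_of j) == part_count (orbit_of l)
  else full (orbit_of j) || full (orbit_of l).

Definition well_formed_block b : bool := [&& size b == k, uniq b & all valid_point b].

Definition block_arcs b : seq ((nat * nat) * (nat * nat)) :=
  let end_points e := (nth (0, 0) b e.1, nth (0, 0) b e.2) in
  [seq end_points e | e <- es] ++ [seq end_points (e.2, e.1) | e <- es].

Definition develops (ws : seq nat) bs : bool :=
  [&& all (well_formed_orbit (size ws)) orbit_indices && all2rel compatible_orbits orbit_indices,
      shape (parts (size ws)) == ws,
      all well_formed_block bs, all (fun e => (e.1 < k) && (e.2 < k)) es &
      let arcs := flatten (map block_arcs bs) in
      all (fun j => full (orbit_of j) ==> all (fun l =>
        let codes := [seq code pq.1 pq.2 | pq <- arcs & (pq.1.1 == j) && (pq.2.1 == l)] in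
        all (fun d => same_part_code j l d || has (eqn d) codes)
          (iota 0 (orbit_length (orbit_of l)))) orbit_indices) orbit_indices].

Lemma uniq_flatten_filter (T : eqType) (g : T -> nat) (s : seq T) (r : seq nat) :
  uniq s -> uniq r -> uniq (flatten [seq [seq x <- s | g x == i] | i <- r]).
Proof.
move=> us; elim: r => //= i r IH /andP[ir ur]; rewrite cat_uniq filter_uniq ?IH // andbT.
apply/hasPn => x /flattenP[_ /mapP[i' i'r ->]]; rewrite !mem_filter => /andP[/eqP-> _].
by apply: contra ir => /andP[/eqP<-].
Qed.

Lemma valid_point_index p : valid_point p -> p.1 \in orbit_indices.
Proof.
by rewrite mem_iota /valid_point /orbit_of; case: (ltnP p.1) => // /(nth_default (Orbit 0 0 0))->.
Qed.

Lemma mem_points p : (p \in points) = valid_point p.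
Proof.
apply/allpairsPdep/idP => [[j [a [_ + ->]]]|vp]; first by rewrite mem_iota.
by exists p.1, p.2; rewrite valid_point_index // mem_iota; case: p vp.
Qed.

Lemma uniq_parts r : uniq (flatten (parts r)).
Proof.
apply: uniq_flatten_filter (iota_uniq 0 r); apply: allpairs_uniq_dep => [|j _|].
- exact: iota_uniq.
- exact: iota_uniq.
by move=> [j a] [j' a'] _ _ /= [<- <-].
Qed.

Lemma mem_nth_parts r i p :
  (p \in nth [::] (parts r) i) = [&& i < r, part p == i & valid_point p].
Proof.
have [ir|ri] := ltnP i r; last by rewrite nth_default // size_map size_iota.
by rewrite (nth_map 0) ?size_iota // nth_iota // mem_filter mem_points.
Qed.

Lemma mem_parts r p : (p \in flatten (parts r)) = (part p < r) && valid_point p.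
Proof.
apply/idP/idP => [/mem_part|/andP[pr vp]].
  by rewrite mem_nth_parts => /and3P[pr /eqP-> ->]; rewrite pr.
by apply: (@mem_nth_flatten _ _ (part p)); rewrite mem_nth_parts pr eqxx.
Qed.

Lemma part_of_parts r p : part p < r -> valid_point p -> part_of (parts r) p = part p.
Proof. by move=> pr vp; apply: part_of_nth (uniq_parts r) _; rewrite mem_nth_parts pr eqxx. Qed.

Section Developed.
Variables (ws : seq nat) (bs : seq (seq (nat * nat))).
Hypothesis dev : develops ws bs.

Lemma orbit_ofP p : valid_point p ->
  [/\ 0 < orbit_length (orbit_of p.1), orbit_length (orbit_of p.1) %| N,
      0 < part_count (orbit_of p.1), part_count (orbit_of p.1) %| orbit_length (orbit_of p.1) &
      part p < size ws].
Proof.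
move=> vp; have /and5P[/andP[/allP wf _] _ _ _ _] := dev.
have /and5P[l0 lN m0 ml /andP[fr _]] := wf _ (valid_point_index vp).
by split=> //; apply: leq_trans fr; rewrite ltn_add2l ltn_mod.
Qed.

Lemma part_code x y : valid_point x -> valid_point y -> full (orbit_of x.1) ->
  same_part_code x.1 y.1 (code x y) -> part x = part y.
Proof.
move=> vx vy /eqP fx /andP[/eqP fE]; have /and5P[/andP[_ /allrelP comp] _ _ _ _] := dev.
have := comp _ _ (valid_point_index vx) (valid_point_index vy).
rewrite /compatible_orbits fE eqxx => /eqP mE.
have [_ lN _ ml _] := orbit_ofP vy; rewrite /part fE mE modn_dvdm // => /eqP d0; congr (_ + _).
have aN : x.2 <= N by apply: ltnW; rewrite -fx.
have : y.2 + N = y.2 + (N - x.2) + x.2 by rewrite -addnA subnK.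
move/(congr1 (modn^~ (part_count (orbit_of y.1)))).
by rewrite -modnDmr (eqP (dvdn_trans ml lN)) addn0 -[RHS]modnDml d0 add0n => ->.
Qed.

(* The translation carrying [p] to [x] also carries [q] to [y], as the codes agree. *)
Lemma translate_arc p q x y : valid_point p -> valid_point x -> valid_point y ->
  p.1 = x.1 -> q.1 = y.1 -> full (orbit_of x.1) -> code p q = code x y ->
  exists2 t, t < N & translate t p = x /\ translate t q = y.
Proof.
case: p q x y => [j a'] [l c'] [j' a] [l' c] vp vx vy /= ? ? /eqP fx; subst j' l'.
have [_ /= lN _ _ _] := orbit_ofP vy.
move: vp vx vy; rewrite /valid_point /code /= fx => pN xN yl cE.
exists ((a + (N - a')) %% N); first by rewrite ltn_mod (leq_ltn_trans _ xN).
rewrite /translate /= fx modnDmr; split; congr pair.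
  by rewrite (_ : a' + (a + (N - a')) = a + N) ?modnDr ?modn_small //; lia.
rewrite -modnDmr modn_dvdm // modnDmr (_ : c' + (a + (N - a')) = c' + (N - a') + a); last by lia.
rewrite -modnDml cE modnDml (_ : c + (N - a) + a = c + N); last by lia.
by rewrite -modnDmr (eqP lN) addn0 modn_small.
Qed.

Lemma block_arc_joined b p q : b \in bs -> (p, q) \in block_arcs b ->
  joined es b p q /\ (valid_point p /\ valid_point q).
Proof.
have /and5P[_ _ /allP bP /allP eP _] := dev => /bP/and3P[/eqP sb _ /allP vb].
have onE i : i < k -> onth b i = Some (nth (0, 0) b i).
  by move=> ik; rewrite onthE (nth_map (0, 0)) ?sb.
rewrite mem_cat => /orP[] /mapP[e ein [-> ->]]; have /andP[e1 e2] := eP e ein.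
  by split; [apply/hasP; exists e; rewrite // !onE // !eqxx | rewrite !vb ?mem_nth ?sb].
by split; [apply/hasP; exists e; rewrite // !onE // !eqxx orbT | rewrite !vb ?mem_nth ?sb].
Qed.

Definition developed : seq (seq (nat * nat)) := [seq map (translate t) b | t <- iota 0 N, b <- bs].

Lemma developed_block b : b \in developed ->
  [/\ size b = k, uniq b & all (mem (flatten (parts (size ws)))) b].
Proof.
have /and5P[_ _ /allP bP _ _] := dev.
case/allpairsP=> -[t c] [_ /bP/and3P[/eqP sc uc /allP vc] ->] /=; split.
- by rewrite size_map.
- rewrite map_inj_in_uniq // => -[j a] [j' a'] /vc va /vc vc' [jj]; subst j'.
  by move/eqP; rewrite eqn_modDr !modn_small // => /eqP->.
apply/allP => _ /mapP[p /vc vp ->]; rewrite /= mem_parts.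
have vt : valid_point (translate t p).
  by rewrite /valid_point /= ltn_mod; have [] := orbit_ofP vp.
by rewrite vt andbT; have [] := orbit_ofP vt.
Qed.

Lemma developed_joined x y : valid_point x -> valid_point y -> full (orbit_of x.1) ->
  part x != part y -> exists2 b, b \in developed & joined es b x y.
Proof.
move=> vx vy fx apart; have /and5P[_ _ _ _ /allP/(_ x.1)] := dev.
rewrite valid_point_index // fx => /(_ isT)/allP/(_ y.1).
rewrite valid_point_index // => /(_ isT)/allP/(_ (code x y)).
rewrite mem_iota ltn_mod; have [-> _ _ _ _] := orbit_ofP vy => /(_ isT).
case/orP=> [/part_code E|/hasP[_ /mapP[[p q] + ->] /eqnP cE]]; first by rewrite E ?eqxx in apart.
rewrite mem_filter => /andP[/andP[/eqP px /eqP qy] /flattenP[_ /mapP[b bb ->] pq]].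
have [j [vp vq]] := block_arc_joined bb pq.
have [t tN [<- <-]] := translate_arc vp vx vy px qy fx (esym cE).
exists (map (translate t) b); last exact: joined_map.
by apply/allpairsP; exists (t, b); rewrite mem_iota.
Qed.

Lemma full_orbit_of_apart x y : valid_point x -> valid_point y -> part x != part y ->
  full (orbit_of x.1) || full (orbit_of y.1).
Proof.
move=> vx vy apart; have /and5P[/andP[/allP wf /allrelP comp] _ _ _ _] := dev.
have ox := valid_point_index vx; have oy := valid_point_index vy; have := comp _ _ ox oy.
have /and5P[_ _ _ _ /andP[_]] := wf _ ox.
have /and5P[_ _ _ _ /andP[_]] := wf _ oy.
rewrite /compatible_orbits.
case: (full (orbit_of x.1)) => //; case: (full (orbit_of y.1)) => //= /eqP my /eqP mx.
by case: eqP => // fE _; rewrite /part mx my !modn1 fE eqxx in apart.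
Qed.

Lemma develops_cover : multipartite_cover k es ws (N * size bs).
Proof.
have /and5P[_ /eqP shE _ _ _] := dev; rewrite -[ws]shE.
apply: (multipartite_cover_of (0, 0)) (uniq_parts _) _.
exists developed; split; first by rewrite size_allpairs size_iota.
  by move=> b /developed_block.
move=> x y []; rewrite !mem_parts => /andP[xr vx] /andP[yr vy]; rewrite !part_of_parts // => apart.
have [fx|fy] := orP (full_orbit_of_apart vx vy apart); first exact: developed_joined.
have [|b bB j] := developed_joined vy vx fy; first by rewrite eq_sym.
by exists b; rewrite // joinedC.
Qed.

End Developed.
End Development.

(** * Blowing up a linear space *)

Section LinearSpace.
Variables (k : nat) (es : seq (nat * nat)) (w : nat -> nat).
Implicit Types (P Q : nat) (p q : nat * nat) (l : seq nat).

Definition fibre P : seq (nat * nat) := [seq (P, a) | a <- iota 0 (w P)].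

Definition fibres l : seq (seq (nat * nat)) := map fibre l.

(* A line through the point [0] also takes care of the pairs inside its fibres. *)
Definition line_cover l m : Prop :=
  if 0 \in l then complete_cover_on k es (flatten (fibres l)) m
  else multipartite_cover_on k es (fibres l) m.

Lemma mem_fibres l p : (p \in flatten (fibres l)) = (p.1 \in l) && (p.2 < w p.1).
Proof.
case: p => P a; apply/flattenP/andP => [[_ /mapP[Q Ql ->] /mapP[b]]|[/= Pl aP]].
  by rewrite mem_iota => bQ [-> ->].
by exists (fibre P); [apply: map_f | apply: map_f; rewrite mem_iota].
Qed.

Lemma shape_fibres l : shape (fibres l) = map w l.
Proof. by rewrite /shape -map_comp; apply: eq_map => P /=; rewrite size_map size_iota. Qed.

Lemma uniq_fibres l : uniq l -> uniq (flatten (fibres l)).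
Proof.
elim: l => //= P l IH /andP[Pl ul]; rewrite cat_uniq IH // andbT.
rewrite map_inj_uniq => [|a b []//]; rewrite iota_uniq /=; apply/hasPn => p.
by rewrite mem_fibres => /andP[pl _]; apply: contra Pl => /mapP[a _ pE]; rewrite pE in pl.
Qed.

Lemma part_of_fibres l p : uniq l -> p \in flatten (fibres l) -> part_of (fibres l) p = index p.1 l.
Proof.
move=> ul; rewrite mem_fibres => /andP[pl pw]; apply: part_of_nth; first exact: uniq_fibres.
rewrite (nth_map 0) ?index_mem // nth_index //.
by case: p pw {pl} => P a aP; rewrite map_f ?mem_iota.
Qed.

Lemma line_cover_complete l m :
  0 \in l -> uniq l -> complete_cover k es (sumn (map w l)) m -> line_cover l m.
Proof.
move=> l0 ul; rewrite /line_cover l0; apply: (complete_cover_to (0, 0)) (uniq_fibres ul) _.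
by rewrite size_flatten shape_fibres.
Qed.

Lemma line_cover_multipartite l m :
  0 \notin l -> uniq l -> multipartite_cover k es (map w l) m -> line_cover l m.
Proof.
move=> l0 ul; rewrite /line_cover (negPf l0).
exact: (multipartite_cover_to (0, 0)) (uniq_fibres ul) (shape_fibres l).
Qed.

Lemma line_cover_perm l l' m : uniq l -> perm_eq l l' -> line_cover l m -> line_cover l' m.
Proof.
move=> ul pl; rewrite /line_cover -(perm_mem pl); have pf := perm_map fibre pl.
case: ifP => _; last exact: multipartite_cover_perm (uniq_fibres ul) pf.
have E := perm_mem (perm_flatten pf) => c.
by apply: covers_widen (covers_sub _ c) => [x|x y]; rewrite /= -?E.
Qed.

Definition on_line l p q : Prop :=
  [/\ p \in flatten (fibres l), q \in flatten (fibres l) & p.1 != q.1 \/ (0 \in l /\ p != q)].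

Lemma line_cover_covers l m V : uniq l -> {subset flatten (fibres l) <= V} ->
  line_cover l m -> covers k es V (on_line l) m.
Proof.
move=> ul lV; rewrite /line_cover; case: ifP => l0 c.
  apply: covers_widen (covers_sub _ c) => [x /lV //|p q [pl ql pq]]; split=> //.
  by case: pq => [|[]//]; apply: contra => /eqP->.
apply: covers_widen (covers_sub _ c) => [x /lV //|p q [pl ql [pq|[]]]]; last by rewrite l0.
split=> //; rewrite !part_of_fibres //; apply: contra pq => /eqP E.
move: pl ql; rewrite !mem_fibres => /andP[pl _] /andP[ql _].
by rewrite -(nth_index 0 pl) E nth_index.
Qed.

(* The pairs within a fibre are covered by a line joining it to the point [0]. *)
Lemma linear_space_cover (v : nat) (I : eqType) (r : seq I) (line : I -> seq nat)
    (cost : I -> nat) :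
  0 < v -> w 0 = 1 -> {in r, forall i, uniq (line i) /\ {subset line i <= iota 0 v}} ->
  {in r, forall i, line_cover (line i) (cost i)} ->
  (forall P Q, P < v -> Q < v -> P != Q -> exists2 i, i \in r & (P \in line i) && (Q \in line i)) ->
  complete_cover k es (\sum_(P <- iota 0 v) w P) (\sum_(i <- r) cost i).
Proof.
move=> v0 w0 lines lc joined_by; pose s := flatten (fibres (iota 0 v)).
suff : complete_cover_on k es s (\sum_(i <- r) cost i).
  rewrite -(big_map w predT id) -sumnE -shape_fibres -size_flatten.
  exact: complete_cover_of (0, 0) _ _ (uniq_fibres (iota_uniq 0 v)).
have cr : {in r, forall i, covers k es (mem s) (on_line (line i)) (cost i)}.
  move=> i ir; have [ul li] := lines i ir; apply: line_cover_covers (lc i ir) => // p.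
  by rewrite /= !mem_fibres => /andP[/li-> ->].
apply: covers_sub (covers_seq cr) => p q [].
rewrite !mem_fibres !mem_iota /= add0n => /andP[pv pw] /andP[qv qw] pq.
have [pqE|ne] := eqVneq p.1 q.1; last first.
  have [i ir /andP[pi qi]] := joined_by _ _ pv qv ne.
  by exists i => //; split; rewrite ?mem_fibres ?pi ?qi //; left.
have p0 : p.1 != 0.
  apply: contraNneq pq => p0; move: pw qw; rewrite -pqE p0 w0 !ltnS !leqn0 => /eqP p2 /eqP q2.
  by case: p q p2 q2 pqE {pv qv p0} => [P a] [Q b] /= -> -> ->.
have [i ir /andP[pi i0]] := joined_by _ _ pv v0 p0.
by exists i => //; split; [rewrite mem_fibres pi | rewrite mem_fibres -pqE pi pqE | right].
Qed.

End LinearSpace.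

(** * Triple systems from half-sums *)

Lemma sum_seq_const (I : Type) (r : seq I) a : \sum_(i <- r) a = a * size r.
Proof. by rewrite big_const_seq count_predT iter_addn_0. Qed.

Lemma sum_seq_const_except (I : eqType) (r : seq I) c a b : uniq r ->
  \sum_(x <- r) (if x == c then a else b) + b * (c \in r) = a * (c \in r) + b * size r.
Proof.
elim: r => [|x r IH] /=; first by rewrite big_nil; lia.
case/andP=> xr /IH; rewrite big_cons inE [c == x]eq_sym.
by case: eqVneq xr => [<-|_ _] /=; [move/negPf=> -> | ]; lia.
Qed.

Section HalfSums.
Variables (k : nat) (es : seq (nat * nat)) (M w1 w2 winf : nat).
Hypothesis M0 : 0 < M.
Hypothesis cover_30 : multipartite_cover k es [:: 30; 30; 30] 90.
Hypothesis cover_61 : complete_cover k es 61 61.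
Hypothesis cover_w1 : multipartite_cover k es [:: w1; 30; 30] (30 + 2 * w1).
Hypothesis cover_w2 : multipartite_cover k es [:: w2; 30; 30] (30 + 2 * w2).

(* The point [(x, i)] of [Z/M x Z/3] is numbered [3 * x + i], and [3 * M] is an additional point;
   the points with [x = 0] carry the exceptional weights. *)
Definition weight (P : nat) : nat :=
  if P < 3 then nth 0 [:: 1; w1; w2] P else if P == 3 * M then winf else 30.

(* Halving maps the even residues onto the first half of [0, ..., M - 1] and the odd ones onto the
   second half, for either parity of [M]. *)
Definition half_sum (x y : nat) : nat :=
  let s := if x + y < M then x + y else x + y - M in
  if s %% 2 == 0 then s %/ 2 else (s + M) %/ 2.

Definition next_level (i : nat) : nat := if i == 2 then 0 else i.+1.

Definition triple (i x y : nat) : seq nat :=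
  [:: 3 * x + i; 3 * y + i; 3 * half_sum x y + next_level i].

Definition special_cost (j : nat) : nat := nth 0 [:: 61; 30 + 2 * w1; 30 + 2 * w2] j.

Definition triple_cost (i x y : nat) : nat :=
  if x == 0 then special_cost i else if x + y == M then special_cost (next_level i) else 90.

Definition triple_lines : seq (seq nat * nat) :=
  [seq (triple i xy.1 xy.2, triple_cost i xy.1 xy.2) |
    i <- iota 0 3, xy <- [seq (x, y) | y <- iota 1 M.-1, x <- iota 0 y]].

Lemma triple_linesP l :
  reflect (exists i x y, [/\ i < 3, x < y < M & l = (triple i x y, triple_cost i x y)])
          (l \in triple_lines).
Proof.
apply: (iffP allpairsP) => [[[i [x y]] [+ /allpairsPdep[y' [x' [+ + [-> ->]]]] ->]]|].
  by rewrite !mem_iota /= => i3 yM xy; exists i, x', y'; split=> //; lia.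
move=> [i [x [y [i3 xyM ->]]]]; exists (i, (x, y)); rewrite mem_iota; split=> //.
by apply/allpairsPdep; exists y, x; rewrite !mem_iota; split=> //; lia.
Qed.

Lemma half_sumC x y : half_sum x y = half_sum y x.
Proof. by rewrite /half_sum addnC. Qed.

Lemma half_sum_lt x y : x < M -> y < M -> half_sum x y < M.
Proof. by move=> xM yM; rewrite /half_sum; do ?case: ifP; lia. Qed.

Lemma half_sum_eq0 x y : x < y < M -> (half_sum x y == 0) = (x + y == M).
Proof. by move=> xyM; rewrite /half_sum; do ?case: ifP; lia. Qed.

Lemma half_sum_solvable x z : x < M -> z < M -> exists2 y, y < M & half_sum x y = z.
Proof.
move=> xM zM; pose s := if 2 * z < M then 2 * z else 2 * z - M + (M.+1 %% 2).
exists (if x <= s then s - x else s + M - x); rewrite /half_sum /s; first by do ?case: ifP; lia.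
by do ?case: ifP; lia.
Qed.

Lemma next_level_lt i : i < 3 -> next_level i < 3.
Proof. by case: i => [|[|[|]]]. Qed.

Lemma next_level_neq i : i < 3 -> next_level i != i.
Proof. by case: i => [|[|[|]]]. Qed.

Definition ordinary (P : nat) : bool := (2 < P) && (weight P == 30).

Lemma ordinary_lt P : 2 < P < 3 * M -> ordinary P.
Proof. by rewrite /ordinary /weight => P3; do ?case: ifP; lia. Qed.

Lemma ordinary_line P Q R : ordinary P -> ordinary Q -> ordinary R ->
  uniq [:: P; Q; R] -> line_cover k es weight [:: P; Q; R] 90.
Proof.
move=> /andP[P2 /eqP wP] /andP[Q2 /eqP wQ] /andP[R2 /eqP wR] u.
by apply: line_cover_multipartite; rewrite //= ?wP ?wQ ?wR // !inE; lia.
Qed.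

Lemma special_line j P Q : j < 3 -> ordinary P -> ordinary Q -> P != Q ->
  line_cover k es weight [:: j; P; Q] (special_cost j).
Proof.
move=> j3 /andP[P2 /eqP wP] /andP[Q2 /eqP wQ] PQ.
have u : uniq [:: j; P; Q] by rewrite /= !inE; lia.
case: j j3 u => [|[|[|]]] // _ u; last 2 first.
- by apply: line_cover_multipartite; rewrite //= ?inE ?wP ?wQ //; lia.
- by apply: line_cover_multipartite; rewrite //= ?inE ?wP ?wQ //; lia.
by apply: line_cover_complete; rewrite //= wP wQ.
Qed.

Lemma triple_uniq i x y : i < 3 -> x < y < M ->
  uniq (triple i x y) /\ {subset triple i x y <= iota 0 (3 * M).+1}.
Proof.
move=> i3 xyM; have [ni nn] := (next_level_lt i3, next_level_neq i3).
have hM : half_sum x y < M by apply: half_sum_lt; lia.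
by split=> [|P]; rewrite /= !inE ?mem_iota; lia.
Qed.

Lemma triple_cover i x y : i < 3 -> x < y < M ->
  line_cover k es weight (triple i x y) (triple_cost i x y).
Proof.
move=> i3 xyM; have [u _] := triple_uniq i3 xyM; have ni := next_level_lt i3.
have hM : half_sum x y < M by apply: half_sum_lt; lia.
have h0 := half_sum_eq0 xyM; move: u; rewrite /triple_cost /triple => u.
have [x0|x0] := eqVneq x 0.
  subst x; move: u; rewrite muln0 add0n /= !inE => u.
  by apply: special_line; rewrite ?ordinary_lt //; lia.
rewrite -h0; have [{}h0|{}h0] := eqVneq (half_sum x y) 0; last first.
  by apply: ordinary_line; rewrite ?ordinary_lt //; lia.
rewrite h0 muln0 add0n in u *.
apply: (line_cover_perm (l := [:: next_level i; 3 * x + i; 3 * y + i])).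
- by move: u; rewrite /= !inE; lia.
- by rewrite (perm_catC [:: _] [:: _; _]).
by move: u; rewrite /= !inE => u; apply: special_line; rewrite ?ordinary_lt //; lia.
Qed.

Section Diagonal.
Variable diag : seq (seq nat * nat).
Hypothesis diag_uniq :
  {in diag, forall l, uniq l.1 /\ {subset l.1 <= iota 0 (3 * M).+1}}.
Hypothesis diag_cover : {in diag, forall l, line_cover k es weight l.1 l.2}.
Hypothesis diag_pair : forall x i, x < M -> i < 3 ->
  exists2 l, l \in diag & (3 * x + i \in l.1) && (3 * half_sum x x + next_level i \in l.1).
Hypothesis diag_inf : forall P, P < 3 * M -> exists2 l, l \in diag & (P \in l.1) && (3 * M \in l.1).

Definition collinear (P Q : nat) : Prop :=
  exists2 l, l \in triple_lines ++ diag & (P \in l.1) && (Q \in l.1).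

Lemma collinearC P Q : collinear P Q -> collinear Q P.
Proof. by case=> l ll h; exists l; rewrite // andbC. Qed.

Lemma collinear_diag P Q :
  (exists2 l, l \in diag & (P \in l.1) && (Q \in l.1)) -> collinear P Q.
Proof. by case=> l ld h; exists l; rewrite // mem_cat ld orbT. Qed.

Lemma collinear_triple i x y P Q : i < 3 -> x < y < M ->
  P \in triple i x y -> Q \in triple i x y -> collinear P Q.
Proof.
move=> i3 xyM hP hQ; exists (triple i x y, triple_cost i x y); last by rewrite hP.
by rewrite mem_cat; apply/orP; left; apply/triple_linesP; exists i, x, y.
Qed.

Lemma collinear_same_level x y i :
  i < 3 -> x < M -> y < M -> x != y -> collinear (3 * x + i) (3 * y + i).
Proof.
move=> i3; wlog xy : x y / x < y => [W xM yM ne|xM yM _].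
  have [xy|yx|E] := ltngtP x y; [exact: W | | by rewrite E eqxx in ne].
  by apply: collinearC; apply: W; rewrite // eq_sym.
by apply: (@collinear_triple i x y); rewrite ?xy // !inE eqxx ?orbT.
Qed.

Lemma collinear_next_level x z i :
  i < 3 -> x < M -> z < M -> collinear (3 * x + i) (3 * z + next_level i).
Proof.
move=> i3 xM zM; have [y yM <-] := half_sum_solvable xM zM.
have [xy|yx|->] := ltngtP x y; last exact/collinear_diag/diag_pair.
- by apply: (@collinear_triple i x y); rewrite ?xy // !inE eqxx ?orbT.
by apply: (@collinear_triple i y x); rewrite ?yx // 1?half_sumC !inE eqxx ?orbT.
Qed.

Lemma collinear_points P Q : P < (3 * M).+1 -> Q < (3 * M).+1 -> P != Q -> collinear P Q.
Proof.
rewrite !ltnS [P <= _]leq_eqVlt [Q <= _]leq_eqVlt => /predU1P[->|PM] /predU1P[->|QM] //.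
- by rewrite eqxx.
- by move=> _; apply/collinearC/collinear_diag/diag_inf.
- by move=> _; apply/collinear_diag/diag_inf.
have level R : R < 3 * M -> exists x i, [/\ x < M, i < 3 & R = 3 * x + i].
  by move=> RM; exists (R %/ 3), (R %% 3); split; lia.
have [x [i [xM i3 ->]]] := level P PM; have [y [j [yM j3 ->]]] := level Q QM => ne.
have [ij|ij] := eqVneq i j; first by subst j; apply: collinear_same_level => //; lia.
have [->|jN] := eqVneq j (next_level i); first exact: collinear_next_level.
have -> : i = next_level j by move: ij jN; rewrite /next_level; do ?case: ifP; lia.
exact/collinearC/collinear_next_level.
Qed.

Lemma sum_weight : \sum_(P <- iota 0 (3 * M).+1) weight P = 1 + w1 + w2 + 30 * (3 * M - 3) + winf.
Proof.
have ordinary : \sum_(P <- iota 3 (3 * M - 3)) weight P = 30 * (3 * M - 3).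
  rewrite (eq_big_seq (fun=> 30)) => [|P]; first by rewrite sum_seq_const size_iota.
  by rewrite mem_iota => hP; have /andP[_ /eqP->//] : ordinary P by apply: ordinary_lt; lia.
have infinite : weight (3 * M) = winf by rewrite /weight eqxx ifN //; lia.
have -> : (3 * M).+1 = 3 + (3 * M - 3) + 1 by lia.
rewrite !iotaD !big_cat /= !big_cons !big_nil ordinary.
rewrite (_ : 0 + (3 + (3 * M - 3)) = 3 * M); last by lia.
by rewrite infinite /weight /=; lia.
Qed.

Lemma half_sum_cover :
  complete_cover k es (1 + w1 + w2 + 30 * (3 * M - 3) + winf)
    (\sum_(l <- triple_lines) l.2 + \sum_(l <- diag) l.2).
Proof.
rewrite -sum_weight -big_cat; apply: (linear_space_cover (line := fst) (cost := snd))=> // l.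
- rewrite mem_cat => /orP[/triple_linesP[i [x [y [i3 xyM ->]]]]|]; last exact: diag_uniq.
  exact: triple_uniq.
- rewrite mem_cat => /orP[/triple_linesP[i [x [y [i3 xyM ->]]]]|]; last exact: diag_cover.
  exact: triple_cover.
exact: collinear_points.
Qed.

End Diagonal.

Lemma triple_cost_row i y : 0 < y < M ->
  \sum_(x <- iota 0 y) triple_cost i x y + 90 * (M < 2 * y) =
  special_cost i + special_cost (next_level i) * (M < 2 * y) + 90 * (y - 1).
Proof.
move=> yM; have -> : y = 1 + (y - 1) by lia.
rewrite iotaD big_cat /= big_seq1 /triple_cost eqxx.
have := sum_seq_const_except (M - y) (special_cost (next_level i)) 90 (iota_uniq 1 (y - 1)).
rewrite mem_iota size_iota (_ : _ && _ = (M < 2 * y)); last by lia.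
rewrite -/(triple_cost _) (_ : 1 + (y - 1) = y); last by lia.
rewrite -addnA => E; rewrite -addnA; congr (_ + _); rewrite -E; congr (_ + _).
by apply: eq_big_seq => x; rewrite mem_iota => xy; rewrite ifN; [congr (if _ then _ else _)|]; lia.
Qed.

Lemma sum_upper_half : \sum_(y <- iota 1 M.-1) (M < 2 * y) = M.-1./2.
Proof.
set q := M.-1./2; have -> : M.-1 = (M.-1 - q) + q by rewrite /q; lia.
rewrite iotaD big_cat /= (eq_big_seq (fun=> 0)) => [|y]; last by rewrite mem_iota /q; lia.
rewrite [X in _ + X](eq_big_seq (fun=> 1)) => [|y]; last by rewrite mem_iota /q; lia.
by rewrite !sum_seq_const !size_iota mul0n mul1n.
Qed.

Lemma sum_triple_cost i :
  \sum_(y <- iota 1 M.-1) \sum_(x <- iota 0 y) triple_cost i x y + 90 * M.-1./2 =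
  special_cost i * M.-1 + special_cost (next_level i) * M.-1./2 + 90 * 'C(M.-1, 2).
Proof.
have E : \sum_(y <- iota 1 M.-1) (y - 1) = 'C(M.-1, 2).
  rewrite -bin2_sum -[X in iota X _]addn0 iotaDl big_map /index_iota subn0.
  by apply: eq_bigr => y _; rewrite addKn.
rewrite -sum_upper_half -E !big_distrr /= -[X in special_cost i * X](size_iota 1) -sum_seq_const.
rewrite -!big_split /=; apply: eq_big_seq => y; rewrite mem_iota => yM.
by apply: triple_cost_row; lia.
Qed.

Lemma sum_triple_lines :
  \sum_(l <- triple_lines) l.2 + 270 * (M - 1)./2 =
  (M - 1 + (M - 1)./2) * (121 + 2 * w1 + 2 * w2) + 135 * ((M - 1) * (M - 2)).
Proof.
rewrite subn1 -subn1 (_ : M - 2 = M.-1.-1) ?subn1; last by lia.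
have := mul_bin_diag M.-1 1; rewrite bin1 => ->.
rewrite big_allpairs_dep /= !big_cons big_nil !big_allpairs_dep /=.
have := sum_triple_cost 0; have := sum_triple_cost 1; have := sum_triple_cost 2.
by rewrite /special_cost /next_level /=; set h := M.-1./2; set N := M.-1; move: h N => h N; lia.
Qed.

End HalfSums.

(** * Exact covers *)

(* With 30 edges in every block, the count leaves no room for a pair to be covered twice. *)
Definition exact_cover (es : seq (nat * nat)) (n : nat) : Prop :=
  exists2 m, 60 * m = n * (n - 1) & complete_cover 20 es n m.

Section Orders.
Variables (es : seq (nat * nat)) (w1 w2 : nat).
Hypothesis cover_30 : multipartite_cover 20 es [:: 30; 30; 30] 90.
Hypothesis cover_61 : complete_cover 20 es 61 61.
Hypothesis cover_w1 : multipartite_cover 20 es [:: w1; 30; 30] (30 + 2 * w1).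
Hypothesis cover_w2 : multipartite_cover 20 es [:: w2; 30; 30] (30 + 2 * w2).

(* The lines through the pairs [(x, half_sum x x)]: for odd [M] the half-sum of [x] and [x] is [x];
   for [M = 2 * m] it is [x] when [x < m] and [x - m] otherwise, and the second case is left to the
   spokes. *)
Definition column (h : nat) : seq nat := [:: 3 * h; 3 * h + 1; 3 * h + 2].

Definition spoke (m i x : nat) : seq nat := [:: 3 * (2 * m); 3 * (m + x) + i; 3 * x + next_level i].

Definition extended_column (q mb mc h : nat) : seq nat * nat :=
  (rcons (column h) (3 * (2 * q).+1), if h == 0 then mb else mc).

Definition short_column (mb h : nat) : seq nat * nat := (column h, if h == 0 then mb else 90).

Definition spoke_line (q x i : nat) : seq nat * nat :=
  (spoke q.+1 i x, if x == 0 then special_cost w1 w2 (next_level i) else 90).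

Definition odd_diagonal (q mb mc : nat) : seq (seq nat * nat) :=
  [seq extended_column q mb mc h | h <- iota 0 (2 * q).+1].

Definition even_diagonal (q mb : nat) : seq (seq nat * nat) :=
  [seq short_column mb h | h <- iota 0 q.+1] ++
  [seq spoke_line q x i | x <- iota 0 q.+1, i <- iota 0 3].

Lemma weight_column M winf h i : 0 < h < M -> i < 3 -> weight M w1 w2 winf (3 * h + i) = 30.
Proof. by move=> hM i3; rewrite /weight !ifN //; lia. Qed.

Lemma odd_cover q winf mb :
  multipartite_cover 20 es [:: 30; 30; 30; winf] (90 + 3 * winf) ->
  complete_cover 20 es (1 + w1 + w2 + winf) mb ->
  complete_cover 20 es (1 + w1 + w2 + 30 * (3 * (2 * q).+1 - 3) + winf)
    (\sum_(l <- triple_lines (2 * q).+1 w1 w2) l.2 +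
     \sum_(l <- odd_diagonal q mb (90 + 3 * winf)) l.2).
Proof.
set M := (2 * q).+1 => cc cb.
have winfE : weight M w1 w2 winf (3 * M) = winf by rewrite /weight eqxx ifN // /M; lia.
have in_diag h : h < M ->
    extended_column q mb (90 + 3 * winf) h \in odd_diagonal q mb (90 + 3 * winf).
  by move=> hM; apply/mapP; exists h; rewrite ?mem_iota.
apply: half_sum_cover => //.
- move=> _ /mapP[h + ->]; rewrite mem_iota => hM; split=> [|P]; rewrite /= !inE ?mem_iota /M; lia.
- move=> _ /mapP[h + ->]; rewrite mem_iota => /= hM; have [->|h0] := eqVneq h 0.
    apply: line_cover_complete; rewrite //= ?inE ?winfE /M; first by lia.
    by rewrite /weight /= addn0 !addnA.
  have wE i : i < 3 -> weight M w1 w2 winf (3 * h + i) = 30 by apply: weight_column; lia.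
  apply: line_cover_multipartite; rewrite //= ?inE ?winfE ?wE //; try by rewrite /M; lia.
  by have := wE 0 isT; rewrite addn0 => ->.
- move=> x i xM i3; exists (extended_column q mb (90 + 3 * winf) x); first exact: in_diag.
  by rewrite /= !inE /half_sum /next_level /M; do ?case: ifP; lia.
move=> P PM; exists (extended_column q mb (90 + 3 * winf) (P %/ 3)).
  by apply: in_diag; lia.
by rewrite /= !inE; lia.
Qed.

Lemma odd_order q winf :
  multipartite_cover 20 es [:: 30; 30; 30; winf] (90 + 3 * winf) ->
  exact_cover es (1 + w1 + w2 + winf) -> exact_cover es (1 + w1 + w2 + winf + 180 * q).
Proof.
move=> cc [mb mbE cb]; have := odd_cover q cc cb; have := @sum_triple_lines (2 * q).+1 w1 w2 isT.
have -> : \sum_(l <- odd_diagonal q mb (90 + 3 * winf)) l.2 = mb + (90 + 3 * winf) * (2 * q).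
  rewrite big_map /= big_cons /=; congr (_ + _).
  rewrite (eq_big_seq (fun=> 90 + 3 * winf)) => [|h]; first by rewrite sum_seq_const size_iota.
  by rewrite mem_iota; case: eqP => //; lia.
have -> : (2 * q).+1 - 1 = 2 * q by lia.
have -> : (2 * q)./2 = q by lia.
have -> : (2 * q).+1 - 2 = 2 * q - 1 by lia.
have -> : 30 * (3 * (2 * q).+1 - 3) = 180 * q by lia.
have -> : 1 + w1 + w2 + 180 * q + winf = 1 + w1 + w2 + winf + 180 * q by lia.
move: (\sum_(l <- _) _) => T TE c; exists (T + (mb + (90 + 3 * winf) * (2 * q))) => //.
move: mbE; have -> : 1 + w1 + w2 + winf - 1 = w1 + w2 + winf by lia.
have -> : 1 + w1 + w2 + winf + 180 * q - 1 = w1 + w2 + winf + 180 * q by lia.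
move=> mbE; case: q TE {c} => [|q]; first by lia.
by rewrite (_ : 2 * q.+1 - 1 = 2 * q + 1); lia.
Qed.

Lemma column_cover M winf h : 0 < h < M -> line_cover 20 es (weight M w1 w2 winf) (column h) 90.
Proof.
move=> hM; rewrite /column -{1}[3 * h]addn0.
by apply: ordinary_line; rewrite ?/ordinary ?weight_column //= ?inE; lia.
Qed.

Lemma spoke_cover q i x : i < 3 -> x < q.+1 ->
  line_cover 20 es (weight (2 * q.+1) w1 w2 30) (spoke_line q x i).1 (spoke_line q x i).2.
Proof.
move=> i3 xq; rewrite /spoke_line /=; have [ni nn] := (next_level_lt i3, next_level_neq i3).
have inf : ordinary (2 * q.+1) w1 w2 30 (3 * (2 * q.+1)).
  by rewrite /ordinary /weight eqxx; case: ifP; lia.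
have [->|x0] := eqVneq x 0; last first.
  by apply: ordinary_line; rewrite ?inf ?ordinary_lt //= ?inE; lia.
rewrite /spoke addn0 muln0 add0n.
apply: (line_cover_perm (l := [:: next_level i; 3 * (2 * q.+1); 3 * q.+1 + i])).
- by rewrite /= !inE; lia.
- by rewrite (perm_catC [:: _] [:: _; _]).
by apply: special_line; rewrite ?inf ?ordinary_lt //; lia.
Qed.

Lemma even_cover q mb : complete_cover 20 es (1 + w1 + w2) mb ->
  complete_cover 20 es (1 + w1 + w2 + 30 * (3 * (2 * q.+1) - 3) + 30)
    (\sum_(l <- triple_lines (2 * q.+1) w1 w2) l.2 + \sum_(l <- even_diagonal q mb) l.2).
Proof.
move=> cb; have in_columns h : h < q.+1 -> short_column mb h \in even_diagonal q mb.
  by move=> hq; rewrite mem_cat; apply/orP; left; apply/mapP; exists h; rewrite ?mem_iota.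
have in_spokes x i : x < q.+1 -> i < 3 -> spoke_line q x i \in even_diagonal q mb.
  move=> xq i3; rewrite mem_cat; apply/orP; right; apply/allpairsP.
  by exists (x, i); rewrite !mem_iota.
apply: half_sum_cover => //.
- move=> l; rewrite mem_cat => /orP[/mapP[h + ->]|/allpairsP[[x i] [+ + ->]]]; rewrite !mem_iota.
    by move=> hq; split=> [|P]; rewrite /= !inE ?mem_iota; lia.
  rewrite /fst /snd => xq i3; have [ni nn] := (next_level_lt i3, next_level_neq i3).
  by split=> [|P]; rewrite /= !inE ?mem_iota; lia.
- move=> l; rewrite mem_cat => /orP[/mapP[h + ->]|/allpairsP[[x i] [+ + ->]]]; rewrite !mem_iota /=.
    move=> hq; have [->|h0] := eqVneq h 0; last by apply: column_cover; lia.
    by apply: line_cover_complete; rewrite //= ?inE /weight /= addn0 !addnA.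
  by move=> xq i3; apply: spoke_cover.
- move=> x i xM i3; have [xq|qx] := ltnP x q.+1.
    exists (short_column mb x); first exact: in_columns.
    by rewrite /= !inE /half_sum /next_level; do ?case: ifP; lia.
  exists (spoke_line q (x - q.+1) i); first by apply: in_spokes; lia.
  by rewrite /= !inE /half_sum; do ?case: ifP; lia.
move=> P PM; have [Pq|qP] := ltnP P (3 * q.+1).
  pose i := (P + 2) %% 3; have i3 : i < 3 by rewrite ltn_mod.
  exists (spoke_line q (P %/ 3) i); first by apply: in_spokes => //; lia.
  by rewrite /= !inE eqxx /next_level /i; case: ifP; lia.
pose x := P %/ 3 - q.+1; have i3 : P %% 3 < 3 by rewrite ltn_mod.
exists (spoke_line q x (P %% 3)); first by apply: in_spokes; rewrite /x //; lia.
by rewrite /= !inE eqxx /x; lia.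
Qed.

Lemma even_order q :
  exact_cover es (1 + w1 + w2) -> exact_cover es (1 + w1 + w2 + 60 * (3 * q + 2)).
Proof.
move=> [mb mbE cb]; have := even_cover q cb; have := @sum_triple_lines (2 * q.+1) w1 w2 isT.
have -> : \sum_(l <- even_diagonal q mb) l.2 = mb + 360 * q + (121 + 2 * w1 + 2 * w2).
  rewrite big_cat big_map big_allpairs_dep /= !big_cons /= !big_nil.
  rewrite (eq_big_seq (fun=> 90)) => [|h]; last by rewrite mem_iota; case: eqP => //; lia.
  rewrite [X in _ + (_ + X)](eq_big_seq (fun=> 270)) => [|h]; last first.
    by rewrite mem_iota !big_cons big_nil; case: eqP => //; lia.
  by rewrite !sum_seq_const size_iota /special_cost /next_level /=; lia.
have -> : 2 * q.+1 - 1 = 2 * q + 1 by lia.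
have -> : (2 * q + 1)./2 = q by lia.
have -> : 2 * q.+1 - 2 = 2 * q by lia.
have -> : 1 + w1 + w2 + 30 * (3 * (2 * q.+1) - 3) + 30 = 1 + w1 + w2 + 60 * (3 * q + 2) by lia.
move: (\sum_(l <- _) _) => T TE c; exists (T + (mb + 360 * q + (121 + 2 * w1 + 2 * w2))) => //.
move: mbE; have -> : 1 + w1 + w2 - 1 = w1 + w2 by lia.
have -> : 1 + w1 + w2 + 60 * (3 * q + 2) - 1 = w1 + w2 + 60 * (3 * q + 2) by lia.
by lia.
Qed.

Lemma all_orders : multipartite_cover 20 es [:: 30; 30; 30; 60] 270 ->
  exact_cover es (1 + w1 + w2) -> exact_cover es (1 + w1 + w2 + 60) ->
  forall t, exact_cover es (1 + w1 + w2 + 60 * t).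
Proof.
move=> cover_fan c0 c1 t; have tE : t = 3 * (t %/ 3) + t %% 3 by lia.
have : t %% 3 < 3 by rewrite ltn_mod.
case: (t %% 3) tE => [|[|[|//]]] tE _.
- have := @odd_order (t %/ 3) 0 (multipartite_cover_rcons0 cover_30).
  by rewrite !addn0 (_ : 60 * t = 180 * (t %/ 3)); [apply | lia].
- rewrite (_ : 1 + w1 + w2 + 60 * t = 1 + w1 + w2 + 60 + 180 * (t %/ 3)); last by lia.
  exact: odd_order.
by rewrite tE; apply: even_order.
Qed.

End Orders.

(** * Base blocks for the six snarks *)

(* The entry [p] of a base block stands for the point [(p %/ N, p %% N)], where [N] is the order of
   the group; the parts of the cover are recorded in the name of the field. *)
Record kit := Kit {
  kit_30_30_30 : seq (seq BinNums.N);
  kit_30_30_30_60 : seq (seq BinNums.N);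
  kit_39_30_30 : seq (seq BinNums.N);
  kit_45_30_30 : seq (seq BinNums.N);
  kit_60_30_30 : seq (seq BinNums.N);
  kit_25 : seq (seq BinNums.N);
  kit_40 : seq (seq BinNums.N);
  kit_61 : seq (seq BinNums.N);
  kit_76 : seq (seq BinNums.N);
  kit_85 : seq (seq BinNums.N);
  kit_121 : seq (seq BinNums.N);
  kit_25_25_25_25 : seq (seq BinNums.N);
  kit_24_24_24_24_39 : seq (seq BinNums.N);
  kit_24_24_24_24_24_24 : seq (seq BinNums.N);
  kit_40_40_40_40 : seq (seq BinNums.N)
}.

Definition generates es N orbits ws (m : nat) (bs : seq (seq BinNums.N)) : bool :=
  develops 20 es N orbits ws [seq [seq edivn p N | p : BinNums.N <- b] | b <- bs] &&
  (N * size bs == m).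

Definition complete_orbits (N f e : nat) : seq orbit :=
  [seq Orbit N (j * N) N | j <- iota 0 f] ++ nseq e (Orbit 1 (f * N) 1).

Definition kit_ok (es : seq (nat * nat)) (K : kit) : bool :=
  [&& [&& generates es 90 [:: Orbit 90 0 3] [:: 30; 30; 30] 90 (kit_30_30_30 K),
          generates es 90 [:: Orbit 90 0 3; Orbit 30 3 1; Orbit 30 3 1] [:: 30; 30; 30; 60] 270
            (kit_30_30_30_60 K),
          generates es 12 (nseq 5 (Orbit 12 1 2) ++ nseq 3 (Orbit 12 0 1) ++ [:: Orbit 3 0 1])
            [:: 39; 30; 30] 108 (kit_39_30_30 K),
          generates es 60 [:: Orbit 60 1 2; Orbit 30 0 1; Orbit 15 0 1] [:: 45; 30; 30] 120
            (kit_45_30_30 K) &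
          generates es 30 [:: Orbit 30 1 1; Orbit 30 2 1; Orbit 30 0 1; Orbit 30 0 1]
            [:: 60; 30; 30] 150 (kit_60_30_30 K)],
      [&& generates es 5 (complete_orbits 5 5 0) (nseq 25 1) 10 (kit_25 K),
          generates es 13 (complete_orbits 13 3 1) (nseq 40 1) 26 (kit_40 K),
          generates es 61 (complete_orbits 61 1 0) (nseq 61 1) 61 (kit_61 K),
          generates es 19 (complete_orbits 19 4 0) (nseq 76 1) 95 (kit_76 K) &
          generates es 17 (complete_orbits 17 5 0) (nseq 85 1) 119 (kit_85 K)] &
      [&& generates es 121 (complete_orbits 121 1 0) (nseq 121 1) 242 (kit_121 K),
          generates es 25 [seq Orbit 25 j 1 | j <- iota 0 4] (nseq 4 25) 125 (kit_25_25_25_25 K),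
          generates es 48 [:: Orbit 48 0 2; Orbit 48 2 2; Orbit 24 4 1; Orbit 12 4 1; Orbit 3 4 1]
            (rcons (nseq 4 24) 39) 240 (kit_24_24_24_24_39 K),
          generates es 144 [:: Orbit 144 0 6] (nseq 6 24) 288 (kit_24_24_24_24_24_24 K) &
          generates es 160 [:: Orbit 160 0 4] (nseq 4 40) 320 (kit_40_40_40_40 K)]].

Open Scope N_scope.

Definition kit_snark1 : kit := Kit
  [:: [:: 66;49;57;35;28;43;81;86;0;59;47;42;67;76;21;39;11;26;75;61]]
  [:: [:: 180;14;48;115;71;80;84;200;87;18;30;12;101;195;35;41;205;109;82;11];
   [:: 80;119;54;187;70;205;86;102;20;3;19;48;207;37;2;42;193;67;65;61];
   [:: 54;23;15;31;115;97;78;29;106;13;21;44;82;190;114;46;55;27;107;193]]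
  [:: [:: 58;93;32;53;97;55;56;31;40;48;50;54;94;29;34;36;88;37;91;45];
   [:: 65;22;31;62;32;3;11;44;49;89;74;63;16;56;15;82;66;2;53;13];
   [:: 77;10;43;74;44;15;23;32;49;95;62;75;4;56;3;70;78;14;53;1];
   [:: 90;2;17;89;26;50;80;84;39;73;77;72;21;48;18;31;96;83;28;34];
   [:: 84;14;5;95;38;50;68;90;27;61;65;60;9;48;6;43;96;71;40;46];
   [:: 60;26;1;90;32;49;13;40;17;76;67;88;30;44;45;9;86;63;28;23];
   [:: 72;38;13;84;44;49;1;28;5;64;79;94;42;32;33;21;92;75;40;11];
   [:: 0;86;6;79;33;67;37;82;7;69;3;51;56;14;1;41;70;96;8;40];
   [:: 12;92;18;67;45;79;25;70;19;81;15;51;56;2;13;29;82;96;20;28]]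
  [:: [:: 28;62;52;68;47;31;40;79;3;12;130;133;25;29;24;6;134;65;51;41];
   [:: 46;65;45;126;13;122;56;75;11;26;34;40;71;73;47;7;4;16;87;82]]
  [:: [:: 69;1;45;84;9;56;77;8;7;92;74;101;30;10;102;44;46;117;52;5];
   [:: 87;1;51;72;9;32;65;8;7;110;62;119;36;10;90;50;52;105;58;5];
   [:: 75;1;57;60;9;38;83;8;7;98;80;107;42;10;108;56;58;93;34;5];
   [:: 63;1;33;78;9;44;71;8;7;116;68;95;48;10;96;32;34;111;40;5];
   [:: 81;1;39;66;9;50;89;8;7;104;86;113;54;10;114;38;40;99;46;5]]
  [:: [:: 13;12;6;2;22;3;19;4;7;16;15;9;18;24;10;0;23;14;5;1];
   [:: 2;14;24;23;15;0;18;22;9;6;16;19;20;13;4;10;12;21;8;7]]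
  [:: [:: 17;26;4;12;8;7;2;19;1;29;23;25;33;31;20;6;0;18;21;28];
   [:: 29;24;31;12;2;34;20;17;5;38;30;1;13;15;28;9;16;35;32;39]]
  [:: [:: 35;0;23;47;39;3;7;36;32;55;33;43;58;57;38;48;10;51;50;37]]
  [:: [:: 37;43;10;18;49;23;66;70;63;3;27;74;40;46;55;71;69;1;41;50];
   [:: 39;0;35;66;50;40;71;37;74;61;36;54;57;28;60;46;70;27;3;24];
   [:: 57;2;27;20;74;37;6;35;58;52;8;1;15;7;34;51;56;16;65;3];
   [:: 70;7;60;72;16;43;44;13;20;64;1;33;56;50;22;18;9;68;19;30];
   [:: 16;45;0;27;36;40;43;22;71;56;32;49;19;61;7;15;30;12;53;66]]
  [:: [:: 72;52;33;0;21;27;78;65;37;4;73;77;47;66;13;60;40;70;79;39];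
   [:: 13;43;12;17;42;20;57;77;41;21;46;69;59;29;58;72;66;73;10;32];
   [:: 15;52;35;12;4;14;62;46;83;81;65;27;18;13;58;69;2;41;26;74];
   [:: 44;80;11;79;55;31;13;57;56;22;18;75;10;38;53;33;78;74;70;16];
   [:: 84;49;52;47;14;1;31;82;51;9;63;46;48;70;36;68;20;54;28;5];
   [:: 0;49;21;35;74;26;36;44;69;58;46;25;55;17;37;32;27;52;73;20];
   [:: 14;35;43;67;40;52;37;4;0;70;5;16;53;60;24;2;27;59;17;9]]
  [:: [:: 5;79;17;1;90;54;10;52;91;113;118;60;103;64;25;62;18;36;16;4];
   [:: 9;30;5;92;93;86;106;97;54;82;83;16;101;115;84;47;114;8;41;74]]
  [:: [:: 0;42;57;15;92;99;78;44;88;51;73;11;22;32;98;81;74;38;93;83];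
   [:: 13;45;1;40;63;50;74;60;51;0;5;29;27;18;24;30;39;87;43;53];
   [:: 44;17;71;23;78;91;74;92;69;20;60;43;8;2;63;27;5;1;79;84];
   [:: 98;65;33;78;7;40;49;2;47;56;11;57;51;84;89;32;67;23;93;48];
   [:: 78;3;72;82;13;18;38;97;31;99;86;41;56;69;30;44;94;11;71;51]]
  [:: [:: 22;87;2;48;118;74;151;119;193;63;154;85;45;80;6;18;7;53;37;4];
   [:: 97;49;151;52;67;56;110;90;61;146;24;75;95;27;39;147;113;4;31;9];
   [:: 0;87;98;60;146;76;192;66;117;44;29;53;14;34;39;3;26;57;115;84];
   [:: 50;20;58;8;57;71;89;17;53;56;1;27;149;115;72;48;0;28;98;103];
   [:: 23;108;55;13;105;98;68;149;115;56;8;78;113;81;2;45;7;88;27;44]]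
  [:: [:: 60;15;88;86;87;117;43;39;4;98;127;50;134;10;76;74;135;97;101;115];
   [:: 133;33;11;72;63;94;64;16;118;55;137;60;9;35;30;141;86;49;8;136]]
  [:: [:: 73;46;155;24;99;135;109;96;93;20;90;153;87;143;50;94;128;148;91;67];
   [:: 54;1;40;82;67;61;103;10;125;42;126;155;33;122;24;153;146;130;53;36]].

Definition kit_snark2 : kit := Kit
  [:: [:: 17;66;70;18;49;73;2;42;34;56;68;63;83;67;46;78;38;48;0;35]]
  [:: [:: 73;60;185;190;14;50;181;89;61;7;186;44;117;99;54;12;183;58;38;2];
   [:: 55;77;185;3;58;69;40;66;35;115;110;51;116;32;2;8;106;70;52;98];
   [:: 190;24;25;6;206;63;197;105;31;28;14;4;184;26;96;107;68;56;21;43]]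
  [:: [:: 50;14;53;88;3;74;1;97;52;54;11;92;19;84;56;89;48;68;49;17];
   [:: 0;21;78;39;87;66;6;24;83;17;19;82;48;93;32;64;56;85;35;36];
   [:: 12;9;66;27;93;78;18;36;71;5;7;70;48;87;44;76;56;91;47;24];
   [:: 7;1;65;28;81;6;69;50;84;39;67;36;13;24;51;2;55;16;60;85];
   [:: 19;13;77;40;69;18;81;50;90;27;79;24;1;36;51;14;55;4;72;91];
   [:: 90;69;10;4;21;51;38;80;45;40;46;31;82;98;75;72;24;26;13;17];
   [:: 84;81;22;16;9;51;26;68;33;28;34;43;70;98;63;60;36;38;1;5];
   [:: 29;45;91;28;71;42;84;38;97;53;13;3;8;16;56;63;30;75;69;41];
   [:: 41;33;85;40;83;30;90;26;97;53;1;15;20;4;56;75;42;63;81;29]]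
  [:: [:: 61;56;1;22;131;28;72;71;23;54;64;17;85;5;59;3;0;34;87;122];
   [:: 36;122;27;65;46;59;38;64;52;19;83;23;120;75;42;3;134;35;11;22]]
  [:: [:: 58;73;18;98;7;107;10;71;6;39;43;49;117;2;85;8;72;4;56;112];
   [:: 12;14;108;74;55;33;98;41;29;62;114;56;81;24;7;36;113;53;37;66];
   [:: 0;85;33;80;41;86;7;87;39;3;10;116;11;58;57;79;34;93;90;22];
   [:: 47;14;81;116;32;13;87;23;42;70;102;51;68;43;31;2;101;9;16;104];
   [:: 103;4;30;5;75;16;92;65;34;55;76;32;117;2;15;43;12;59;105;118]]
  [:: [:: 19;22;2;7;16;4;18;24;8;21;13;0;23;11;12;3;5;14;15;9];
   [:: 21;1;2;10;4;22;14;18;16;20;19;8;11;6;15;12;0;7;9;24]]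
  [:: [:: 34;16;8;19;17;20;7;31;22;1;3;6;18;5;37;13;33;36;30;39];
   [:: 0;19;32;29;25;33;14;8;13;36;37;3;6;15;35;2;17;4;27;9]]
  [:: [:: 42;51;56;15;32;3;14;25;43;33;18;37;46;20;50;34;30;44;10;8]]
  [:: [:: 15;18;20;4;34;40;33;47;0;7;22;49;68;61;10;56;32;72;9;8];
   [:: 58;44;51;66;68;37;11;69;35;32;63;21;25;14;62;13;15;20;75;45];
   [:: 58;1;68;0;33;42;7;3;39;66;53;29;12;11;61;24;43;5;52;62];
   [:: 31;72;24;12;21;30;60;67;54;42;19;65;50;47;51;35;37;73;17;57];
   [:: 41;20;43;47;64;21;51;73;19;52;67;71;32;55;53;8;5;54;10;17]]
  [:: [:: 0;66;4;7;5;17;59;34;2;80;79;50;67;57;77;12;37;69;8;6];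
   [:: 46;77;83;48;49;52;6;84;60;74;58;82;0;23;61;26;54;78;43;57];
   [:: 30;79;84;68;44;77;57;81;37;47;27;18;61;63;34;48;15;26;72;11];
   [:: 49;14;82;21;27;1;80;53;34;23;32;41;56;12;20;22;66;19;39;68];
   [:: 0;13;23;21;39;54;16;26;74;1;4;58;22;65;3;68;53;37;32;25];
   [:: 35;64;43;47;7;82;55;26;2;84;10;71;58;44;19;45;39;0;3;22];
   [:: 79;1;9;75;19;54;40;62;61;21;58;50;63;48;76;38;24;17;32;74]]
  [:: [:: 68;107;26;79;108;78;9;113;115;36;25;17;50;64;99;28;21;93;16;43];
   [:: 110;61;80;9;44;71;34;93;33;111;13;85;97;31;112;72;117;22;5;6]]
  [:: [:: 20;4;61;29;68;87;65;16;94;95;7;25;21;43;89;32;99;70;51;86];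
   [:: 0;72;87;55;38;52;97;42;92;61;80;23;37;21;9;11;83;90;69;29];
   [:: 66;74;98;20;36;41;80;35;53;92;61;17;27;56;45;26;55;57;89;3];
   [:: 57;51;7;86;45;15;30;83;65;24;41;17;82;26;11;9;37;47;73;98];
   [:: 40;27;98;21;55;23;75;7;82;90;66;38;14;64;10;96;1;61;32;37]]
  [:: [:: 1;107;73;32;17;100;92;80;149;97;16;41;30;88;21;102;89;62;113;35];
   [:: 91;51;47;33;146;149;26;55;8;16;57;105;65;94;11;194;18;96;95;61];
   [:: 47;52;149;46;65;67;112;37;119;10;56;34;25;74;144;28;117;60;5;15];
   [:: 107;6;60;11;49;38;87;20;90;70;41;45;192;97;115;34;68;14;77;51];
   [:: 0;105;62;19;79;145;5;67;153;109;90;71;54;81;65;29;149;39;84;110]]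
  [:: [:: 62;105;142;55;34;85;0;87;10;59;17;110;125;92;61;75;19;108;30;73];
   [:: 34;81;127;29;32;8;91;118;43;24;130;95;75;141;114;49;136;76;71;89]]
  [:: [:: 62;6;83;53;103;31;84;45;8;116;132;99;89;2;113;66;1;138;87;139];
   [:: 30;73;3;16;71;91;80;9;67;112;86;11;28;83;32;133;8;62;50;40]].

Definition kit_snark3 : kit := Kit
  [:: [:: 82;70;65;36;11;89;42;30;88;1;75;41;34;51;20;54;63;23;43;25]]
  [:: [:: 97;201;30;9;10;33;20;79;115;53;181;82;8;86;182;32;56;25;63;100];
   [:: 75;62;115;50;72;23;92;60;112;58;195;65;25;88;107;12;201;33;27;188];
   [:: 194;93;37;61;72;2;46;206;29;70;103;62;12;33;14;197;67;115;189;13]]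
  [:: [:: 43;55;24;90;34;93;50;51;26;45;28;53;87;39;48;98;44;57;85;58];
   [:: 68;86;57;7;22;42;1;70;48;15;65;98;31;94;64;20;47;96;4;19];
   [:: 80;92;57;19;10;30;13;82;48;3;77;98;43;88;76;8;35;96;16;7];
   [:: 13;3;0;68;54;79;30;86;21;71;41;45;20;56;51;69;40;91;89;33];
   [:: 1;15;12;80;54;67;42;92;9;83;29;33;8;56;51;81;28;85;95;45];
   [:: 23;46;63;36;9;62;17;42;90;67;40;82;85;2;58;15;4;35;74;79];
   [:: 11;34;75;24;21;74;5;30;84;79;28;70;91;14;58;3;16;47;62;67];
   [:: 0;33;62;45;61;91;22;43;46;10;17;59;73;81;55;74;83;14;38;37];
   [:: 12;45;74;33;73;85;10;31;34;22;5;59;61;69;55;62;71;2;26;25]]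
  [:: [:: 6;87;19;126;35;70;58;120;12;76;7;55;16;121;48;68;26;128;11;51];
   [:: 52;39;70;53;20;87;34;3;121;76;25;17;69;55;49;28;24;59;79;74]]
  [:: [:: 0;63;35;92;3;65;34;61;31;64;2;93;40;4;6;30;37;12;91;94];
   [:: 0;81;41;116;3;83;40;79;37;82;2;117;46;4;6;36;43;12;115;118];
   [:: 0;69;47;110;3;71;46;67;43;70;2;111;52;4;6;42;49;12;109;112];
   [:: 0;87;53;104;3;89;52;85;49;88;2;105;58;4;6;48;55;12;103;106];
   [:: 0;75;59;98;3;77;58;73;55;76;2;99;34;4;6;54;31;12;97;100]]
  [:: [:: 10;7;3;0;23;16;18;4;5;22;2;20;13;9;17;14;12;6;21;19];
   [:: 1;0;16;18;24;23;2;15;11;22;8;5;6;7;10;13;17;4;20;12]]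
  [:: [:: 33;7;13;19;36;18;24;11;38;14;4;27;10;37;39;5;17;12;29;31];
   [:: 14;33;22;17;30;6;31;20;8;10;34;35;16;24;2;12;1;5;32;25]]
  [:: [:: 31;53;25;27;38;34;15;46;1;43;44;49;26;40;56;20;18;35;42;28]]
  [:: [:: 32;16;59;49;12;1;22;72;68;13;21;71;55;31;62;53;28;60;33;25];
   [:: 2;23;34;53;56;36;49;52;0;72;3;42;25;74;64;62;51;61;73;14];
   [:: 5;67;33;50;64;59;46;71;26;36;0;25;13;7;6;45;18;42;70;17];
   [:: 25;48;50;69;12;26;29;20;42;35;66;11;43;72;45;51;27;31;60;47];
   [:: 34;61;22;10;8;24;66;12;17;0;65;54;39;52;75;5;55;44;14;2]]
  [:: [:: 14;82;58;64;75;44;56;0;20;52;21;53;10;83;77;60;47;31;61;17];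
   [:: 59;43;7;25;83;38;1;72;35;41;30;10;42;65;79;78;76;14;9;0];
   [:: 6;69;47;61;35;65;80;26;56;43;84;16;81;62;25;79;75;48;40;5];
   [:: 11;45;50;33;73;57;71;61;10;55;32;21;22;24;40;47;20;84;18;48];
   [:: 32;69;15;8;40;68;17;14;2;64;10;4;59;62;51;30;73;31;53;74];
   [:: 0;29;77;34;61;15;42;5;1;44;38;22;21;65;60;31;26;11;40;64];
   [:: 84;7;80;36;38;82;26;68;55;42;74;67;64;37;13;31;32;27;34;2]]
  [:: [:: 0;21;103;56;111;96;50;110;15;27;51;82;115;98;87;86;4;52;19;88];
   [:: 24;108;15;71;27;91;102;120;101;40;20;68;32;2;57;119;19;11;54;25]]
  [:: [:: 4;38;59;43;67;63;75;28;18;80;21;46;56;87;62;14;79;33;19;60];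
   [:: 40;45;21;65;87;74;90;94;3;48;80;31;23;91;98;1;83;43;30;58];
   [:: 35;38;17;20;94;90;11;93;61;74;30;69;67;86;42;13;34;18;0;58];
   [:: 99;3;50;55;78;21;29;12;95;67;49;6;65;32;17;28;98;11;68;76];
   [:: 60;97;16;99;48;30;63;93;64;17;56;49;4;3;87;66;62;42;40;83]]
  [:: [:: 35;18;110;62;11;56;98;58;22;32;27;43;46;151;15;113;40;74;57;91];
   [:: 9;145;59;193;80;155;1;6;58;33;51;56;43;28;18;103;147;62;72;3];
   [:: 61;68;98;109;83;13;99;65;28;19;110;35;32;155;90;106;55;33;17;24];
   [:: 0;55;113;72;14;91;106;70;69;75;66;95;115;56;54;107;15;50;61;41];
   [:: 81;11;119;42;73;145;46;32;101;154;9;147;58;0;88;43;76;95;96;192]]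
  [:: [:: 128;133;70;101;86;64;9;116;7;29;132;97;121;20;129;95;30;82;115;111];
   [:: 109;11;3;34;1;27;18;126;33;114;139;58;122;56;7;132;13;96;129;53]]
  [:: [:: 31;105;128;16;87;96;102;115;129;157;42;19;108;112;159;101;124;5;133;154];
   [:: 25;6;116;124;1;56;137;83;105;35;149;20;48;135;146;71;47;134;145;96]].

Definition kit_snark4 : kit := Kit
  [:: [:: 22;26;54;74;48;32;87;5;51;50;49;83;39;59;6;13;30;25;46;84]]
  [:: [:: 93;39;70;75;76;27;96;45;34;41;192;24;108;80;5;183;191;83;67;73];
   [:: 26;63;108;69;195;55;29;57;73;84;188;52;79;209;36;205;111;81;4;89];
   [:: 95;40;21;39;200;79;90;7;77;72;107;20;110;190;53;114;192;18;13;35]]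
  [:: [:: 58;51;98;59;54;19;16;53;88;7;48;89;10;4;17;22;56;5;95;90];
   [:: 63;29;50;14;78;9;77;5;68;26;86;40;92;24;54;90;59;46;81;39];
   [:: 75;41;50;2;66;21;65;17;80;38;92;28;86;36;54;84;59;34;69;27];
   [:: 29;69;28;71;57;76;38;47;12;20;7;27;82;98;89;24;60;26;46;17];
   [:: 41;81;40;83;57;64;26;35;0;8;19;39;70;98;95;36;72;38;34;5];
   [:: 0;28;97;71;3;88;57;29;52;61;43;73;56;70;83;32;8;65;9;19];
   [:: 12;40;97;83;15;94;57;41;52;73;31;61;56;82;71;44;20;77;21;7];
   [:: 93;46;19;37;86;59;82;91;16;3;79;43;32;9;14;74;2;17;81;28];
   [:: 87;34;7;25;92;59;70;85;4;15;67;31;44;21;2;62;14;5;69;40]]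
  [:: [:: 10;16;126;1;79;27;67;4;124;50;61;32;62;30;18;68;37;2;121;51];
   [:: 75;47;48;23;79;51;18;131;42;5;74;41;50;45;36;123;54;69;61;38]]
  [:: [:: 0;61;35;64;33;62;32;91;3;93;2;95;38;60;94;5;31;6;1;39];
   [:: 0;79;41;82;39;80;38;109;3;111;2;113;44;78;112;5;37;6;1;45];
   [:: 0;67;47;70;45;68;44;97;3;99;2;101;50;66;100;5;43;6;1;51];
   [:: 0;85;53;88;51;86;50;115;3;117;2;119;56;84;118;5;49;6;1;57];
   [:: 0;73;59;76;57;74;56;103;3;105;2;107;32;72;106;5;55;6;1;33]]
  [:: [:: 16;6;10;19;5;3;9;17;7;0;11;1;23;13;14;4;2;21;24;8];
   [:: 19;12;15;2;16;21;17;7;18;1;13;20;22;23;4;6;8;10;24;14]]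
  [:: [:: 39;10;9;34;2;19;22;13;11;4;17;23;38;7;36;16;26;15;32;29];
   [:: 2;29;32;23;0;26;37;5;19;7;27;6;14;1;25;34;9;35;20;17]]
  [:: [:: 3;49;27;43;31;16;35;26;52;28;32;33;51;37;4;38;41;0;48;6]]
  [:: [:: 35;53;38;51;71;17;21;47;1;69;68;42;13;46;34;32;59;26;45;57];
   [:: 44;53;66;4;55;50;19;16;46;39;17;43;1;37;57;0;69;3;38;13];
   [:: 65;34;19;3;22;12;48;35;6;73;33;43;36;67;25;51;8;16;52;44];
   [:: 13;19;57;22;32;6;61;35;70;2;37;72;41;67;56;62;59;23;20;46];
   [:: 10;67;37;5;22;68;63;15;30;65;1;75;16;25;72;48;47;57;18;11]]
  [:: [:: 0;21;74;33;82;44;55;3;58;49;35;40;28;46;23;47;72;30;20;9];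
   [:: 46;60;55;83;40;52;70;80;13;25;19;74;7;78;39;5;50;15;77;2];
   [:: 77;75;9;26;45;83;62;61;42;2;59;68;22;14;35;50;28;54;56;23];
   [:: 58;67;4;22;7;9;49;35;27;2;60;80;66;28;51;61;40;44;34;5];
   [:: 74;4;65;60;23;20;68;70;12;9;42;27;7;41;1;31;18;13;80;66];
   [:: 57;53;54;7;37;72;43;60;31;73;17;11;62;42;0;1;22;66;29;28];
   [:: 20;51;38;37;71;67;84;43;1;69;79;17;44;73;33;57;81;72;76;12]]
  [:: [:: 77;74;58;107;62;68;78;19;67;114;57;72;94;102;39;93;12;108;34;46];
   [:: 14;106;93;51;114;91;21;78;101;20;3;116;23;11;86;118;44;16;45;40]]
  [:: [:: 55;2;26;99;36;93;49;59;16;51;4;86;34;31;54;1;10;75;78;67];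
   [:: 91;9;66;56;38;71;47;83;2;97;1;16;69;28;60;33;39;87;21;0];
   [:: 43;38;92;71;80;4;69;63;11;54;40;14;42;55;24;83;51;97;87;6];
   [:: 0;82;37;51;9;75;60;72;88;95;39;22;49;45;18;92;77;5;54;61];
   [:: 94;91;41;67;9;64;34;99;35;55;42;4;7;75;68;49;83;32;48;22]]
  [:: [:: 86;56;97;148;31;8;73;94;9;114;62;194;37;85;17;48;0;84;116;2];
   [:: 26;109;53;9;16;1;62;103;42;118;70;46;31;75;89;144;193;36;52;68];
   [:: 150;32;51;57;103;54;146;1;46;59;10;61;113;11;154;38;74;22;71;111];
   [:: 81;119;15;40;11;117;77;145;80;154;64;116;21;89;101;67;30;111;19;41];
   [:: 0;10;63;51;31;39;113;8;50;93;78;70;7;77;22;65;12;84;147;98]]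
  [:: [:: 88;96;11;75;110;121;98;15;31;42;52;69;73;74;63;12;133;26;136;82];
   [:: 33;27;8;38;72;88;66;40;23;92;42;104;93;63;35;76;41;102;14;128]]
  [:: [:: 7;50;104;36;61;98;121;137;58;23;113;116;146;16;4;31;110;80;69;62];
   [:: 121;154;4;66;133;48;51;150;92;20;130;125;39;105;131;86;63;122;70;88]].

Definition kit_snark5 : kit := Kit
  [:: [:: 9;11;64;32;33;35;24;71;37;79;31;82;17;50;69;15;41;36;58;67]]
  [:: [:: 73;87;111;66;105;14;180;77;209;61;67;53;42;93;39;84;112;2;76;193];
   [:: 27;36;94;32;207;26;182;53;19;88;113;61;201;107;59;57;203;24;25;187];
   [:: 194;109;39;59;33;56;54;86;45;88;40;31;96;91;63;199;83;16;79;35]]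
  [:: [:: 42;59;69;57;96;63;56;39;89;49;50;78;33;87;54;81;53;36;30;27];
   [:: 35;61;18;69;25;66;26;83;28;50;21;73;59;15;1;2;32;30;90;79];
   [:: 47;73;6;81;37;78;38;71;40;50;9;61;59;3;13;14;44;42;84;67];
   [:: 25;1;58;8;69;98;26;94;11;17;21;43;42;38;75;95;20;66;47;55];
   [:: 37;13;58;20;81;98;38;88;23;5;9;31;30;26;63;89;8;78;35;55];
   [:: 93;44;37;48;89;4;64;74;17;23;3;34;86;82;18;16;72;49;55;67];
   [:: 87;32;25;48;95;16;76;62;5;11;15;46;92;70;6;4;60;49;55;79];
   [:: 0;54;82;97;13;15;78;37;26;34;91;4;72;95;21;1;89;46;36;73];
   [:: 12;54;70;97;1;3;66;25;38;46;85;16;60;89;9;13;95;34;24;61]]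
  [:: [:: 14;55;132;47;86;59;46;49;79;5;52;121;9;16;131;51;32;124;65;30];
   [:: 39;64;10;130;5;84;17;66;58;71;1;63;41;59;43;36;38;22;79;70]]
  [:: [:: 46;36;114;28;80;111;4;21;107;7;54;64;23;50;119;65;43;74;9;52];
   [:: 52;42;108;28;68;105;4;21;101;7;30;82;23;56;113;83;49;62;9;58];
   [:: 58;48;102;28;86;99;4;21;95;7;36;70;23;32;107;71;55;80;9;34];
   [:: 34;54;96;28;74;93;4;21;119;7;42;88;23;38;101;89;31;68;9;40];
   [:: 40;30;90;28;62;117;4;21;113;7;48;76;23;44;95;77;37;86;9;46]]
  [:: [:: 23;24;10;21;9;11;8;14;19;6;7;22;18;15;1;12;17;0;3;4];
   [:: 18;2;14;12;23;15;21;17;10;24;7;11;0;4;16;3;5;22;6;9]]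
  [:: [:: 13;16;26;24;6;21;20;33;10;35;30;31;23;3;2;9;19;28;12;4];
   [:: 19;38;8;22;29;4;30;36;37;31;5;16;10;15;25;12;0;32;21;39]]
  [:: [:: 41;10;45;8;13;48;27;25;19;51;35;29;11;2;42;20;58;33;21;6]]
  [:: [:: 70;46;26;36;18;2;74;27;62;1;8;49;57;63;38;64;6;20;41;16];
   [:: 30;28;38;26;6;52;16;33;54;15;18;1;51;75;70;7;64;49;45;56];
   [:: 69;21;57;56;14;65;47;67;46;75;26;36;54;41;17;15;22;29;28;62];
   [:: 19;54;2;10;20;67;64;9;49;66;25;62;30;14;58;75;12;68;39;28];
   [:: 36;35;25;20;14;19;52;32;55;9;5;57;41;66;38;8;58;54;7;53]]
  [:: [:: 51;17;6;73;70;38;48;20;79;59;42;15;74;23;76;21;50;19;81;31];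
   [:: 82;71;73;83;51;25;59;4;27;66;8;32;38;45;52;13;76;28;2;37];
   [:: 66;63;21;40;25;11;20;3;82;43;30;71;38;34;31;8;22;49;72;29];
   [:: 0;57;34;14;61;36;41;54;44;20;72;66;31;84;4;16;35;30;59;52];
   [:: 73;52;41;45;6;77;2;13;3;83;36;84;12;31;67;65;57;50;25;17];
   [:: 45;76;46;68;39;20;8;80;59;36;67;79;1;71;29;48;16;57;65;66];
   [:: 56;46;51;75;9;16;0;57;5;11;58;20;66;19;78;7;68;12;22;39]]
  [:: [:: 77;15;60;23;34;22;59;69;21;6;10;120;25;16;28;89;96;107;31;57];
   [:: 120;83;86;46;60;85;91;104;53;29;21;78;58;50;81;101;6;25;7;65]]
  [:: [:: 12;35;91;90;8;77;70;47;15;82;10;25;53;11;54;71;19;49;44;2];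
   [:: 48;36;94;65;98;6;99;44;16;30;51;72;78;10;19;32;38;25;68;89];
   [:: 45;13;63;94;56;81;27;98;21;32;62;4;60;55;80;77;57;97;43;25];
   [:: 69;34;10;78;56;7;72;67;27;40;42;6;87;11;24;12;54;57;95;75];
   [:: 0;52;97;34;76;67;81;8;99;15;88;56;5;69;41;43;82;48;22;74]]
  [:: [:: 30;81;1;153;70;76;103;99;90;67;6;77;115;50;194;102;43;59;49;15];
   [:: 149;95;11;60;7;17;32;12;53;75;68;100;27;54;3;47;65;87;194;106];
   [:: 52;119;14;2;29;77;19;73;114;64;28;22;39;0;112;75;11;149;153;94];
   [:: 0;59;106;102;32;65;153;66;37;75;146;29;144;9;148;6;52;82;87;15];
   [:: 113;28;3;69;99;85;119;55;27;84;0;35;40;36;105;104;74;49;43;92]]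
  [:: [:: 140;101;34;33;108;18;15;36;67;25;129;97;8;78;11;113;84;57;130;37];
   [:: 101;48;58;72;87;78;73;102;142;60;22;105;6;19;117;3;116;10;66;38]]
  [:: [:: 135;147;82;114;148;74;157;53;27;47;156;76;5;89;34;3;29;22;48;136];
   [:: 133;151;136;144;126;102;28;61;111;77;104;79;88;107;83;90;149;142;52;21]].

Definition kit_snark6 : kit := Kit
  [:: [:: 85;28;42;75;47;44;60;82;62;21;61;26;23;63;46;14;65;43;19;57]]
  [:: [:: 79;95;59;204;67;112;53;110;22;3;65;27;15;102;38;19;203;29;77;84];
   [:: 60;75;199;101;2;79;93;87;17;111;205;40;109;183;41;49;45;53;36;70];
   [:: 38;59;191;99;9;36;207;62;26;37;41;202;84;75;200;48;205;47;112;85]]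
  [:: [:: 58;70;53;64;3;59;50;82;23;54;97;52;5;72;78;66;57;14;17;2];
   [:: 77;26;33;40;88;36;97;80;11;29;61;18;55;90;42;92;43;24;54;89];
   [:: 65;38;45;28;94;24;97;68;23;41;73;6;55;84;30;86;31;36;54;95];
   [:: 0;37;63;57;91;47;18;10;88;42;66;51;5;30;96;33;56;65;78;21];
   [:: 12;25;75;57;85;35;6;22;94;30;78;51;17;42;96;45;56;77;66;9];
   [:: 51;48;74;14;93;24;25;11;71;9;17;65;2;26;80;22;85;3;87;16];
   [:: 51;48;62;2;87;36;37;23;83;21;5;77;14;38;68;10;91;15;93;4];
   [:: 40;10;91;19;78;62;47;11;77;59;27;24;44;21;75;42;0;82;71;35];
   [:: 28;22;85;7;66;74;35;23;65;59;39;36;32;9;63;30;12;70;83;47]]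
  [:: [:: 55;44;88;4;7;68;1;19;134;85;40;74;126;3;50;59;41;14;52;124];
   [:: 75;68;58;52;17;39;18;127;23;62;71;22;16;132;3;50;55;77;9;63]]
  [:: [:: 0;3;62;61;35;91;34;5;1;95;33;92;97;30;7;6;60;36;64;41];
   [:: 0;3;80;79;41;109;40;5;1;113;39;110;115;36;7;6;78;42;82;47];
   [:: 0;3;68;67;47;97;46;5;1;101;45;98;103;42;7;6;66;48;70;53];
   [:: 0;3;86;85;53;115;52;5;1;119;51;116;91;48;7;6;84;54;88;59];
   [:: 0;3;74;73;59;103;58;5;1;107;57;104;109;54;7;6;72;30;76;35]]
  [:: [:: 24;19;21;16;18;9;10;20;3;1;11;13;15;22;5;2;6;7;4;14];
   [:: 6;3;9;17;14;22;5;16;23;1;12;11;7;2;21;15;19;4;24;13]]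
  [:: [:: 25;27;9;14;20;30;18;28;29;0;17;6;39;36;23;34;8;1;31;4];
   [:: 23;20;6;24;15;26;2;7;14;36;27;4;5;12;13;19;29;33;38;0]]
  [:: [:: 2;32;16;21;60;52;59;40;42;25;48;10;31;13;23;0;5;51;12;18]]
  [:: [:: 67;1;35;33;14;17;16;41;11;69;0;66;12;52;54;60;55;32;47;37];
   [:: 34;63;6;48;59;9;44;50;10;26;46;37;40;75;14;8;49;25;70;42];
   [:: 6;22;35;14;53;15;8;42;66;32;45;23;68;50;24;75;65;19;74;34];
   [:: 50;16;60;58;65;42;43;37;61;14;55;53;21;1;62;17;4;25;57;68];
   [:: 57;33;31;40;62;21;26;42;61;39;14;38;22;7;18;70;30;17;68;29]]
  [:: [:: 0;47;81;50;58;33;51;73;16;69;77;21;75;15;7;27;63;57;5;2];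
   [:: 55;32;70;35;18;5;46;69;28;1;19;56;23;9;22;38;27;16;62;47];
   [:: 48;55;46;3;51;66;63;16;69;17;6;81;10;36;77;45;41;83;9;72];
   [:: 79;30;75;5;51;44;80;53;56;38;47;15;69;76;43;46;71;0;73;24];
   [:: 40;51;80;15;68;50;29;22;57;78;44;4;32;30;2;24;17;47;46;60];
   [:: 62;34;35;46;63;55;80;84;50;61;36;27;73;2;25;29;59;54;17;19];
   [:: 64;31;18;33;84;42;4;15;66;7;81;54;55;75;56;16;44;1;3;32]]
  [:: [:: 106;118;44;18;22;83;8;76;20;39;40;90;31;33;59;13;49;97;71;100];
   [:: 33;3;34;36;42;75;97;106;28;6;105;0;85;35;25;117;38;20;1;78]]
  [:: [:: 84;55;35;10;89;53;43;59;64;21;42;20;0;93;29;70;69;82;47;1];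
   [:: 74;69;84;97;25;8;86;34;21;59;70;78;94;40;27;13;1;49;58;85];
   [:: 0;50;94;31;18;75;12;64;93;60;17;84;48;22;5;86;78;14;58;44];
   [:: 10;64;34;68;42;63;13;72;40;16;11;41;88;80;56;76;91;35;28;21];
   [:: 23;8;33;40;55;75;45;66;0;98;51;87;88;73;37;7;34;63;48;91]]
  [:: [:: 0;149;84;64;55;94;22;79;193;194;33;104;19;50;12;40;147;62;105;66];
   [:: 97;0;55;81;74;42;39;108;103;109;147;88;36;25;76;19;40;116;54;7];
   [:: 38;112;7;70;5;144;80;117;69;113;60;2;23;25;94;45;83;146;75;42];
   [:: 21;56;154;60;118;145;53;87;22;20;5;54;114;75;93;152;42;62;30;117];
   [:: 72;43;85;55;96;13;61;66;27;84;34;15;113;14;28;9;39;76;71;97]]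
  [:: [:: 116;67;107;94;131;84;32;31;111;135;104;105;117;82;19;4;70;11;66;21];
   [:: 56;53;103;112;45;1;42;64;133;30;44;127;90;108;33;35;11;21;135;104]]
  [:: [:: 124;11;1;35;20;123;144;74;97;145;110;77;4;95;38;100;136;69;45;119];
   [:: 141;83;90;102;17;42;0;41;11;40;36;79;87;157;146;59;58;29;2;121]].

Close Scope N_scope.

Definition index_edges (t : table) : seq (nat * nat) :=
  [seq (label_index e.1, label_index e.2) | e <- table_edges t].

Lemma snark1_kit : kit_ok (index_edges snark1) kit_snark1.
Proof. by vm_compute. Qed.

Lemma snark2_kit : kit_ok (index_edges snark2) kit_snark2.
Proof. by vm_compute. Qed.

Lemma snark3_kit : kit_ok (index_edges snark3) kit_snark3.
Proof. by vm_compute. Qed.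

Lemma snark4_kit : kit_ok (index_edges snark4) kit_snark4.
Proof. by vm_compute. Qed.

Lemma snark5_kit : kit_ok (index_edges snark5) kit_snark5.
Proof. by vm_compute. Qed.

Lemma snark6_kit : kit_ok (index_edges snark6) kit_snark6.
Proof. by vm_compute. Qed.

Section KitCovers.
Variables (es : seq (nat * nat)) (K : kit).
Hypothesis ok : kit_ok es K.

Lemma generates_cover N orbits ws m bs :
  generates es N orbits ws m bs -> multipartite_cover 20 es ws m.
Proof. by case/andP=> /develops_cover + /eqP<-; rewrite size_map. Qed.

Lemma kit_multipartite_covers :
  [/\ multipartite_cover 20 es [:: 30; 30; 30] 90, multipartite_cover 20 es [:: 30; 30; 30; 60] 270,
      multipartite_cover 20 es [:: 39; 30; 30] 108, multipartite_cover 20 es [:: 45; 30; 30] 120 &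
      multipartite_cover 20 es [:: 60; 30; 30] 150].
Proof.
by have /and3P[/and5P[/generates_cover ? /generates_cover ? /generates_cover ? /generates_cover ?
  /generates_cover ?] _ _] := ok.
Qed.

Lemma kit_cyclic_orders :
  [/\ complete_cover 20 es 25 10, complete_cover 20 es 40 26, complete_cover 20 es 61 61,
      complete_cover 20 es 76 95 & complete_cover 20 es 85 119] /\ complete_cover 20 es 121 242.
Proof.
have /and3P[_ /and5P[/generates_cover c25 /generates_cover c40 /generates_cover c61
  /generates_cover c76 /generates_cover c85] /and5P[/generates_cover c121 _ _ _ _]] := ok.
by do ?split; apply: complete_cover_singletons.
Qed.

Lemma kit_filled_orders :
  [/\ complete_cover 20 es 100 165, complete_cover 20 es 136 306, complete_cover 20 es 145 348 &
      complete_cover 20 es 160 424].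
Proof.
have /and3P[_ _ /and5P[_ /generates_cover c100 /generates_cover c136 /generates_cover c145
  /generates_cover c160]] := ok.
have [[c25 c40 _ _ _] _] := kit_cyclic_orders; split.
- by apply: (fill_parts (e := 0) (ms := nseq 4 10)) c100 _ => // -[|[|[|[|]]]].
- by apply: (fill_parts (e := 1) (ms := rcons (nseq 4 10) 26)) c136 _ => // -[|[|[|[|[|]]]]].
- by apply: (fill_parts (e := 1) (ms := nseq 6 10)) c145 _ => // -[|[|[|[|[|[|]]]]]].
by apply: (fill_parts (e := 0) (ms := nseq 4 26)) c160 _ => // -[|[|[|[|]]]].
Qed.

Lemma kit_orders n : n %% 60 \in [:: 1; 16; 25; 40] -> n <> 16 -> exact_cover es n.
Proof.
have [c30 c30_60 c39 c45 c60] := kit_multipartite_covers.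
have [[c25 c40 c61 c76 c85] c121] := kit_cyclic_orders.
have [c100 c136 c145 c160] := kit_filled_orders.
have orders w1 w2 : multipartite_cover 20 es [:: w1; 30; 30] (30 + 2 * w1) ->
    multipartite_cover 20 es [:: w2; 30; 30] (30 + 2 * w2) ->
    exact_cover es (1 + w1 + w2) -> exact_cover es (1 + w1 + w2 + 60) ->
    n %% 60 = (1 + w1 + w2) %% 60 -> 1 + w1 + w2 <= n -> exact_cover es n.
  move=> cw1 cw2 e0 e1 nE nn.
  have := all_orders c30 c61 cw1 cw2 c30_60 e0 e1 ((n - (1 + w1 + w2)) %/ 60).
  by rewrite (_ : 1 + w1 + w2 + 60 * _ = n) //; lia.
rewrite !inE => /or4P[] /eqP nE n16.
- have [n1|n1] := ltnP n 61; last by apply: (orders 30 30) => //; [exists 61 | exists 242].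
  have -> : n = 1 by lia.
  by exists 0; [| apply: covers0 => x y []; rewrite !mem_iota; lia].
- by apply: (orders 45 30) => //; [exists 95 | exists 306 | lia].
- have [n1|n1] := ltnP n 85; last by apply: (orders 39 45) => //; [exists 119 | exists 348].
  by have -> : n = 25 by [lia]; exists 10.
have [n1|n1] := ltnP n 100; last by apply: (orders 39 60) => //; [exists 165 | exists 424].
by have -> : n = 40 by [lia]; exists 26.
Qed.

End KitCovers.

(** * Designs from covers *)

Lemma complete_edgeP n (e : {set complete_graph n}) :
  reflect (exists u v : 'I_n, u != v /\ e = [set u; v]) (e \in edges (complete_graph n)).
Proof.
apply: (iffP imsetP) => [[[u v] + ->]|[u [v [uv ->]]]].
  by rewrite inE => uv; exists u, v.
by exists (u, v); rewrite ?inE.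
Qed.

Lemma card_complete_edges n : #|edges (complete_graph n)| = 'C(n, 2).
Proof.
rewrite -[X in 'C(X, 2)]card_ord -card_draws; apply: eq_card => e; rewrite inE.
exact/complete_edgeP/cards2P.
Qed.

Section FromCover.
Variables (G : sgraph) (k : nat) (es : seq (nat * nat)) (rank : G -> nat).
Hypothesis rank_inj : injective rank.
Hypothesis rank_lt : forall x, rank x < k.
Hypothesis edge_rank : forall x y, adj x y -> (rank x, rank y) \in es \/ (rank y, rank x) \in es.
Hypothesis rank_edge : forall e, e \in es -> exists x y, adj x y /\ e = (rank x, rank y).
Hypothesis es0 : 0 < size es.
Variables (n : nat) (x0 : complete_graph n).

Definition block_map (b : seq (complete_graph n)) (x : G) : complete_graph n := nth x0 b (rank x).

Definition block_edges (b : seq (complete_graph n)) : {set {set complete_graph n}} :=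
  [set [set block_map b p.1; block_map b p.2] | p : G * G & adj p.1 p.2].

Lemma block_map_inj b : size b = k -> uniq b -> injective (block_map b).
Proof.
by move=> sb ub x y /eqP; rewrite nth_uniq ?sb ?rank_lt // => /eqP/rank_inj.
Qed.

Lemma mem_block_edges b x y : adj x y -> [set block_map b x; block_map b y] \in block_edges b.
Proof. by move=> xy; apply/imsetP; exists (x, y); rewrite ?inE. Qed.

Lemma block_edges_sub b : size b = k -> uniq b -> block_edges b \subset edges (complete_graph n).
Proof.
move=> sb ub; apply/subsetP => _ /imsetP[[x y] + ->]; rewrite inE /= => xy.
apply/complete_edgeP; exists (block_map b x), (block_map b y); split=> //.
by apply: contraTneq xy => /(block_map_inj sb ub)->; rewrite adj_irrefl.
Qed.

Lemma card_block_edges b : #|block_edges b| <= size es.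
Proof.
rewrite -(size_map (fun e => [set nth x0 b e.1; nth x0 b e.2])).
apply: leq_trans (card_size _); apply: subset_leq_card; apply/subsetP => _ /imsetP[[x y] + ->].
rewrite inE /= => /edge_rank[h|h]; apply/mapP; first by exists (rank x, rank y).
by exists (rank y, rank x); rewrite //= setUC.
Qed.

Lemma joined_block_edges b u v : joined es b u v -> [set u; v] \in block_edges b.
Proof.
case/hasP=> e /rank_edge[x [y [xy ->]]] /orP[] /andP[] /eqP/(onth_nth x0)<- /eqP/(onth_nth x0)<-.
  exact: mem_block_edges.
by apply: mem_block_edges; rewrite adj_sym.
Qed.

Lemma block_edges_copy b : size b = k -> uniq b -> exists W : {set complete_graph n},
  is_subgraph W (block_edges b) /\ isomorphic_to G W (block_edges b).
Proof.
move=> sb ub; have inj := block_map_inj sb ub; exists (block_map b @: [set: G]); split.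
  split; first exact: block_edges_sub.
  by move=> _ /imsetP[[x y] _ ->]; apply/subsetP => z /set2P[]->; apply: imset_f.
exists (block_map b); split=> // x y; apply/idP/imsetP => [xy|[[x' y'] + E]].
  by exists (x, y); rewrite ?inE.
case/set2_inj: E => -[/inj-> /inj->]; rewrite inE // => xy; rewrite adj_sym; exact: xy.
Qed.

(* A cover with no more blocks than a design must be a design. *)
Lemma design_of_cover m : m * size es = 'C(n, 2) -> complete_cover k es n m ->
  exists D : {set {set {set complete_graph n}}}, is_design G D.
Proof.
move=> mE /(complete_cover_to (x0 : 'I_n) (enum_uniq 'I_n) (size_enum_ord n))[B [sB gB cB]].
pose D := [set F | F \in map block_edges B].
have DP F : F \in D -> exists2 b, size b = k /\ uniq b & F = block_edges b.
  by rewrite inE => /mapP[b /gB[sb ub _] ->]; exists b.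
have cov : cover D = edges (complete_graph n).
  apply/eqP; rewrite eqEsubset; apply/andP; split.
    by apply/bigcupsP => F /DP[b [sb ub] ->]; apply: block_edges_sub.
  apply/subsetP => e /complete_edgeP[u [v [uv ->]]].
  have [|b bB j] := cB u v; first by rewrite !mem_enum.
  by apply/bigcupP; exists (block_edges b); [rewrite inE map_f | apply: joined_block_edges].
have D0 : set0 \notin D.
  apply/negP => /DP[b _ /setP b0].
  have [x [y [xy _]]] := rank_edge (mem_nth (0, 0) es0).
  by have := b0 [set block_map b x; block_map b y]; rewrite mem_block_edges // inE.
have trivD : \sum_(F in D) #|F| <= #|cover D|.
  rewrite cov card_complete_edges -mE; apply: (@leq_trans (#|D| * size es)).
    by rewrite -sum_nat_const; apply: leq_sum => F /DP[b _ ->]; apply: card_block_edges.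
  by rewrite leq_mul2r -sB -(size_map block_edges) cardsE card_size orbT.
exists D; split; last by move=> F /DP[b [sb ub] ->]; apply: block_edges_copy.
by apply/and3P; split; rewrite ?cov // /trivIset eqn_leq trivD leq_card_cover.
Qed.

End FromCover.

(** * Necessary conditions *)

Section Necessary.
Variables (G : sgraph) (d n : nat) (D : {set {set {set complete_graph n}}}).
Hypothesis regularG : regular d G.
Hypothesis designD : is_design G D.

Definition incident (F : {set {set complete_graph n}}) (u : complete_graph n) :
    {set {set complete_graph n}} := [set e in F | u \in e].

Lemma card_incident_block F : F \in D -> exists2 f : G -> complete_graph n, injective f &
  forall u, #|incident F u| = (u \in f @: [set: G]) * d.
Proof.
move=> FD; have [_ /(_ F FD)[W [[Fe FW] [f [inj fW fadj]]]]] := designD.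
exists f => // u; have [/imsetP[x _ ->]|uW] := boolP (u \in f @: [set: G]); last first.
  apply: eq_card0 => e; rewrite inE; apply/negP => /andP[eF ue]; case/negP: uW; rewrite fW.
  exact: subsetP (FW e eF) u ue.
rewrite mul1n -(regularG x) -(card_in_imset (f := fun y => [set f x; f y])); last first.
  move=> y y'; rewrite !inE => xy xy' /set2_inj[[_ /inj//]|[/inj xE _]].
  by rewrite xE adj_irrefl in xy'.
apply: eq_card => e; rewrite inE; apply/andP/imsetP => [[eF xe]|[y + ->]]; last first.
  by rewrite inE => xy; rewrite -fadj set21.
have /complete_edgeP[u' [v' [_ eE]]] := subsetP Fe e eF.
have inW z : z \in e -> exists y, z = f y.
  by move=> ze; have := subsetP (FW e eF) z ze; rewrite -fW => /imsetP[y _ ->]; exists y.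
have [a aE] : exists y, u' = f y by apply: inW; rewrite eE set21.
have [b bE] : exists y, v' = f y by apply: inW; rewrite eE set22.
have ab : adj a b by rewrite fadj -aE -bE -eE.
move: xe; rewrite eE aE bE !inE !(inj_eq inj) => /orP[]/eqP->.
  by exists b; rewrite ?inE.
by exists a; rewrite ?inE 1?adj_sym // setUC.
Qed.

Lemma card_incident_complete u : #|incident (edges (complete_graph n)) u| = n - 1.
Proof.
have -> : n - 1 = #|[set~ u]| by rewrite cardsC1 card_ord subn1.
rewrite -(card_in_imset (f := fun v : 'I_n => [set u; v])); last first.
  by move=> v v'; rewrite !inE => vu vu' /set2_inj[[]//|[vE _]]; rewrite vE eqxx in vu'.
apply: eq_card => e; rewrite inE; apply/andP/imsetP => [[/complete_edgeP[a [b [ab ->]]]]|[v + ->]].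
  rewrite !inE => /orP[]/eqP->; first by exists b; rewrite ?inE // eq_sym.
  by exists a; rewrite ?inE // setUC.
rewrite in_setC1 => vu; split; last exact: set21.
by apply/complete_edgeP; exists u, v; rewrite eq_sym.
Qed.

Lemma sum_card_incident u : \sum_(F in D) #|incident F u| = n - 1.
Proof.
have [/and3P[/eqP cov triv _] _] := designD; rewrite -(card_incident_complete u) -cov.
have incidentE F : #|incident F u| = \sum_(e in F) (u \in e).
  by rewrite -sum1dep_card big_mkcondr; apply: eq_bigr => e _; case: (u \in e).
by rewrite incidentE big_trivIset //; apply: eq_bigr => F _.
Qed.

Lemma degree_dvd : 0 < n -> d %| n - 1.
Proof.
move=> n0; rewrite -(sum_card_incident (Ordinal n0)); apply: dvdn_sum => F FD.
by have [f _ ->] := card_incident_block FD; apply: dvdn_mull.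
Qed.

Lemma design_count : n * (n - 1) = #|D| * (#|G| * d).
Proof.
have -> : n * (n - 1) = \sum_(u : complete_graph n) \sum_(F in D) #|incident F u|.
  by rewrite (eq_bigr _ (fun u _ => sum_card_incident u)) sum_nat_const card_ord.
rewrite exchange_big -sum_nat_const; apply: eq_bigr => F FD.
have [f inj fE] := card_incident_block FD; rewrite (eq_bigr _ (fun u _ => fE u)) -big_distrl /=.
by congr (_ * _); rewrite -big_mkcond sum1_card card_imset // cardsT.
Qed.

Lemma design_order_ge : 1 < n -> #|G| <= n.
Proof.
move=> n1; have /card_gt0P[F FD] : 0 < #|D|.
  by rewrite lt0n; apply: contraTneq n1 => D0; have := design_count; rewrite D0 -leqNgt; nia.
by have [f inj _] := card_incident_block FD; have := leq_card f inj; rewrite card_ord.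
Qed.

End Necessary.

Lemma cubic20_design_order (G : sgraph) n (D : {set {set {set complete_graph n}}}) :
  regular 3 G -> #|G| = 20 -> 0 < n -> is_design G D ->
  n %% 60 \in [:: 1; 16; 25; 40] /\ n <> 16.
Proof.
move=> cubic card20 n0 dD; have := degree_dvd cubic dD n0; have := design_count cubic dD.
have := design_order_ge cubic dD; rewrite card20 => ge20 total three; split; last by lia.
have residues : all (fun r => (r %% 3 == 1) && (r * (r + 59) %% 60 == 0) ==>
  (r \in [:: 1; 16; 25; 40])) (iota 0 60) by vm_compute.
have := allP residues (n %% 60); rewrite mem_iota ltn_mod => /(_ isT)/implyP; apply.
apply/andP; split; first by lia.
rewrite modnMml -modnMmr modnDml modnMmr.
have -> : n * (n + 59) = n * (n - 1) + n * 60 by nia.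
by rewrite addnC modnMDl total modnMl.
Qed.

(** * Designs for the six snarks *)

Lemma snark_exact_cover t n : t \in snarks -> n %% 60 \in [:: 1; 16; 25; 40] -> n <> 16 ->
  exact_cover (index_edges t) n.
Proof.
move=> + n_residue n16; rewrite !inE => /or4P[/eqP->|/eqP->|/eqP->|/or3P[]/eqP->].
- exact: kit_orders snark1_kit n n_residue n16.
- exact: kit_orders snark2_kit n n_residue n16.
- exact: kit_orders snark3_kit n n_residue n16.
- exact: kit_orders snark4_kit n n_residue n16.
- exact: kit_orders snark5_kit n n_residue n16.
- exact: kit_orders snark6_kit n n_residue n16.
Qed.

Lemma snark_design (G : sgraph) t (phi : label -> G) n : t \in snarks -> #|G| = 20 ->
  injective phi -> (forall a b, adj (phi a) (phi b) = linked t a b) ->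
  0 < n -> exact_cover (index_edges t) n ->
  exists D : {set {set {set complete_graph n}}}, is_design G D.
Proof.
move=> ts card20 inj adjE n0 [m mE cm].
have /andP[/eqP size30 ut] : (size (table_edges t) == 30) && uniq (unzip1 t).
  have h : all (fun t => (size (table_edges t) == 30) && uniq (unzip1 t)) snarks by vm_compute.
  exact: allP h t ts.
have [g phiK gK] : bijective phi by apply: inj_card_bij inj _; rewrite card20 card_label.
have edgeE x y : adj x y = ((g x, g y) \in table_edges t) || ((g y, g x) \in table_edges t).
  by rewrite -{1}[x]gK -{1}[y]gK adjE linkedE !mem_table_edges.
apply: (@design_of_cover G 20 (index_edges t) (label_index \o g) _ _ _ _ _ n (Ordinal n0) m _ cm).
- exact: inj_comp (can_inj label_indexK) (can_inj gK).
- by move=> x /=; case: (g x).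
- move=> x y; rewrite edgeE.
  by case/orP=> /(map_f (fun e => (label_index e.1, label_index e.2))); [left | right].
- move=> _ /mapP[[a b] ab ->]; exists (phi a), (phi b); rewrite edgeE !phiK ab; split=> //.
  by rewrite /= !phiK.
- by rewrite size_map size30.
by rewrite size_map size30 bin2 -subn1 -mE; lia.
Qed.

Theorem theorem3 (G : sgraph) (hG : nontrivial_snark G) (hV : #|G| = 20)
    (n : nat) (hn : 0 < n) :
  (exists D : {set {set {set complete_graph n}}}, is_design G D) <->
  (n %% 60 \in [:: 1; 16; 25; 40]) /\ n <> 16.
Proof.
split=> [[D dD]|[n_residue n16]].
  by have [[_ _ cubic _] _ _] := hG; apply: cubic20_design_order cubic hV hn dD.
have [t t_snark [phi phi_inj phi_adj]] := nontrivial_snark20 hG hV.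
exact: snark_design t_snark hV phi_inj phi_adj hn (snark_exact_cover t_snark n_residue n16).
Qed.
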